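(* Let $\mathcal D=[H_-,H_+]\times[\sigma_-,\sigma_+]\subset(\tfrac12,1)\times(0,+\infty)$ have nonempty interior, and suppose Assumptions A and B (given in the context) hold. Then $v_n(H)=n^{-1/(4H+2)}$ is a lower rate of convergence over $\mathcal D$ for estimating $H$: there exists $c>0$ such that $$\liminf_{n\to\infty}\ \inf_{\widehat H}\ \sup_{(H,\sigma)\in\mathcal D}\mathbb P^n_{H,\sigma}\big[n^{1/(4H+2)}|\widehat H-H|\ge c\big]>0,$$ where the infimum is over all estimators $\widehat H$, i.e. real random variables measurable with respect to the sigma-field generated by $(Y^n_i)_{0\le i\le n}$.
   Context: **Model.** $W^H$ is fractional Brownian motion with Hurst parameter $H\in(0,1)$: the centered continuous Gaussian process with $\mathrm{Cov}(W^H_s,W^H_t)=\frac{\kappa(H)}2\{|t|^{2H}+|s|^{2H}-|t-s|^{2H}\}$, $\kappa(H)=\pi/(H\Gamma(2H)\sin(\pi H))$. For each $n\ge1$ and $(H,\sigma)\in\mathcal D$, a probability measure $\mathbb P^n_{H,\sigma}$ (expectation $\mathbb E^n_{H,\sigma}$) is given on a common space carrying a process $X=(X_t)_{t\ge0}$, with the law of $\sigma W^H$ under $\mathbb P^n_{H,\sigma}$, and real random variables $\xi^n_i$, $0\le i\le n$. The data are $Y^n_i=X_{i/n}+a(X_{i/n})\xi^n_i$, $i=0,\dots,n$, where $a:\mathbb R\to\mathbb R$ is a fixed function. **Assumption A.** (i) $a$ is bounded and continuously differentiable with bounded derivative. (ii) $X$ is adapted to a filtration $\mathcal F^n=(\mathcal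 F^n_t)_{t\ge0}$. (iii) $\xi^n_i$ is $\mathcal F^n_{(i+1)/n}$-measurable, $\mathbb E^n_{H,\sigma}[\xi^n_i|\mathcal F^n_{i/n}]=0$, $\mathbb E^n_{H,\sigma}[(\xi^n_i)^2|\mathcal F^n_{i/n}]=1$, and $\sup_{(H,\sigma)\in\mathcal D}\sup_{i,n}\mathbb E^n_{H,\sigma}[(\xi^n_i)^4]<\infty$. **Assumption B.** (i) $\inf_xa(x)>0$. (ii) Conditional on $X$, the variables $\xi^n_i$, $0\le i\le n$, are independent and absolutely continuous with $\mathcal C^2$ densities $x\mapsto\exp(-v_{i,n}(x))$ (where $v_{i,n}$ depends neither on $X$ nor on $(H,\sigma)$), which vanish at infinity, together with their derivatives, at a rate strictly faster than $1/x^2$; moreover $\sup_{i,n}\mathbb E\big[\big(\tfrac{d}{dx}v_{i,n}(\xi^n_i)\big)^2(1+|\xi^n_i|^2)\big]<\infty$, and the functions $\tfrac{d^2}{dx^2}v_{i,n}$ are Lipschitz continuous with Lipschitz constants independent of $i,n$. *)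

(* Defs.v *)
From HB Require Import structures.
From mathcomp Require Import all_boot all_order all_algebra.
From mathcomp Require Import all_classical all_reals all_analysis.

Set Implicit Arguments.
Unset Strict Implicit.
Unset Printing Implicit Defensive.

Import Order.TTheory GRing.Theory Num.Theory.
Import numFieldNormedType.Exports.

Local Open Scope classical_set_scope.
Local Open Scope ring_scope.

Definition measurable_wrt (T : Type) d' (T' : measurableType d')
    (G : set_system T) (f : T -> T') : Prop :=
  preimage_set_system setT f measurable `<=` G.

Definition sigma_generated (T : Type) d' (T' : measurableType d')
    (I : Type) (J : set I) (f : I -> T -> T') : set_system T :=
  <<s \bigcup_(i in J) preimage_set_system setT (f i) measurable >>.

Definition sub_sigma_algebra_of d (T : measurableType d) (G : set_system T) :=
  sigma_algebra setT G /\ G `<=` measurable.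

Definition filtration (R : realType) d (T : measurableType d)
    (F : R -> set_system T) : Prop :=
  (forall t, 0 <= t -> sub_sigma_algebra_of (F t)) /\
  (forall s t, 0 <= s -> s <= t -> F s `<=` F t).

(* g is a version of the conditional expectation E_P[Z | G] *)
Definition is_cond_exp (R : realType) d (T : measurableType d)
    (P : probability T R) (G : set_system T) (Z g : T -> R) : Prop :=
  [/\ P.-integrable setT (EFin \o Z),
      measurable_wrt G g,
      P.-integrable setT (EFin \o g) &
      forall A, G A ->
        (\int[P]_(w in A) (g w)%:E = \int[P]_(w in A) (Z w)%:E)%E].

Definition is_cond_prob (R : realType) d (T : measurableType d)
    (P : probability T R) (G : set_system T) (A : set T) (g : T -> R) : Prop :=
  is_cond_exp P G (\1_A) g.

Definition cond_independent (R : realType) d (T : measurableType d)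
    (P : probability T R) (G : set_system T) (I : finType) (Z : I -> T -> R) :
    Prop :=
  forall (B : I -> set R) (g : I -> T -> R),
    (forall i, measurable (B i)) ->
    (forall i, is_cond_prob P G (Z i @^-1` B i) (g i)) ->
    is_cond_prob P G (\bigcap_i (Z i @^-1` B i)) (fun w => \prod_i g i w).

(* Conditionally on G, Z has the nonrandom Lebesgue density p. *)
Definition has_cond_density (R : realType) d (T : measurableType d)
    (P : probability T R) (G : set_system T) (Z : T -> R) (p : R -> R) : Prop :=
  [/\ (forall x, 0 <= p x),
      measurable_fun setT p &
      forall B : set R, measurable B ->
        is_cond_prob P G (Z @^-1` B)
          (cst (\int[lebesgue_measure]_(x in B) p x))].

(* Variance 0 is treated apart since the library's normal_prob m 0 is the
   uniform law on [0, 1]. *)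
Definition gaussian (R : realType) d (T : measurableType d)
    (P : probability T R) (Z : T -> R) : Prop :=
  exists m s : R, forall A : set R, measurable A ->
    pushforward P Z A = if s == 0 then \d_m A else normal_prob m s A.

Definition gaussian_process (R : realType) d (T : measurableType d)
    (P : probability T R) (W : R -> {mfun T >-> R}) : Prop :=
  forall (k : nat) (t c : 'I_k -> R), (forall j, 0 <= t j) ->
    gaussian P (fun w => \sum_(j < k) c j * W (t j) w).

Definition Gamma (R : realType) (x : R) : R :=
  \int[lebesgue_measure]_(t in `]0, +oo[) (t `^ (x - 1) * expR (- t)).

Definition kappa (R : realType) (H : R) : R :=
  pi / (H * Gamma (2 * H) * sin (pi * H)).

Definition fbm_cov (R : realType) (H s t : R) : R :=
  kappa H / 2 *
  (`|t| `^ (2 * H) + `|s| `^ (2 * H) - `|t - s| `^ (2 * H)).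

(* Processes are indexed by R; only times t >= 0 are constrained. *)
Definition fbm (R : realType) d (T : measurableType d)
    (P : probability T R) (H : R) (W : R -> {mfun T >-> R}) : Prop :=
  [/\ gaussian_process P W,
      (forall t, 0 <= t -> ('E_P[W t] = 0)%E),
      (forall s t, 0 <= s -> 0 <= t ->
         covariance P (W s) (W t) = (fbm_cov H s t)%:E) &
      {ae P, forall w, {within `[0, +oo[, continuous (fun t => W t w)}}].

(* Under P, X has the law of sigma W^H *)
Definition scaled_fbm (R : realType) d (T : measurableType d)
    (P : probability T R) (H sigma : R) (X : R -> {mfun T >-> R}) : Prop :=
  exists2 W : R -> {mfun T >-> R}, fbm P H W &
    forall t, 0 <= t -> forall w, X t w = sigma * W t w.

Definition continuously_differentiable (R : realType) (f : R -> R) : Prop :=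
  (forall x, derivable f x 1) /\ continuous f^`()%classic.

Definition twice_continuously_differentiable (R : realType) (f : R -> R) :
    Prop :=
  (forall x, derivable f x 1) /\ continuously_differentiable f^`()%classic.

(* f x = o(1 / x ^ 2) as x tends to +oo and to -oo *)
Definition vanishes_faster_than_inv_sqr (R : realType) (f : R -> R) : Prop :=
  (x ^+ 2 * f x @[x --> +oo] --> 0) /\ (x ^+ 2 * f x @[x --> -oo] --> 0).

(* Below, a parameter (H, sigma) is a pair in R * R, the law of the experiment
   number n >= 1 under that parameter is P n (H, sigma), and the noise variables
   of that experiment are xi n i with i : 'I_n.+1, i.e. 0 <= i <= n. *)

Record assumption_A (R : realType) d (T : measurableType d)
    (D : set (R * R)) (P : nat -> R * R -> probability T R)
    (X : R -> {mfun T >-> R}) (xi : forall n, 'I_n.+1 -> {mfun T >-> R})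
    (a : R -> R) (F : nat -> R -> set_system T) : Prop := {
  A_bounded : bounded_fun a;
  A_C1 : continuously_differentiable a;
  A_bounded_derivative : bounded_fun a^`()%classic;
  A_filtration : forall n, (0 < n)%N -> filtration (F n);
  A_adapted : forall n, (0 < n)%N ->
    forall t, 0 <= t -> measurable_wrt (F n t) (X t);
  A_noise_measurable : forall n, (0 < n)%N -> forall i : 'I_n.+1,
    measurable_wrt (F n (i.+1%:R / n%:R)) (xi n i);
  A_noise_mean : forall n, (0 < n)%N -> forall (i : 'I_n.+1) theta, D theta ->
    is_cond_exp (P n theta) (F n (i%:R / n%:R)) (xi n i) (cst 0);
  A_noise_var : forall n, (0 < n)%N -> forall (i : 'I_n.+1) theta, D theta ->
    is_cond_exp (P n theta) (F n (i%:R / n%:R))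
      (fun w => xi n i w ^+ 2) (cst 1);
  A_noise_moment4 : exists M : R,
    forall n, (0 < n)%N -> forall (i : 'I_n.+1) theta, D theta ->
      ('E_(P n theta)[fun w => (xi n i w ^+ 4)%R] <= M%:E)%E
}.

Record assumption_B (R : realType) d (T : measurableType d)
    (D : set (R * R)) (P : nat -> R * R -> probability T R)
    (X : R -> {mfun T >-> R}) (xi : forall n, 'I_n.+1 -> {mfun T >-> R})
    (a : R -> R) (v : forall n, 'I_n.+1 -> R -> R) : Prop := {
  B_inf : 0 < inf (range a);
  B_independent : forall n, (0 < n)%N -> forall theta, D theta ->
    cond_independent (P n theta)
      (sigma_generated `[0, +oo[ X) (fun i : 'I_n.+1 => xi n i);
  B_density : forall n, (0 < n)%N -> forall (i : 'I_n.+1) theta, D theta ->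
    has_cond_density (P n theta)
      (sigma_generated `[0, +oo[ X) (xi n i) (fun x => expR (- v n i x));
  B_C2 : forall n, (0 < n)%N -> forall i : 'I_n.+1,
    twice_continuously_differentiable (fun x => expR (- v n i x));
  (* the density and its derivatives of order 1 and 2 *)
  B_decay : forall n, (0 < n)%N -> forall (i : 'I_n.+1) (j : 'I_3),
    vanishes_faster_than_inv_sqr (fun x => expR (- v n i x))^`(j)%classic;
  B_score_moment : exists M : R,
    forall n, (0 < n)%N -> forall (i : 'I_n.+1) theta, D theta ->
      ('E_(P n theta)[fun w =>
         ((v n i)^`()%classic (xi n i w) ^+ 2 * (1 + `|xi n i w| ^+ 2))%R] <= M%:E)%E;
  B_lipschitz : exists L : R,
    forall n, (0 < n)%N -> forall i : 'I_n.+1, L.-lipschitz (v n i)^`(2)%classic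
}.

Definition observation (R : realType) d (T : measurableType d)
    (X : R -> {mfun T >-> R}) (xi : forall n, 'I_n.+1 -> {mfun T >-> R})
    (a : R -> R) (n : nat) (i : 'I_n.+1) (w : T) : R :=
  X (i%:R / n%:R) w + a (X (i%:R / n%:R) w) * xi n i w.

Definition estimator (R : realType) d (T : measurableType d)
    (X : R -> {mfun T >-> R}) (xi : forall n, 'I_n.+1 -> {mfun T >-> R})
    (a : R -> R) (n : nat) : set (T -> R) :=
  [set est | measurable_wrt
     (sigma_generated [set: 'I_n.+1] (observation X xi a (n := n))) est].

(* Main.v *)
Require Import Defs.
From HB Require Import structures.
From mathcomp Require Import all_boot all_order all_algebra.
From mathcomp Require Import all_classical all_reals all_analysis.
From mathcomp Require Import measurable_realfun.
From mathcomp Require Import ring lra zify.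

Set Implicit Arguments.
Unset Strict Implicit.
Unset Printing Implicit Defensive.
Import Order.TTheory GRing.Theory Num.Theory.
Import numFieldNormedType.Exports.
Local Open Scope classical_set_scope.
Local Open Scope ring_scope.

(** Two-point method. An interior point (H0, s0) of D is compared with H1 = H0 - eps, eps of order
    n^(-1/(4 H0 + 2)), and with s1 chosen so that the spectral densities of the two signals agree at
    the frequency N = n^(1/(2 H0 + 1)) where the signal drowns in the noise. Since the covariance of
    fractional Brownian motion on the grid has convex second differences, it is diagonalised exactly
    by the Fourier basis of period 2n, with coefficients comparable to power laws. The N low
    frequencies are compared through the variances of the Gaussian coefficients, at a Hellinger cost
    of order N eps^2. On the high frequencies the same Gaussian variables drive both signals, whose
    squared distance has a mean of order N eps^2; the noise, of finite Fisher information, blurs it.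
    All costs are measured by the affinity sqrt (a b) + sqrt ((1 - a) (1 - b)) of the probabilities
    a, b of an event, which is multiplicative along products and mixtures. *)

(** No density of the law of the observations is ever computed: it is enough to bound the affinity
    of the two probabilities of every single event. The obstacle is that the two mechanisms act
    together. Given the Gaussian coefficients, the noise comparison costs a squared distance that
    must be averaged, but the low coefficients have different laws under the two parameters. The
    Gaussian comparison therefore keeps a third law, the normalised geometric mean of the two: the
    conditional affinity is integrated under it, and its variances are at most 2 whatever the ratio
    of the original ones. The other difficulty is a logarithm: two power laws that agree at N differ
    at frequency k by a relative error of order eps times ln (k / N). A factor y^b + y^(-b) with y =
    k / N absorbs it; b is a quarter of [p0 - 1], where p0 = 2 H0, small enough that the sums on
    both sides of N remain of order N. Exact diagonalisation, in place of a Toeplitz approximation,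
    keeps these bounds uniform in n and k. *)

Section CosineSums.
Variable R : realType.
Implicit Types (x : R) (m n : nat).

(** * Trigonometric sums and the Fejer kernel *)

Definition cosum x m : R := \sum_(a < m) cos (a%:R * x).
Definition sinsum x m : R := \sum_(a < m) sin (a%:R * x).
(** The squared modulus of the sum of exp(i a x) over a < m, that is m times the Fejer kernel of
    order m. *)
Definition fejer x m : R := cosum x m ^+ 2 + sinsum x m ^+ 2.

Definition distn (u v : nat) : nat := ((u - v) + (v - u))%N.

Lemma cos_distn x u v : cos ((distn u v)%:R * x) = cos ((u%:R - v%:R) * x).
Proof.
rewrite /distn; have [uv|vu] := leqP u v.
  rewrite (eqP (uv : (u - v)%N == 0%N)) add0n natrB// -cosN -mulNr opprB.
  by [].
have /eqP -> : (v - u)%N == 0%N by rewrite subn_eq0 ltnW.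
by rewrite addn0 natrB// ltnW.
Qed.

Lemma mul_sin_cosum x m :
  2 * sin (x / 2) * cosum x m = sin (m%:R * x - x / 2) + sin (x / 2).
Proof.
elim: m => [|m IH].
  by rewrite /cosum big_ord0 mulr0 mul0r sub0r sinN addNr.
rewrite /cosum big_ord_recr/= mulrDr -/(cosum x m) IH.
have -> : m.+1%:R * x - x / 2 = m%:R * x + x / 2 :> R.
  by rewrite -natr1; field.
by rewrite sinB sinD; ring.
Qed.

Lemma mul_sin_sinsum x m :
  2 * sin (x / 2) * sinsum x m = cos (x / 2) - cos (m%:R * x - x / 2).
Proof.
elim: m => [|m IH].
  by rewrite /sinsum big_ord0 mulr0 mul0r sub0r cosN subrr.
rewrite /sinsum big_ord_recr/= mulrDr -/(sinsum x m) IH.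
have -> : m.+1%:R * x - x / 2 = m%:R * x + x / 2 :> R.
  by rewrite -natr1; field.
by rewrite cosB cosD; ring.
Qed.

Lemma fejer_ge0 x m : 0 <= fejer x m.
Proof. by rewrite addr_ge0 ?sqr_ge0. Qed.

(** Multiplication by [2 * sin (x / 2)] telescopes both sums; the squares then add up to 2 - 2 cos
    (m x), which is at most 4. *)
Lemma fejer_le_sin x m : sin (x / 2) ^+ 2 * fejer x m <= 1.
Proof.
suff : (2 * sin (x / 2) * cosum x m) ^+ 2 +
       (2 * sin (x / 2) * sinsum x m) ^+ 2 <= 4.
  by rewrite /fejer !exprMn; lra.
rewrite mul_sin_cosum mul_sin_sinsum.
set u := _ - _; set w := x / 2.
have h1 := cos2Dsin2 u; have h2 := cos2Dsin2 w.
have h3 := cos_geN1 (u + w); rewrite cosD in h3.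
by rewrite -subr_ge0; nra.
Qed.

Lemma fejer_le_sqr x m : fejer x m <= m%:R ^+ 2.
Proof.
suff H : fejer x m <= m%:R ^+ 2 /\
         `|cosum x m| <= m%:R by case: H.
split; last first.
  rewrite (le_trans (ler_norm_sum _ _ _))//.
  rewrite (le_trans (ler_sum _ (fun i _ => cos_max _)))//.
  by rewrite sumr_const card_ord.
elim: m => [|m IH].
  by rewrite /fejer /cosum /sinsum !big_ord0 expr0n/= addr0.
rewrite /fejer /cosum /sinsum !big_ord_recr/= -/(cosum x m) -/(sinsum x m).
have h := cos2Dsin2 (m%:R * x).
set c := cos _ in h *; set s := sin _ in h *.
rewrite -natr1; move: IH; rewrite /fejer.
set A := cosum _ _; set B := sinsum _ _ => IH.
have m0 : 0 <= m%:R :> R by [].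
(* Adding the unit vector (c, s) to (A, B) raises the squared length by 1 plus twice this inner
   product, bounded by Cauchy-Schwarz in the plane. *)
suff : A * c + B * s <= m%:R by nra.
apply: ler_normlW; rewrite -[leRHS]ger0_norm// -ler_sqr ?nnegrE// !real_normK ?num_real//.
apply: le_trans IH.
have -> : A ^+ 2 + B ^+ 2 = (A ^+ 2 + B ^+ 2) * (c ^+ 2 + s ^+ 2) by rewrite h mulr1.
by rewrite -subr_ge0 (_ : _ - _ = (A * s - B * c) ^+ 2) ?sqr_ge0//; ring.
Qed.

Lemma cos_ge_quad x : 1 - x ^+ 2 / 2 <= cos x.
Proof.
have sin_le (t : R) : 0 <= t -> sin t <= t.
  move=> t0.
  have [|c _] := @MVT_segment R (@sin R) (@cos R) 0 t t0.
    by apply: continuous_subspaceT => z; exact: continuous_sin.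
  rewrite sin0 !subr0 => ->.
    by rewrite ler_piMl// cos_le1.
have -> : cos x = 1 - 2 * sin (x / 2) ^+ 2.
  have {1}-> : x = (x / 2) *+ 2 by rewrite -mulr_natr; field.
  rewrite cos_mulr2n; have := cos2Dsin2 (x / 2).
  by rewrite -mulr_natr; lra.
have : sin (x / 2) ^+ 2 <= (x / 2) ^+ 2.
  wlog x0 : x / 0 <= x.
    move=> H; have [|x0] := leP 0 x; first exact: H.
    have := H (- x); rewrite !mulNr sinN !sqrrN; apply.
    by rewrite oppr_ge0 ltW.
  have x20 : 0 <= x / 2 by rewrite divr_ge0.
  suff : - (x / 2) <= sin (x / 2).
    by have := sin_le _ x20; nra.
  have [h|h] := leP (x / 2) pi.
    by have := @sin_ge0_pi R (x / 2); rewrite x20 h => /(_ isT); lra.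
  have := sin_geN1 (x / 2); have := @pi_ge2 R; lra.
by rewrite !expr_div_n; lra.
Qed.

(** All phases are at most 1, so every cosine is at least 1/2 and nothing cancels. *)
Lemma fejer_ge x m : 0 <= x -> m%:R * x <= 1 -> m%:R ^+ 2 / 4 <= fejer x m.
Proof.
move=> x0 mx.
have H : m%:R / 2 <= cosum x m.
  rewrite /cosum -[m in leLHS]card_ord -sum1_card natr_sum mulr_suml ler_sum// => i _.
  have : 0 <= i%:R * x <= 1.
    rewrite mulr_ge0//= (le_trans _ mx)// ler_wpM2r// ler_nat ltnW//.
  move=> /andP[h1 h2].
  have := cos_ge_quad (i%:R * x); nra.
rewrite /fejer; have : 0 <= m%:R :> R by [].
have := sqr_ge0 (sinsum x m); nra.
Qed.

(** The double angle and the mean value theorem give sin x = x cos (x/2) cos c with x/2 and c in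
    [0, pi/4]; there each cosine is at least cos (pi/4), whose square is 1/2. *)
Lemma sin_ge_half x : 0 <= x <= pi / 2 -> x / 2 <= sin x.
Proof.
move=> /andP[x0 xp].
have c0 (t : R) : 0 <= t -> t <= pi / 4 -> cos (pi / 4) <= cos t.
  have pi0 := @pi_gt0 R.
  move=> t0 tp; rewrite leNgt; apply/negP => h.
  have : pi / 4 < t.
    by rewrite -(@ltr_cos R)//; rewrite in_itv/=; lra.
  by rewrite ltNge tp.
have cc : cos (pi / 4) ^+ 2 = 2^-1 :> R.
  have := @cos_mulr2n R (pi / 4); rewrite (_ : pi / 4 *+ 2 = pi / 2); last first.
    by rewrite -mulr_natr; field.
  by rewrite cos_pihalf -mulr_natr; lra.
have cp : 0 <= cos (pi / 4) :> R.
  by apply: cos_ge0_pihalf; have := @pi_gt0 R; lra.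
have -> : sin x = 2 * (cos (x / 2) * sin (x / 2)).
  by rewrite mulr_natl -sin_mulr2n; congr sin; rewrite -mulr_natr; field.
have x20 : 0 <= x / 2 by lra.
have h1 : cos (pi / 4) <= cos (x / 2) by apply: c0; lra.
have [|c] := @MVT_segment R (@sin R) (@cos R) 0 (x / 2) x20.
  by apply: continuous_subspaceT => z; exact: continuous_sin.
rewrite sin0 !subr0 in_itv/= => /andP[c1 c2] e.
have h2 : cos (pi / 4) <= cos c by apply: c0; lra.
rewrite e.
have : cos (pi / 4) ^+ 2 <= cos (x / 2) * cos c by rewrite expr2 ler_pM.
rewrite cc; nra.
Qed.

Lemma fejerE x m :
  fejer x m = \sum_(a < m) \sum_(b < m) cos ((distn a b)%:R * x).
Proof.
rewrite /fejer !expr2 {1}/cosum {1}/sinsum !mulr_suml -big_split/=.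
apply: eq_bigr => a _; rewrite !mulr_sumr -big_split/=.
by apply: eq_bigr => b _; rewrite cos_distn mulrBl cosB.
Qed.

Lemma cosum_prod x i i' :
  \sum_(a < i) \sum_(b < i') cos ((distn a b)%:R * x) =
  cosum x i * cosum x i' + sinsum x i * sinsum x i'.
Proof.
rewrite {1}/cosum {1}/sinsum !mulr_suml -big_split/=.
apply: eq_bigr => a _; rewrite !mulr_sumr -big_split/=.
by apply: eq_bigr => b _; rewrite cos_distn mulrBl cosB.
Qed.

(** The frequencies of the discrete Fourier transform of length [2 * n]. A period twice the length
    of the grid keeps the lags up to n free of aliasing. *)
Definition freq n (k : nat) : R := pi * k%:R / n%:R.

Lemma sum_cos_freq n l : (0 < n)%N -> (l < 2 * n)%N ->
  \sum_(k < 2 * n) cos (l%:R * freq n k) = (2 * n * (l == 0))%N%:R.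
Proof.
move=> n0 ln.
have n0' : n%:R != 0 :> R by rewrite pnatr_eq0 -lt0n.
have [->|l0] := eqVneq l 0%N.
  under eq_bigr do rewrite mul0r cos0.
  by rewrite sumr_const card_ord muln1.
rewrite muln0; set y := l%:R * freq n 1 : R.
have -> : \sum_(k < 2 * n) cos (l%:R * freq n k) = cosum y (2 * n).
  by apply: eq_bigr => k _; rewrite /y /freq; congr cos; field.
have s0 : sin (y / 2) != 0.
  rewrite gt_eqF// sin_gt0_pi//.
  have -> : y / 2 = pi * (l%:R / (2 * n)%:R).
    by rewrite /y /freq natrM; field.
  have l1 : l%:R < (2 * n)%:R :> R by rewrite ltr_nat.
  have l2 : 0 < l%:R :> R by rewrite ltr0n lt0n.
  rewrite mulr_gt0 ?pi_gt0 ?divr_gt0 ?(lt_trans l2 l1)//=.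
  by rewrite gtr_pMr ?pi_gt0// ltr_pdivrMr ?(lt_trans l2 l1)// mul1r.
have := mul_sin_cosum y (2 * n).
have -> : (2 * n)%:R * y - y / 2 = - (y / 2) + (pi *+ 2) *+ l.
  have -> : pi *+ 2 *+ l = pi * 2 * l%:R :> R by rewrite -[LHS]mulr_natr -[pi *+ 2]mulr_natr.
  by rewrite /y /freq natrM; field.
rewrite periodicn; last exact: sinD2pi.
by rewrite sinN addNr => /eqP; rewrite mulf_eq0 mulf_eq0 pnatr_eq0/= (negPf s0)/= => /eqP.
Qed.

Lemma sum_cos_freq2 n u w : (0 < n)%N -> (u + w < 2 * n)%N ->
  \sum_(k < 2 * n) cos (u%:R * freq n k) * cos (w%:R * freq n k) =
  (n * ((u == w) + (u + w == 0)))%N%:R.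
Proof.
move=> n0 uw.
transitivity (2^-1 * (\sum_(k < 2 * n) cos ((u + w)%N%:R * freq n k) +
                      \sum_(k < 2 * n) cos ((distn u w)%:R * freq n k))).
  rewrite -big_split mulr_sumr; apply: eq_bigr => k _ /=.
  by rewrite cos_distn natrD mulrDl mulrBl cosD cosB; field.
rewrite !sum_cos_freq//; last by rewrite /distn; lia.
have -> : (distn u w == 0)%N = (u == w) by rewrite /distn; lia.
by rewrite !natrM natrD; field.
Qed.

(** Fejer kernels are the discrete Fourier transforms of triangles, [(m - j)%N] being a positive
    part. Once the square is expanded, the sum over frequencies selects the pairs a, b < m with a =
    b + j and those with b = a + j; each kind has m - j members. *)
Lemma triangle_fejer n m j : (0 < n)%N -> (m <= n)%N -> (j <= n)%N -> (0 < m)%N ->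
  \sum_(k < 2 * n) cos (j%:R * freq n k) * fejer (freq n k) m =
  (2 * n * (m - j))%N%:R.
Proof.
move=> n0 mn jn m0.
under eq_bigr do rewrite fejerE mulr_sumr.
rewrite exchange_big/=.
under eq_bigr do under eq_bigr do rewrite mulr_sumr.
under eq_bigr do rewrite exchange_big/=.
transitivity (\sum_(a < m) \sum_(b < m)
   (n * ((b + j == a)%N + (a + j == b)%N))%N%:R : R).
  apply: eq_bigr => a _; apply: eq_bigr => b _.
  have := ltn_ord a; have := ltn_ord b => hb ha.
  (* No aliasing: [distn a b < m <= n] and [j <= n], so the two lags add up to less than the
     period. *)
  rewrite sum_cos_freq2//; last by rewrite /distn; lia.
  congr (n * _)%N%:R; rewrite /distn; lia.
under eq_bigr do rewrite -natr_sum -big_distrr big_split/=.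
rewrite -natr_sum -big_distrr big_split/= [in X in (_ + X)%N]exchange_big/= addnn -mul2n.
rewrite mulnA [(n * 2)%N]mulnC; congr (_ * _)%N%:R.
have E (b : 'I_m) : (\sum_(a < m) (a + j == b) = (j <= b))%N.
  have [jb|jb] := leqP j b.
    have h : (b - j < m)%N by have := ltn_ord b; lia.
    rewrite (bigD1 (Ordinal h))//= subnK// eqxx big1 ?addn0// => i.
    by rewrite -val_eqE/= => ib; apply/eqP; rewrite eqb0; lia.
  by rewrite big1// => i _; apply/eqP; rewrite eqb0; lia.
under eq_bigr do rewrite E.
rewrite -(big_mkord xpredT (fun b => nat_of_bool (j <= b)%N)).
elim: m {mn m0 E} => [|m IH]; first by rewrite big_geq.
by rewrite big_nat_recr//= IH; lia.
Qed.

End CosineSums.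

(** * Convex sequences: decomposition into triangles and exact diagonalisation *)

Section ConvexSequence.
Variable R : realType.
Implicit Types (d : nat -> R) (n m j : nat).

Definition bend d m : R := d m.+1 + d m.-1 - 2 * d m.

(** Summation by parts, twice. For a convex, decreasing and nonnegative sequence all the
    coefficients are nonnegative, which is Polya's criterion for positive definiteness. *)
Lemma convex_decomp d n j : (0 < n)%N -> (j <= n)%N ->
  d j = \sum_(1 <= m < n) bend d m * (m - j)%N%:R +
        (d n.-1 - d n) * (n - j)%N%:R + d n.
Proof.
move=> n0; elim: n n0 => // n IH _; rewrite leq_eqVlt => /predU1P[->|].
  rewrite subnn mulr0 addr0 big_nat_cond big1 ?add0r// => m /andP[/andP[m1 mn] _].
  by rewrite (_ : (m - n.+1 = 0)%N) ?mulr0//; lia.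
rewrite ltnS => jn.
case: n IH jn => [|n] IH jn.
  have -> : j = 0%N by lia.
  by rewrite big_geq//= subn0; ring.
rewrite big_nat_recr//= [LHS]IH// /bend/= (subSn jn) -natr1.
ring.
Qed.

(* Spectral weight of frequency k for the sequence d on a period 2n. *)
Definition spectral d n k : R :=
  \sum_(1 <= m < n) bend d m * fejer (freq R n k) m +
  (d n.-1 - d n) * fejer (freq R n k) n + (2 * n * (k == 0))%N%:R * d n.

(** Each triangle of [convex_decomp] is replaced by its Fejer kernel; the constant [d n] is carried
    by frequency 0 alone. *)
Lemma spectral_cos d n j : (0 < n)%N -> (j <= n)%N ->
  (2 * n)%N%:R * d j =
  \sum_(k < 2 * n) spectral d n k * cos (j%:R * freq R n k).
Proof.
move=> n0 jn; rewrite {1}(convex_decomp d n0 jn) /spectral.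
under [RHS]eq_bigr do rewrite mulrDl mulrDl.
rewrite !big_split/= !mulrDr; congr (_ + _ + _).
- under [RHS]eq_bigr do rewrite mulr_suml.
  rewrite [RHS]exchange_big/= mulr_sumr; apply: eq_big_nat => m /andP[m1 mn].
  rewrite mulrCA -natrM -(triangle_fejer R n0 (ltnW mn))// mulr_sumr.
  by apply: eq_bigr => k _; ring.
- rewrite mulrCA -natrM -(triangle_fejer R n0 (leqnn n))// mulr_sumr.
  by apply: eq_bigr => k _; ring.
- have h : (0 < 2 * n)%N by lia.
  rewrite (bigD1 (Ordinal h))//= muln1 big1 ?addr0.
    by rewrite /freq mulr0 mul0r mulr0 cos0 mulr1.
  by move=> k; rewrite -val_eqE/= => /negPf ->; rewrite muln0 !mul0r.
Qed.

(** Summing a stationary covariance over two index ranges gives the covariance of partial sums: the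
    frequencies remain uncoupled when increments are summed back to the process. *)
Lemma spectral_cov d n i i' : (0 < n)%N -> (i <= n)%N -> (i' <= n)%N ->
  (2 * n)%N%:R * \sum_(l < i) \sum_(l' < i') d (distn l l') =
  \sum_(k < 2 * n) spectral d n k *
    (cosum (freq R n k) i * cosum (freq R n k) i' +
     sinsum (freq R n k) i * sinsum (freq R n k) i').
Proof.
move=> n0 hi hi'.
under [RHS]eq_bigr do rewrite -cosum_prod mulr_sumr.
rewrite [RHS]exchange_big mulr_sumr; apply: eq_bigr => l _.
under [RHS]eq_bigr do rewrite mulr_sumr.
rewrite [RHS]exchange_big mulr_sumr; apply: eq_bigr => l' _ /=.
by rewrite spectral_cos//; rewrite /distn; have := ltn_ord l; have := ltn_ord l'; lia.
Qed.

(** The double sum telescopes, in l' and then in l; it recovers a process with stationary increments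
    from the covariance of its increments. Writing |j - 1| as [distn j 1] makes lag 0 see f as an
    even function. *)
Lemma second_difference (f : nat -> R) i i' :
  f 0%N = 0 ->
  \sum_(l < i) \sum_(l' < i')
    (fun j => f j.+1 + f (distn j 1) - 2 * f j) (distn l l') =
  f i + f i' - f (distn i i').
Proof.
move=> f0.
have H l m : \sum_(l' < m)
    (fun j => f j.+1 + f (distn j 1) - 2 * f j) (distn l l') =
    f l.+1 - f l + f (distn l m) - f (distn l.+1 m).
  elim: m => [|m IH]; first by rewrite big_ord0 /distn !subn0 !sub0n !addn0; ring.
  rewrite big_ord_recr/= IH.
  have [lm|ml|->] := ltngtP l m.
  - have -> : (distn l.+1 m = (distn l m).-1)%N by rewrite /distn; lia.
    have -> : (distn l m.+1 = (distn l m).+1)%N by rewrite /distn; lia.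
    have -> : (distn l.+1 m.+1 = (distn l m))%N by rewrite /distn; lia.
    have -> : (distn (distn l m) 1 = (distn l m).-1)%N by rewrite /distn; lia.
    ring.
  - have -> : (distn l.+1 m = (distn l m).+1)%N by rewrite /distn; lia.
    have -> : (distn l m.+1 = (distn l m).-1)%N by rewrite /distn; lia.
    have -> : (distn l.+1 m.+1 = (distn l m))%N by rewrite /distn; lia.
    have -> : (distn (distn l m) 1 = (distn l m).-1)%N by rewrite /distn; lia.
    ring.
  - have -> : (distn m.+1 m = 1)%N by rewrite /distn; lia.
    have -> : (distn m m.+1 = 1)%N by rewrite /distn; lia.
    have -> : (distn m.+1 m.+1 = 0)%N by rewrite /distn; lia.
    have -> : (distn m m = 0)%N by rewrite /distn; lia.
    have -> : (distn 0 1 = 1)%N by rewrite /distn; lia.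
    ring.
elim: i => [|i IH].
  rewrite big_ord0 f0; have -> : distn 0 i' = i' by rewrite /distn; lia.
  ring.
rewrite big_ord_recr/= IH H; ring.
Qed.

End ConvexSequence.

(** * Powers: two-sided bounds, sums and iterated differences *)

Section PowerEstimates.
Variable R : realType.
Implicit Types (a b x y u p q : R).

Lemma powR_eq_expR a x : 0 < a -> a `^ x = expR (x * ln a).
Proof. by move=> a0; rewrite /powR gt_eqF. Qed.

Lemma powR_addr a x y : 0 < a -> a `^ (x + y) = a `^ x * a `^ y.
Proof. by move=> a0; rewrite powRD// (gt_eqF a0) implybT. Qed.

Lemma powR_gt0_le a x y : 1 <= a -> x <= y -> a `^ x <= a `^ y.
Proof. by move=> a1; exact: ler_powR. Qed.

Lemma powR_le1_ge a x y : 0 < a -> a <= 1 -> x <= y -> a `^ y <= a `^ x.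
Proof. by move=> a0 a1 xy; apply: ger_powR; rewrite ?a0. Qed.

Lemma powR_base_le a b x : 0 <= x -> 0 < a -> a <= b -> a `^ x <= b `^ x.
Proof.
by move=> x0 a0 ab; apply: ge0_ler_powR => //; rewrite nnegrE ltW// (lt_le_trans a0).
Qed.

Lemma powR_base_ge a b x : x <= 0 -> 0 < a -> a <= b -> b `^ x <= a `^ x.
Proof.
move=> x0 a0 ab; rewrite -(opprK x) !(powRN _ (- x)) lef_pV2 ?posrE ?powR_gt0//.
- by apply: powR_base_le; rewrite ?oppr_ge0.
- exact: lt_le_trans ab.
Qed.

(** A symmetric substitute for exp (b |ln u|): it dominates the powers u^e with |e| <= b and, up to
    a constant, |ln u|. *)
Definition twoside b u : R := u `^ b + u `^ (- b).

Lemma twoside_ge0 b u : 0 <= twoside b u.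
Proof. by rewrite addr_ge0 ?powR_ge0. Qed.

Lemma expR_abs_le_twoside b u : 0 < u -> expR (b * `|ln u|) <= twoside b u.
Proof.
move=> u0; rewrite /twoside !powR_eq_expR//.
have [h|h] := leP 0 (ln u).
  by rewrite ger0_norm// lerDl expR_ge0.
by rewrite ltr0_norm// mulrN -mulNr lerDr expR_ge0.
Qed.

Lemma twoside_ge1 b u : 0 <= b -> 0 < u -> 1 <= twoside b u.
Proof.
move=> b0 u0; apply: le_trans (expR_abs_le_twoside b u0).
by rewrite -expR0 ler_expR mulr_ge0.
Qed.

Lemma powR_le_twoside b e u : 0 < u -> `|e| <= b -> u `^ e <= twoside b u.
Proof.
move=> u0 eb; apply: le_trans (expR_abs_le_twoside b u0).
rewrite powR_eq_expR// ler_expR (le_trans (ler_norm _))// normrM ler_wpM2r//.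
Qed.

Lemma twoside_scale b c u : 0 <= b <= 1 -> 0 < u -> 3^-1 <= c <= 2 ->
  twoside b (c * u) <= 3 * twoside b u.
Proof.
move=> /andP[b0 b1] u0 /andP[c3 c2].
have c0 : 0 < c by lra.
rewrite /twoside !powRM ?(ltW u0) ?(ltW c0)//.
have h1 : c `^ b <= 3.
  apply: (@le_trans _ _ (3 `^ b)); first by apply: powR_base_le => //; lra.
  by rewrite -[leRHS]powRr1//; apply: powR_gt0_le => //; lra.
have h2 : c `^ (- b) <= 3.
  apply: (@le_trans _ _ (3^-1 `^ (- b))); first by apply: powR_base_ge => //; lra.
  rewrite -(@powR_inv1 _ 3)// -powRrM mulN1r opprK.
  by rewrite -[leRHS]powRr1//; apply: powR_gt0_le => //; lra.
rewrite mulrDr; apply: lerD; rewrite ler_wpM2r ?powR_ge0//.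
Qed.

Lemma expR_sub1_norm x : `|expR x - 1| <= `|x| * expR `|x|.
Proof.
have h1 := expR_ge1Dx x; have h2 := expR_ge1Dx (- x).
have [x0|x0] := leP 0 x.
  rewrite !ger0_norm//; last by rewrite subr_ge0 -expR0 ler_expR.
  have e0 := expR_gt0 x.
  have : expR (- x) * expR x = 1 by rewrite -expRD addNr expR0.
  nra.
rewrite (ltr0_norm x0) ler0_norm; last by rewrite subr_le0 -expR0 ler_expR ltW.
have : 1 <= expR (- x) by rewrite -expR0 ler_expR; lra.
nra.
Qed.

Lemma powR_sub1_norm b e u : 0 < u -> 0 < b -> `|e| <= b / 2 ->
  `|u `^ e - 1| <= 2 / b * `|e| * twoside b u.
Proof.
move=> u0 b0 eb; rewrite powR_eq_expR//.
apply: le_trans (expR_sub1_norm _) _.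
rewrite normrM; set L := `|ln u|.
have L0 : 0 <= L by rewrite normr_ge0.
(* Half of the exponent b pays for the logarithm, the other half for the exponential. *)
have h1 : L <= 2 / b * expR (b / 2 * L).
  have h := expR_ge1Dx (b / 2 * L).
  have eL : 2 / b * (b / 2 * L) = L by field; rewrite gt_eqF.
  by rewrite -[leLHS]eL ler_wpM2l ?divr_ge0 ?(ltW b0)//; lra.
apply: (@le_trans _ _ (`|e| * (2 / b * expR (b / 2 * L)) * expR (b / 2 * L))).
  apply: ler_pM => //; first by rewrite mulr_ge0.
  - by rewrite ler_wpM2l.
  - by rewrite ler_expR ler_wpM2r.
have -> : `|e| * (2 / b * expR (b / 2 * L)) * expR (b / 2 * L) =
    2 / b * `|e| * expR (b * L).
  have -> : b * L = b / 2 * L + b / 2 * L by field.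
  by rewrite expRD; ring.
by rewrite ler_wpM2l ?mulr_ge0 ?invr_ge0 ?(ltW b0)// expR_abs_le_twoside.
Qed.

Lemma powR_derive x p : 0 < x -> is_derive x 1 (fun t : R => t `^ p) (p * x `^ (p - 1)).
Proof. by move=> x0; exact: is_derive1_powR. Qed.

Lemma powR_MVT p x y : 0 < x -> x <= y ->
  exists2 z, x <= z <= y & y `^ p - x `^ p = p * z `^ (p - 1) * (y - x).
Proof.
move=> x0 xy.
have [||c cxy e] := @MVT_segment R (fun t => t `^ p) (fun t => p * t `^ (p - 1)) x y xy.
- by move=> z; rewrite in_itv/= => /andP[xz _]; apply: powR_derive; exact: lt_trans xz.
- apply: derivable_within_continuous => z; rewrite in_itv/= => /andP[xz _].
  by have [] := powR_derive p (lt_le_trans x0 xz).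
- by exists c => //; move: cxy; rewrite in_itv.
Qed.

(** Comparison with the integral of x^(-a) by telescoping: by the mean value theorem s m^(s - 1) is
    at most the increment of x^s from m - 1 to m. *)
Lemma sum_low a u n : 0 <= a < 1 -> 1 <= u ->
  \sum_(1 <= m < n | m%:R <= u) (m%:R / u) `^ (- a) <= u / (1 - a).
Proof.
move=> /andP[a0 a1] u1; set s := 1 - a; have s0 : 0 < s by rewrite /s; lra.
have u0 : 0 < u by lra.
have tel m : (1 <= m)%N -> s * m%:R `^ (s - 1) <= m%:R `^ s - m.-1%:R `^ s.
  (* The index 1 is apart, as the mean value theorem is applied on intervals with a positive left
     end. *)
  case: m => // m _; case: m => [|m].
    by rewrite /= powR1 powR0 ?gt_eqF//; rewrite /s; lra.
  have m0 : 0 < m.+1%:R :> R by [].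
  have [|z /andP[z1 z2] ->] := @powR_MVT s m.+1%:R m.+2%:R m0.
    by rewrite ler_nat.
  rewrite (_ : m.+2%:R - m.+1%:R = 1) ?mulr1; last by rewrite -[m.+2%:R]natr1; ring.
  rewrite ler_wpM2l ?(ltW s0)//.
  by apply: powR_base_ge => //; [rewrite /s; lra|exact: lt_le_trans z1].
have B1 k : \sum_(1 <= m < k | m%:R <= u) s * m%:R `^ (s - 1) <= k.-1%:R `^ s.
  elim: k => [|k IH]; first by rewrite big_geq// powR_ge0.
  case: k IH => [|k] IH; first by rewrite big_geq// powR_ge0.
  rewrite big_mkcond big_nat_recr//= -big_mkcond/=.
  apply: le_trans (lerD IH (_ : _ <= k.+1%:R `^ s - k%:R `^ s)) _; last first.
    by rewrite /= addrC subrK.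
  case: ifP => _; first exact: tel.
  rewrite subr_ge0; apply: ge0_ler_powR; rewrite ?(ltW s0) ?nnegrE//.
  by rewrite ler_nat.
have B2 : \sum_(1 <= m < n | m%:R <= u) s * m%:R `^ (s - 1) <= u `^ s.
  elim: n => [|k IH]; first by rewrite big_geq// powR_ge0.
  case: k IH => [|k] IH; first by rewrite big_geq// powR_ge0.
  have [h|h] := leP k.+1%:R u.
    by apply: le_trans (B1 _) _; apply: ge0_ler_powR; rewrite ?(ltW s0) ?nnegrE// ltW.
  by rewrite big_mkcond big_nat_recr//= -big_mkcond/= (leNgt k.+1%:R) h addr0.
rewrite -mulr_sumr -ler_pdivlMl// in B2.
rewrite (eq_bigr (fun m => u `^ a * m%:R `^ (s - 1))); last first.
  move=> m _; rewrite powRM ?invr_ge0 ?(ltW u0)// mulrC; congr (_ * _).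
    by rewrite -powR_inv1 ?(ltW u0)// -powRrM mulrN mulNr mul1r opprK.
  by congr powR; rewrite /s; ring.
rewrite -mulr_sumr; apply: le_trans (ler_wpM2l (powR_ge0 _ _) B2) _.
rewrite mulrCA -powR_addr// (_ : a + s = 1); last by rewrite /s; ring.
by rewrite powRr1 ?(ltW u0)// mulrC.
Qed.

Lemma sum_high b u n : 1 < b -> 1 <= u ->
  \sum_(1 <= m < n | u < m%:R) (m%:R / u) `^ (- b) <= 2 `^ (b - 1) / (b - 1) * u.
Proof.
move=> b1 u1; set s := b - 1; have s0 : 0 < s by rewrite /s; lra.
have u0 : 0 < u by lra.
have tel m : s * m.+2%:R `^ (- b) <= m.+1%:R `^ (- s) - m.+2%:R `^ (- s).
  have m0 : 0 < m.+1%:R :> R by [].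
  have [|z /andP[z1 z2] e] := @powR_MVT (- s) m.+1%:R m.+2%:R m0.
    by rewrite ler_nat.
  rewrite -opprB e (_ : m.+2%:R - m.+1%:R = 1); last by rewrite -[m.+2%:R]natr1; ring.
  rewrite mulr1 -mulNr opprK.
  rewrite (_ : - s - 1 = - b); last by rewrite /s; ring.
  rewrite ler_wpM2l ?(ltW s0)//.
  by apply: powR_base_ge => //; [lra|exact: lt_le_trans z1].
(* The first index m above [u >= 1] is at least 2, so the telescoping starts at m - 1 >= m / 2 > u /
   2; this is the origin of the factor 2^(b - 1). *)
have B k : \sum_(1 <= m < k.+1 | u < m%:R) s * m%:R `^ (- b) <=
    if u < k%:R then (u / 2) `^ (- s) - k%:R `^ (- s) else 0.
  elim: k => [|k IH].
    by rewrite big_geq//; case: ifP => // h; move: h u0; rewrite ltNge => /negP + /ltW.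
  rewrite big_mkcond big_nat_recr//= -big_mkcond/=.
  have [h|h] := ltP u k.+1%:R; last first.
    rewrite addr0; move: IH; rewrite ltNge (le_trans _ h)//; by rewrite ler_nat.
  case: k IH h => [|k] IH h; first by move: h u1; rewrite ltNge => /negP.
  apply: le_trans (lerD IH (tel k)) _.
  case: ifP => h2; first by rewrite addrA subrK.
  rewrite add0r lerD2r; apply: powR_base_ge; rewrite ?divr_gt0//; first lra.
  by move: h; rewrite ltNge in h2; move/negbFE: h2; rewrite -[k.+2%:R]natr1 -[k.+1%:R]natr1 => *; have : 0 <= k%:R :> R by []; lra.
have {}B : \sum_(1 <= m < n | u < m%:R) s * m%:R `^ (- b) <= (u / 2) `^ (- s).
  case: n => [|n]; first by rewrite big_geq// powR_ge0.
  apply: le_trans (B _) _; case: ifP => _; last exact: powR_ge0.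
  by rewrite gerBl powR_ge0.
rewrite -mulr_sumr -ler_pdivlMl// in B.
rewrite (eq_bigr (fun m => u `^ b * m%:R `^ (- b))); last first.
  move=> m _; rewrite powRM ?invr_ge0 ?(ltW u0)// mulrC; congr (_ * _).
  by rewrite -powR_inv1 ?(ltW u0)// -powRrM mulrN mulNr mul1r opprK.
rewrite -mulr_sumr; apply: le_trans (ler_wpM2l (powR_ge0 _ _) B) _.
rewrite powRM ?invr_ge0 ?(ltW u0)//.
rewrite -[X in _ * (_ * (_ * X `^ _))]powR_inv1// -powRrM mulrN mulNr mul1r opprK.
rewrite (_ : _ * _ = 2 `^ s / s * (u `^ b * u `^ (- s))); last by ring.
rewrite -powR_addr// /s (_ : b - (b - 1) = 1); last by ring.
by rewrite powRr1// ltW.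
Qed.

Definition fdiff (f : R -> R) x : R := f (x + 1) - f x.

(** Induction on the order, applied to the differences of the [h i], which again form a chain of
    derivatives; one more mean value theorem removes the last difference. *)
Lemma iter_fdiff_MVT (h : nat -> R -> R) (e : nat) x :
  (forall i (t : R), 0 < t -> is_derive t 1 (h i) (h i.+1 t)) -> 0 < x ->
  exists2 z, x <= z <= x + e%:R & iter e fdiff (h 0%N) x = h e z.
Proof.
elim: e h x => [|e IH] h x dh x0.
  by exists x => //; rewrite addr0 lexx.
have [|z /andP[z1 z2] ez] := IH (fun i => fdiff (h i)) x _ x0.
  move=> i t t0; rewrite /fdiff.
  have t1 : 0 < t + 1 by lra.
  apply: is_deriveB; last exact: dh.
  have H := @is_derive1_comp _ (h i) (shift (1 : R)) t _ _ (dh i _ t1) (is_derive_shift t 1 1).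
  by move: H; rewrite mulr1.
rewrite iterSr ez /fdiff.
have z0 : 0 < z by exact: lt_le_trans z1.
have [|||c cz ec] := @MVT_segment R (h e) (h e.+1) z (z + 1); first by lra.
- by move=> t; rewrite in_itv/= => /andP[zt _]; apply: dh; exact: lt_trans zt.
- apply: derivable_within_continuous => t; rewrite in_itv/= => /andP[zt _].
  by have [] := dh e _ (lt_le_trans z0 zt).
exists c; last by rewrite ec addrAC subrr add0r mulr1.
by move: cz; rewrite in_itv/= -natr1 => /andP[? ?]; apply/andP; split; lra.
Qed.

(** The falling factorial, the coefficient produced by i derivatives of x^p. *)
Definition ffact p (i : nat) : R := \prod_(l < i) (p - l%:R).

Lemma ffactS p i : ffact p i.+1 = ffact p i * (p - i%:R).
Proof. by rewrite /ffact big_ord_recr. Qed.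

Lemma ffact_bound p i : 0 <= p <= 2 -> (i <= 4)%N -> `|ffact p i| <= 3 ^+ i.
Proof.
move=> /andP[p0 p2]; elim: i => [|i IH] hi; first by rewrite /ffact big_ord0 normr1.
rewrite ffactS normrM exprSr ler_pM//; first by apply: IH; lia.
have : i%:R <= 3 :> R by rewrite (ler_nat _ i 3).
by have : 0 <= i%:R :> R by []; rewrite ler_norml; lra.
Qed.

Lemma ffact_lipschitz p q i : 0 <= p <= 2 -> 0 <= q <= 2 -> (i <= 4)%N ->
  `|ffact p i - ffact q i| <= i%:R * 3 ^+ i * `|p - q|.
Proof.
move=> hp hq; elim: i => [|i IH] hi; first by rewrite /ffact !big_ord0 subrr normr0 !mul0r.
have := IH (ltnW hi); have := ffact_bound hq (ltnW hi).
rewrite !ffactS.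
have -> : ffact p i * (p - i%:R) - ffact q i * (q - i%:R) =
  (ffact p i - ffact q i) * (p - i%:R) + ffact q i * (p - q) by ring.
move=> h1 h2; apply: le_trans (ler_normD _ _) _; rewrite !normrM.
have h3 : `|p - i%:R| <= 3.
  have : i%:R <= 3 :> R by rewrite (ler_nat _ i 3).
  by have : 0 <= i%:R :> R by []; rewrite ler_norml; lra.
have : `|ffact p i - ffact q i| * `|p - i%:R| <= (i%:R * 3 ^+ i * `|p - q|) * 3 by rewrite ler_pM.
have : `|ffact q i| * `|p - q| <= 3 ^+ i * `|p - q| by rewrite ler_wpM2r.
have : 0 <= (3 : R) ^+ i * `|p - q| by rewrite mulr_ge0 ?exprn_ge0.
rewrite exprS -natr1; set t := (3 : R) ^+ i; nra.
Qed.

(* Combination of two powers up to constants, and its i-th derivative. *)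
Definition mix A B p q (i : nat) (x : R) : R :=
  A * ffact p i * x `^ (p - i%:R) + B * ffact q i * x `^ (q - i%:R).

Lemma is_derive_mix A B p q i x : 0 < x ->
  is_derive x 1 (mix A B p q i) (mix A B p q i.+1 x).
Proof.
move=> x0; rewrite /mix !ffactS.
have E (r : R) : (r - i%:R) - 1 = r - i.+1%:R by rewrite -natr1; ring.
have H (r c : R) : is_derive x 1 (fun t => c * t `^ (r - i%:R))
    (c * ((r - i%:R) * x `^ (r - i.+1%:R))).
  by rewrite -E; apply: is_deriveZ; exact: powR_derive.
have := is_deriveD (H p (A * ffact p i)) (H q (B * ffact q i)).
by rewrite !mulrA.
Qed.

Lemma mix_MVT A B p q e x : 0 < x ->
  exists2 z, x <= z <= x + e%:R &
    iter e fdiff (fun t => A * t `^ p + B * t `^ q) x = mix A B p q e z.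
Proof.
move=> x0; have [|z hz ez] := @iter_fdiff_MVT (mix A B p q) e x _ x0.
  by move=> i t; exact: is_derive_mix.
exists z => //; rewrite -ez; congr (iter _ _ _ _); apply/funext => t.
by rewrite /mix /ffact !big_ord0 !subr0 !mulr1.
Qed.

End PowerEstimates.

(** * Second differences of powers: the covariance of fractional Gaussian noise *)

Section PowerSequences.
Variable R : realType.

Definition pw (p : R) (j : nat) : R := j%:R `^ p.
(** Up to a constant factor, the autocovariance at lag j of the unit increments of fractional
    Brownian motion with 2H = p. *)
Definition dseq (p : R) (j : nat) : R :=
  pw p j.+1 + pw p (distn j 1) - 2 * pw p j.

Lemma distnS1 k : distn k.+1 1 = k.
Proof. by rewrite /distn; lia. Qed.

(** One family for two uses: A = 0, B = 1 is [dseq] itself, and B = -1 is the difference of two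
    covariances rescaled so as to agree at a given wavelength. *)
Definition mixseq (A B p q : R) (j : nat) : R := A * dseq p j + B * dseq q j.

Lemma natr1E (k : nat) : k%:R + 1 = k.+1%:R :> R.
Proof. by rewrite natr1. Qed.

(** The bend of a second difference is a fourth difference, here over k+1, ..., k+5. The bends at 1
    and 2 are excluded because their stencils reach lag 0 or below, where powers are not smooth. *)
Lemma bend_mixseq A B p q k : exists2 z : R, k.+1%:R <= z <= k.+1%:R + 4%:R &
  bend (mixseq A B p q) k.+3 = mix A B p q 4%N z.
Proof.
have k0 : 0 < k.+1%:R :> R by [].
have [z hz ez] := mix_MVT A B p q 4%N k0; exists z => //; rewrite -ez.
rewrite /= /fdiff !natr1E /bend /= /mixseq /dseq !distnS1 /pw; ring.
Qed.

Lemma slope_mixseq A B p q k : exists2 z : R, k.+1%:R <= z <= k.+1%:R + 3%:R &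
  mixseq A B p q k.+2 - mixseq A B p q k.+3 = - mix A B p q 3%N z.
Proof.
have k0 : 0 < k.+1%:R :> R by [].
have [z hz ez] := mix_MVT A B p q 3%N k0; exists z => //; rewrite -ez.
rewrite /= /fdiff !natr1E /= /mixseq /dseq !distnS1 /pw; ring.
Qed.

Lemma val_mixseq A B p q k : exists2 z : R, k.+1%:R <= z <= k.+1%:R + 2%:R &
  mixseq A B p q k.+2 = mix A B p q 2%N z.
Proof.
have k0 : 0 < k.+1%:R :> R by [].
have [z hz ez] := mix_MVT A B p q 2%N k0; exists z => //; rewrite -ez.
rewrite /= /fdiff !natr1E /= /mixseq /dseq !distnS1 /pw; ring.
Qed.

(** The constants are 2^(-3) and (1/3)^(-3), the extreme cases for exponents in [-3, 0]. *)
Lemma powR_range (r t m : R) : -3 <= r <= 0 -> 0 < m -> 3^-1 * m <= t <= 2 * m ->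
  8^-1 * m `^ r <= t `^ r <= 27 * m `^ r.
Proof.
move=> /andP[r3 r0] m0 /andP[t1 t2].
have t0 : 0 < t by apply: lt_le_trans t1; rewrite mulr_gt0.
have -> : t = (t / m) * m by rewrite divfK// gt_eqF.
have c1 : 3^-1 <= t / m by rewrite ler_pdivlMr.
have c2 : t / m <= 2 by rewrite ler_pdivrMr.
have c0 : 0 < t / m by rewrite divr_gt0.
rewrite powRM ?(ltW c0) ?(ltW m0)// !ler_pM2r ?powR_gt0//; apply/andP; split.
  apply: (@le_trans _ _ (2 `^ r)); last exact: powR_base_ge.
  apply: (@le_trans _ _ (2 `^ (- 3))); last by apply: powR_gt0_le => //; lra.
  by rewrite powR_invn// -natrX.
apply: (@le_trans _ _ (3^-1 `^ r)); first exact: powR_base_ge.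
apply: (@le_trans _ _ (3^-1 `^ (- 3))); first by apply: powR_le1_ge => //; lra.
by rewrite powR_invn// exprVn invrK -natrX.
Qed.

(** 15 = 1 + 4 + 6 + 4 is the total weight of the stencil at index 2; at index 1, folded at the
    origin, the weights 1, 4, 7 only sum to 12. *)
Lemma bend_small (d : nat -> R) (f : nat -> R) (C : R) m : f 0%N = 0 ->
  (forall j, d j = f j.+1 + f (distn j 1) - 2 * f j) ->
  (forall a, (1 <= a <= 4)%N -> `|f a| <= C) -> (1 <= m <= 2)%N ->
  `|bend d m| <= 15 * C.
Proof.
move=> f0 df fC; case: m => [//|[|[|//]]] _; rewrite /bend /= !df !distnS1 ?f0.
  have -> : distn 0 1 = 1%N by rewrite /distn; lia.
  have := fC 1%N isT; have := fC 2%N isT; have := fC 3%N isT.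
  rewrite !ler_norml; lra.
have := fC 1%N isT; have := fC 2%N isT; have := fC 3%N isT; have := fC 4%N isT.
rewrite !ler_norml; lra.
Qed.

Lemma range3 (k c : nat) (z : R) : (c <= 4)%N ->
  k.+1%:R <= z <= k.+1%:R + c%:R -> 3^-1 * k.+3%:R <= z <= 2 * k.+3%:R.
Proof.
rewrite -(ler_nat R) -[k.+3%:R]natr1 -[k.+2%:R]natr1 -[k.+1%:R]natr1 => c4.
have : 0 <= k%:R :> R by [].
by move=> ? ?; lra.
Qed.

Lemma range2 (k c : nat) (z : R) : (c <= 2)%N ->
  k.+1%:R <= z <= k.+1%:R + c%:R -> 3^-1 * k.+2%:R <= z <= 2 * k.+2%:R.
Proof.
rewrite -(ler_nat R) -[k.+2%:R]natr1 -[k.+1%:R]natr1 => c4.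
have : 0 <= k%:R :> R by [].
by move=> ? ?; lra.
Qed.

End PowerSequences.

(** * Difference of two rescaled power covariances *)

Section SpectralEstimates.
Variable R : realType.
Variables (p0 b : R).
Hypothesis (hp0 : 1 < p0 < 2) (hb : b = (p0 - 1) / 4).

Let b0 : 0 < b. Proof. by move: hp0 => /andP[? ?]; rewrite hb; lra. Qed.
Let b1 : b <= 1 / 4. Proof. by move: hp0 => /andP[? ?]; rewrite hb; lra. Qed.

Section TwoExponents.
Variables (p1 u : R).
Hypothesis (hp1 : 0 <= p1 <= 2) (hd : `|p1 - p0| <= b / 2) (u1 : 1 <= u).
Let u0 : 0 < u. Proof. exact: lt_le_trans u1. Qed.
Let D := p1 - p0.
Let A := u `^ (- D).

Let Apow (z : R) : 0 < z -> A * z `^ D = (z / u) `^ D.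
Proof.
move=> z0; rewrite /A powRM ?invr_ge0 ?ltW// mulrC; congr (_ * _).
by rewrite -powR_inv1 ?ltW// -powRrM mulN1r.
Qed.

(** 81 is 27 from [powR_range] times 3 from [twoside_scale]; 324 = 4 * 81 is the Lipschitz constant
    of [ffact] up to order 4, and 162 / b joins the bound 81 of [ffact] with the 2 / b of
    [powR_sub1_norm]. *)
Definition Kmix : R := 81 * (324 + 162 / b).

(** 16 bounds a^p0 for a <= 4, 9 comes from [twoside_scale] used twice, 8 undoes m^(p0 - 4) >= 1/8,
    and 2 / b is the constant of [powR_sub1_norm]. *)
Definition Ksmall : R := 16 * (9 * 8) * (2 / b).

Lemma Ksmall_ge0 : 0 <= Ksmall.
Proof. by rewrite /Ksmall mulr_ge0 ?divr_ge0 ?mulr_ge0// ltW. Qed.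

(** Since A z^p1 = z^p0 (z / u)^D, the difference splits into a change of the factorial coefficient
    and a deviation of (z / u)^D from 1, both of order |D|. *)
Lemma mix_bound e (z m : R) : (2 <= e <= 4)%N -> 0 < m -> 3^-1 * m <= z <= 2 * m ->
  `|mix A (-1) p1 p0 e z| <= Kmix * `|D| * (m `^ (p0 - e%:R) * twoside b (m / u)).
Proof.
move=> /andP[e2 e4] m0 /andP[z1 z2].
have /andP[p0l p0r] := hp0; have bq := b1; have bp := b0.
have z0 : 0 < z by apply: lt_le_trans z1; rewrite mulr_gt0.
have zu0 : 0 < z / u by rewrite divr_gt0.
have mu0 : 0 < m / u by rewrite divr_gt0.
have e2R : 2 <= e%:R :> R by rewrite (ler_nat _ 2).
have e4R : e%:R <= 4 :> R by rewrite (ler_nat _ _ 4).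
have p02 : 0 <= p0 <= 2 by lra.
have E : mix A (-1) p1 p0 e z = z `^ (p0 - e%:R) *
   ((ffact p1 e - ffact p0 e) * (z / u) `^ D + ffact p0 e * ((z / u) `^ D - 1)).
  rewrite /mix (_ : p1 - e%:R = (p0 - e%:R) + D); last by rewrite /D; ring.
  by rewrite powR_addr// -Apow//; ring.
rewrite E normrM (ger0_norm (powR_ge0 _ _)).
have h81 : (3 : R) ^+ e <= 81.
  by rewrite -natrX (ler_nat _ _ 81); apply: (@leq_trans (3 ^ 4)); rewrite ?leq_exp2l.
have h1 : `|ffact p1 e - ffact p0 e| <= 324 * `|D|.
  apply: le_trans (ffact_lipschitz hp1 p02 e4) _.
  rewrite ler_wpM2r// (_ : 324 = 4 * 81); last by ring.
  by rewrite ler_pM// exprn_ge0.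
have h2 : `|ffact p0 e| <= 81 by apply: le_trans (ffact_bound p02 e4) _.
have h3 : (z / u) `^ D <= twoside b (z / u).
  by apply: powR_le_twoside => //; apply: le_trans hd _; lra.
have h4 := powR_sub1_norm zu0 b0 hd.
have h5 : twoside b (z / u) <= 3 * twoside b (m / u).
  rewrite (_ : z / u = (z / m) * (m / u)); last by field; rewrite ?gt_eqF.
  apply: twoside_scale => //; first by rewrite ltW//=; lra.
  by rewrite ler_pdivlMr// ler_pdivrMr// z1 z2.
have [_ h6] := andP (@powR_range R (p0 - e%:R) z m (ltac:(lra)) m0 (ltac:(by rewrite z1 z2))).
set T := twoside b (m / u) in h5 *.
have T0 : 0 <= T by exact: twoside_ge0.
have h7 : `|(ffact p1 e - ffact p0 e) * (z / u) `^ D + ffact p0 e * ((z / u) `^ D - 1)|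
   <= (324 + 162 / b) * `|D| * (3 * T).
  apply: le_trans (ler_normD _ _) _; rewrite !normrM (ger0_norm (powR_ge0 (z / u) _)).
  have -> : (324 + 162 / b) * `|D| * (3 * T) = 324 * `|D| * (3 * T) + 162 / b * `|D| * (3 * T) by ring.
  apply: lerD.
    by apply: ler_pM => //; [exact: powR_ge0|exact: le_trans h5].
  apply: (@le_trans _ _ (81 * (2 / b * `|D| * (3 * T)))); last first.
    by rewrite (_ : 162 / b = 81 * (2 / b)) ?mulrA//; ring.
  apply: ler_pM => //; apply: le_trans h4 _; rewrite ler_wpM2l//.
  by rewrite mulr_ge0// divr_ge0// ltW.
apply: le_trans (ler_pM (powR_ge0 _ _) (normr_ge0 _) h6 h7) _.
by rewrite /Kmix le_eqVlt; apply/orP; left; apply/eqP; ring.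
Qed.

Lemma pw_mix_small a m : (1 <= a <= 4)%N -> (1 <= m <= 2)%N ->
  `|A * pw p1 a - pw p0 a| <= Ksmall * `|D| * (m%:R `^ (p0 - 4) * twoside b (m%:R / u)).
Proof.
move=> /andP[a1 a4] /andP[m1 m2].
have /andP[p0l p0r] := hp0; have bq := b1; have bp := b0.
have a0R : 0 < a%:R :> R by rewrite ltr0n.
have a1R : 1 <= a%:R :> R by rewrite ler1n.
have m0R : 0 < m%:R :> R by rewrite ltr0n.
have m1R : 1 <= m%:R :> R by rewrite ler1n.
have m2R : m%:R <= 2 :> R by rewrite (ler_nat _ _ 2).
have a4R : a%:R <= 4 :> R by rewrite (ler_nat _ _ 4).
have -> : A * pw p1 a - pw p0 a = a%:R `^ p0 * ((a%:R / u) `^ D - 1).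
  rewrite /pw (_ : p1 = p0 + D); last by rewrite /D; ring.
  by rewrite powR_addr// -Apow//; ring.
have au0 : 0 < a%:R / u by rewrite divr_gt0.
have mu0 : 0 < m%:R / u by rewrite divr_gt0.
rewrite normrM (ger0_norm (powR_ge0 _ _)).
have h1 : a%:R `^ p0 <= 16.
  apply: (@le_trans _ _ (a%:R `^ 2)); first by apply: powR_gt0_le => //; lra.
  by rewrite powR_mulrn// -natrX (ler_nat _ _ 16) -[16%N]/(4 ^ 2)%N leq_exp2r.
have h2 := powR_sub1_norm au0 b0 hd.
have h3 : twoside b (a%:R / u) <= 9 * twoside b (m%:R / u).
  have b01 : 0 <= b <= 1 by rewrite ltW//=; lra.
  (* The ratio a / m can reach 4 while [twoside_scale] allows a factor 2: beyond 2 it is applied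
     twice. *)
  have [am|am] := leP (a%:R / m%:R) (2 : R).
    have -> : a%:R / u = (a%:R / m%:R) * (m%:R / u) by field; rewrite ?gt_eqF.
    apply: le_trans (twoside_scale b01 mu0 _) _.
      by rewrite am andbT ler_pdivlMr//; lra.
    by rewrite ler_wpM2r ?twoside_ge0//; lra.
  have -> : a%:R / u = 2 * ((a%:R / m%:R / 2) * (m%:R / u)) by field; rewrite ?gt_eqF.
  have c0 : 0 < a%:R / m%:R / 2 :> R by rewrite !divr_gt0.
  have q1 := twoside_scale b01 (mulr_gt0 c0 mu0) (_ : 3^-1 <= 2 <= 2).
  have q2 := twoside_scale b01 mu0 (_ : 3^-1 <= a%:R / m%:R / 2 <= 2).
  have {}q1 := q1 (ltac:(lra)).
  have {}q2 : twoside b (a%:R / m%:R / 2 * (m%:R / u)) <= 3 * twoside b (m%:R / u).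
    apply: q2; apply/andP; split; first lra.
    rewrite ler_pdivrMr// ler_pdivrMr//; nra.
  lra.
have h4 : 8^-1 <= m%:R `^ (p0 - 4).
  apply: (@le_trans _ _ (m%:R `^ (- 3))); last by apply: powR_gt0_le => //; lra.
  rewrite powR_invn// lef_pV2 ?posrE ?exprn_gt0//.
  by rewrite -natrX (ler_nat _ _ 8) -[8%N]/(2 ^ 3)%N leq_exp2r.
apply: le_trans (ler_pM (powR_ge0 _ _) (normr_ge0 _) h1 h2) _.
set T := twoside b (m%:R / u) in h3 *.
have T0 : 0 <= T by exact: twoside_ge0.
apply: (@le_trans _ _ (16 * (2 / b * `|D| * (9 * T)))).
  by rewrite ler_wpM2l// ler_wpM2l// mulr_ge0// divr_ge0// ltW.
rewrite (_ : 16 * _ = Ksmall * `|D| * (8^-1 * T)); last by rewrite /Ksmall; field; rewrite gt_eqF.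
by rewrite ler_wpM2l ?ler_wpM2r// mulr_ge0// Ksmall_ge0.
Qed.

End TwoExponents.

(* u is the wavelength n / k, in grid steps. *)
Definition tame (d : nat -> R) (u K : R) n :=
  [/\ (forall m, (1 <= m < n)%N ->
         `|bend d m| <= K * (m%:R `^ (p0 - 4) * twoside b (m%:R / u))),
      `|d n.-1 - d n| <= K * (n%:R `^ (p0 - 3) * twoside b (n%:R / u)) &
      `|d n| <= K * (n%:R `^ (p0 - 2) * twoside b (n%:R / u))].

Lemma tame_diff (p1 u : R) n : 0 <= p1 <= 2 -> `|p1 - p0| <= b / 2 -> 1 <= u ->
  (3 <= n)%N ->
  tame (mixseq (u `^ (- (p1 - p0))) (-1) p1 p0) u
    ((Kmix + 15 * Ksmall) * `|p1 - p0|) n.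
Proof.
move=> hp1 hd u1 n3.
have /andP[p0l p0r] := hp0; have bq := b1; have bp := b0.
have K0 : 0 <= Kmix.
  have bi : 0 <= b^-1 by rewrite invr_ge0 ltW.
  by have := mulr_ge0 (ler0n R 162) bi; rewrite /Kmix; lra.
have L0 : 0 <= 15 * Ksmall by rewrite mulr_ge0// Ksmall_ge0.
have mono K (X : R) : 0 <= X -> K <= Kmix + 15 * Ksmall -> K * `|p1 - p0| * X <=
    (Kmix + 15 * Ksmall) * `|p1 - p0| * X.
  by move=> X0 hK; rewrite ler_wpM2r// ler_wpM2r.
have T0 (m : nat) r : 0 <= m%:R `^ r * twoside b (m%:R / u).
  by rewrite mulr_ge0 ?powR_ge0 ?twoside_ge0.
split.
- move=> m /andP[m1 mn].
  have [m2|m3] := leqP m 2.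
    apply: le_trans (mono (15 * (Ksmall)) _ (T0 _ _) _); last by lra.
    rewrite -(mulrA 15) -(mulrA 15); apply: (@bend_small _ _ (fun j => u `^ (- (p1 - p0)) * pw p1 j - pw p0 j)).
    + have p10 : p1 != 0.
        by rewrite gt_eqF//; move: hd; rewrite ler_norml => /andP[]; lra.
      have p00 : p0 != 0 by rewrite gt_eqF//; lra.
      by rewrite /pw (powR0 p10) (powR0 p00) mulr0 subr0.
    + by move=> j; rewrite /mixseq /dseq; ring.
    + by move=> a ha; apply: (pw_mix_small hd u1 ha); rewrite m1 m2.
    + by rewrite m1 m2.
  case: m m3 m1 mn => [//|[//|[//|k]]] _ _ _.
  have [z hz ->] := bend_mixseq (u `^ (- (p1 - p0))) (-1) p1 p0 k.
  apply: le_trans (mono Kmix _ (T0 _ _) _); last lra.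
  by apply: (mix_bound hp1 hd u1) => //; exact: range3 hz.
- case: n n3 => [//|[//|[//|k]]] _ /=.
  have [z hz ->] := slope_mixseq (u `^ (- (p1 - p0))) (-1) p1 p0 k.
  apply: le_trans (mono Kmix _ (T0 _ _) _); last lra.
  by rewrite normrN; apply: (mix_bound hp1 hd u1) => //; exact: range3 hz.
- case: n n3 => [//|[//|k]] _ /=.
  have [z hz ->] := val_mixseq (u `^ (- (p1 - p0))) (-1) p1 p0 k.
  apply: le_trans (mono Kmix _ (T0 _ _) _); last lra.
  by apply: (mix_bound hp1 hd u1) => //; exact: range2 hz.
Qed.

End SpectralEstimates.

(** * Convexity of the covariance, including the indices next to the origin *)

Section SpectralBounds.
Variable R : realType.
Variables (p0 b : R).
Hypothesis (hp0 : 1 < p0 < 2) (hb : b = (p0 - 1) / 4).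

Let b0 : 0 < b. Proof. by move: hp0 => /andP[? ?]; rewrite hb; lra. Qed.
Let b1 : b <= 1 / 4. Proof. by move: hp0 => /andP[? ?]; rewrite hb; lra. Qed.

Lemma mixseq01 : mixseq 0 1 p0 p0 = dseq p0.
Proof. by apply/funext => j; rewrite /mixseq mul0r mul1r add0r. Qed.

Lemma mix01 e z : mix 0 1 p0 p0 e z = ffact p0 e * z `^ (p0 - e%:R).
Proof. by rewrite /mix !mul0r mul1r add0r. Qed.

(** 3^4 * 27 serves the smooth range, from [ffact_bound] and [powR_range]; 15 * (16 * 8) serves the
    indices 1 and 2, from [bend_small]. *)
Definition Kself : R := 3 ^+ 4 * 27 + 15 * (16 * 8).

Lemma tame_self (u : R) n : 1 <= u -> (3 <= n)%N -> tame p0 b (dseq p0) u Kself n.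
Proof.
move=> u1 n3.
have /andP[p0l p0r] := hp0.
have u0 : 0 < u by lra.
have h81 (m e : nat) (z : R) : (2 <= e <= 4)%N -> 0 < m%:R :> R -> 3^-1 * m%:R <= z <= 2 * m%:R ->
    `|mix 0 1 p0 p0 e z| <= Kself * (m%:R `^ (p0 - e%:R) * twoside b (m%:R / u)).
  move=> /andP[e2 e4] m0 hz; rewrite mix01 normrM (ger0_norm (powR_ge0 _ _)).
  have e2R : 2 <= e%:R :> R by rewrite (ler_nat _ 2).
  have e4R : e%:R <= 4 :> R by rewrite (ler_nat _ _ 4).
  have r3 : -3 <= p0 - e%:R <= 0 by apply/andP; split; lra.
  have /andP[_ h] := powR_range r3 m0 hz.
  have p02 : 0 <= p0 <= 2 by apply/andP; split; lra.
  have f := ffact_bound p02 e4.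
  have f' : `|ffact p0 e| <= 3 ^+ 4.
    by apply: le_trans f _; rewrite -!natrX ler_nat leq_exp2l.
  apply: le_trans (ler_pM (normr_ge0 _) (powR_ge0 _ _) f' h) _.
  have t1 : 1 <= twoside b (m%:R / u) by apply: twoside_ge1; [exact: ltW|exact: divr_gt0].
  set X := m%:R `^ _; have X0 : 0 <= X by exact: powR_ge0.
  rewrite (mulrA (3 ^+ 4)). apply: ler_pM => //.
  - by rewrite /Kself lerDl; do !apply: mulr_ge0.
  - by rewrite ler_peMr.
rewrite -mixseq01; split.
- move=> m /andP[m1 mn].
  have [m2|m3] := leqP m 2.
    have m0 : 0 < m%:R :> R by rewrite ltr0n.
    have t1 : 1 <= twoside b (m%:R / u) by apply: twoside_ge1; [exact: ltW|exact: divr_gt0].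
    have h8 : 8^-1 <= m%:R `^ (p0 - 4).
      apply: (@le_trans _ _ (m%:R `^ (- 3))); last by apply: powR_gt0_le; rewrite ?ler1n//; lra.
      rewrite powR_invn ?ler0n// lef_pV2 ?posrE ?exprn_gt0//.
      by rewrite -natrX (ler_nat _ _ 8) -[8%N]/(2 ^ 3)%N leq_exp2r.
    apply: (@le_trans _ _ (15 * 16)).
      rewrite mixseq01; apply: (@bend_small _ _ (pw p0)).
      + by rewrite /pw powR0// gt_eqF//; lra.
      + by [].
      + move=> a /andP[a1 a4]; rewrite /pw ger0_norm ?powR_ge0//.
        apply: (@le_trans _ _ (a%:R `^ 2)); first by apply: powR_gt0_le; rewrite ?ler1n//; lra.
        by rewrite powR_mulrn// -natrX (ler_nat _ _ 16) -[16%N]/(4 ^ 2)%N leq_exp2r.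
      + by rewrite m1 m2.
    apply: (@le_trans _ _ (15 * (16 * 8) * (8^-1 * 1))); first by lra.
    apply: ler_pM => //; rewrite ?mulr_ge0//.
      by rewrite /Kself lerDr mulr_ge0// exprn_ge0.
    by apply: ler_pM.
  case: m m3 m1 mn => [//|[//|[//|k]]] _ _ _.
  have [z hz ->] := bend_mixseq 0 1 p0 p0 k.
  by apply: h81 => //; exact: range3 hz.
- case: n n3 => [//|[//|[//|k]]] _ /=.
  have [z hz ->] := slope_mixseq 0 1 p0 p0 k.
  by rewrite normrN; apply: h81 => //; exact: range3 hz.
- case: n n3 => [//|[//|k]] _ /=.
  have [z hz ->] := val_mixseq 0 1 p0 p0 k.
  by apply: h81 => //; exact: range2 hz.
Qed.

(** The claim is 3^p0 - 4 * 2^p0 + 7 > 0, out of reach of a derivative because the stencil is folded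
    at 0. With p0 = 2 - 3 s and c = 2^(-s), 2^p0 becomes 4 c^3, and 27 <= 32 bounds 3^p0 below by 9
    c^5; there remains a polynomial in c on ]0, 1[. *)
Lemma bend1_gt0 : 0 < bend (dseq p0) 1.
Proof.
have /andP[p0l p0r] := hp0.
rewrite /bend /= /dseq /= (_ : distn 0 1 = 1)%N; last by rewrite /distn; lia.
rewrite (_ : distn 1 1 = 0)%N; last by rewrite /distn; lia.
rewrite (_ : distn 2 1 = 1)%N; last by rewrite /distn; lia.
rewrite /pw powR1 powR0 ?gt_eqF//; last by lra.
pose s := (2 - p0) / 3.
have s0 : 0 < s by rewrite /s; lra.
pose c : R := 2 `^ (- s).
have c0 : 0 < c by exact: powR_gt0.
have c1 : c < 1.
  rewrite /c powRN invf_lt1 ?powR_gt0//.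
  have : (2 : R) `^ 0 < 2 `^ s.
    by rewrite !powR_eq_expR// ltr_expR ltr_pM2r// ln_gt0// ltr1n.
  by rewrite powRr0.
have ps : p0 = 2 - 3 * s by rewrite /s; field.
have h2 : (2 : R) `^ p0 = 4 * c ^+ 3.
  have -> : c ^+ 3 = 2 `^ (- (3 * s)).
    by rewrite -powR_mulrn ?powR_ge0// /c -powRrM; congr powR; ring.
  by rewrite ps powR_addr// powR_mulrn//; congr (_ * _); ring.
have h3 : 9 * c ^+ 5 <= (3 : R) `^ p0.
  have -> : c ^+ 5 = (2 ^+ 5) `^ (- s).
    by rewrite -powR_mulrn ?powR_ge0// /c -powRrM -powR_mulrn// -powRrM mulrC.
  rewrite ps powR_addr// powR_mulrn// (_ : - (3 * s) = 3 * - s); last by ring.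
  rewrite powRrM powR_mulrn// (_ : (3 : R) ^+ 2 = 9); last by ring.
  by rewrite ler_wpM2l//; apply: powR_base_ge; rewrite ?exprn_gt0//; lra.
have c5 : 0 < c ^+ 3 by rewrite exprn_gt0.
have : 0 < 9 * c ^+ 5 - 16 * c ^+ 3 + 7.
  (* The polynomial vanishes at c = 1, that is at p0 = 2; both factored terms show their sign for c
     < 1. *)
  have -> : 9 * c ^+ 5 - 16 * c ^+ 3 + 7 =
     3 * ((1 - c) ^+ 2 * (3 * c ^+ 3 + 6 * c ^+ 2 + 4 * c + 2)) +
     (1 - c) * (1 + c + c ^+ 2) by ring.
  have c2 : 0 < c ^+ 2 by rewrite exprn_gt0.
  apply: ltr_wpDl; first by rewrite !mulr_ge0 ?sqr_ge0//; lra.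
  by rewrite mulr_gt0//; lra.
rewrite h2; lra.
Qed.

Lemma ffact4_gt0 : 0 < ffact p0 4.
Proof.
have /andP[p0l p0r] := hp0.
rewrite /ffact !big_ord_recr big_ord0/= mul1r subr0.
have -> : p0 * (p0 - 1) * (p0 - 2) * (p0 - 3) = p0 * (p0 - 1) * ((2 - p0) * (3 - p0)) by ring.
by rewrite !mulr_gt0//; lra.
Qed.

(** The stencil touches 0, where the fourth derivative blows up; the fourth difference based at t >
    0 is nonnegative, and t tends to 0. *)
Lemma bend2_ge0 : 0 <= bend (dseq p0) 2.
Proof.
have /andP[p0l p0r] := hp0.
have -> : bend (dseq p0) 2 = 4 `^ p0 - 4 * 3 `^ p0 + 6 * 2 `^ p0 - 4 * 1 `^ p0.
  rewrite /bend /= /dseq !distnS1 /= /pw powR0; first by ring.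
  by rewrite gt_eqF//; lra.
set G := (X in 0 <= X); rewrite leNgt; apply/negP => G0.
have lip (a t : R) : 1 <= a <= 4 -> 0 < t <= 1 -> `|(a + t) `^ p0 - a `^ p0| <= 10 * t.
  move=> /andP[a1 a4] /andP[t0 t1].
  have a0 : 0 < a by lra.
  have [|z /andP[z1 z2] ->] := @powR_MVT R p0 a (a + t) a0; first by lra.
  rewrite (addrC a) addrK normrM (gtr0_norm t0) ler_wpM2r ?(ltW t0)//.
  rewrite normrM ger0_norm ?(ger0_norm (powR_ge0 _ _)); last by lra.
  have : z `^ (p0 - 1) <= 5; last first.
    by have := powR_ge0 z (p0 - 1); nra.
  apply: (@le_trans _ _ (z `^ 1)); first by apply: powR_gt0_le; lra.
  by rewrite powRr1; lra.
(* 151 = 10 * (1 + 4 + 6 + 4) + 1: the Lipschitz errors at the points 4, 3, 2, 1, and the term t^p0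
   <= t. *)
have key (t : R) : 0 < t <= 1 -> - (151 * t) <= G.
  move=> ht; have /andP[t0 t1] := ht.
  have [z /andP[z1 _] ez] := mix_MVT 0 1 p0 p0 4%N t0.
  have : 0 <= mix 0 1 p0 p0 4 z by rewrite mix01 mulr_ge0 ?powR_ge0// ltW// ffact4_gt0.
  rewrite -ez /= /fdiff.
  have q1 := lip 1 t (ltac:(by apply/andP; split; lra)) ht.
  have q2 := lip 2 t (ltac:(by apply/andP; split; lra)) ht.
  have q3 := lip 3 t (ltac:(by apply/andP; split; lra)) ht.
  have q4 := lip 4 t (ltac:(by apply/andP; split; lra)) ht.
  have q0 : t `^ p0 <= t.
    by rewrite -[leRHS](powRr1 (ltW t0)); apply: powR_le1_ge => //; lra.
  rewrite (_ : t + 1 + 1 + 1 + 1 = 4 + t); last by ring.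
  rewrite (_ : t + 1 + 1 + 1 = 3 + t); last by ring.
  rewrite (_ : t + 1 + 1 = 2 + t); last by ring.
  rewrite (addrC t 1); move: q1 q2 q3 q4; rewrite !ler_norml /G; lra.
have := key (Num.min 1 (- G / 302)); rewrite lt_min ge_min lexx ltr01 orTb andbT andTb divr_gt0 ?oppr_gt0 ?ltr0n//.
move=> /(_ isT); have : Num.min 1 (- G / 302) <= - G / 302 by rewrite ge_min lexx orbT.
lra.
Qed.

Definition clow : R := ffact p0 4 / 8.

Lemma bend_ge m : (3 <= m)%N -> clow * m%:R `^ (p0 - 4) <= bend (dseq p0) m.
Proof.
have /andP[p0l p0r] := hp0.
case: m => [//|[//|[//|k]]] _; rewrite -mixseq01.
have [z hz ->] := bend_mixseq 0 1 p0 p0 k.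
rewrite mix01 /clow -mulrA ler_wpM2l ?(ltW ffact4_gt0)//.
have r3 : -3 <= p0 - 4 <= 0 by apply/andP; split; lra.
have k0 : 0 < k.+3%:R :> R by [].
by have /andP[] := powR_range r3 k0 (range3 (isT : (4 <= 4)%N) hz).
Qed.

Lemma bend_ge0 m : (1 <= m)%N -> 0 <= bend (dseq p0) m.
Proof.
case: m => [//|[|[|m]]] _; [exact: ltW bend1_gt0|exact: bend2_ge0|].
apply: le_trans (bend_ge _) => //.
by rewrite mulr_ge0 ?powR_ge0// /clow divr_ge0// ltW// ffact4_gt0.
Qed.

Lemma slope_ge0 n : (3 <= n)%N -> 0 <= dseq p0 n.-1 - dseq p0 n.
Proof.
have /andP[p0l p0r] := hp0.
case: n => [//|[//|[//|k]]] _; rewrite -mixseq01/=.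
have [z hz ->] := slope_mixseq 0 1 p0 p0 k.
rewrite mix01 -mulNr mulr_ge0 ?powR_ge0//.
rewrite /ffact !big_ord_recr big_ord0/= mul1r subr0.
have -> : - (p0 * (p0 - 1) * (p0 - 2)) = p0 * (p0 - 1) * (2 - p0) by ring.
by rewrite !mulr_ge0//; lra.
Qed.

Lemma dseq_ge0 n : (2 <= n)%N -> 0 <= dseq p0 n.
Proof.
have /andP[p0l p0r] := hp0.
case: n => [//|[//|k]] _; rewrite -mixseq01/=.
have [z hz ->] := val_mixseq 0 1 p0 p0 k.
rewrite mix01 mulr_ge0 ?powR_ge0//.
rewrite /ffact !big_ord_recr big_ord0/= mul1r subr0.
by rewrite !mulr_ge0//; lra.
Qed.

End SpectralBounds.

(** * Frequencies and wavelengths *)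

Section FrequencyBounds.
Variable R : realType.

(** For k < 2n, the distance to the nearest multiple of the period, since k and 2n - k carry
    conjugate exponentials; it is raised to 1 at k = 0, so that wavelengths are finite and at most
    n. *)
Definition kap (n k : nat) : nat := maxn 1 (minn k (2 * n - k)).

Definition wavelength (n k : nat) : R := n%:R / (kap n k)%:R.

Lemma kap_gt0 n k : 0 < (kap n k)%:R :> R.
Proof. by rewrite ltr0n /kap; lia. Qed.

Lemma wavelength_ge1 n k : (0 < n)%N -> (k < 2 * n)%N -> 1 <= wavelength n k.
Proof.
move=> n0 kn; rewrite /wavelength ler_pdivlMr ?kap_gt0// mul1r ler_nat /kap; lia.
Qed.

Lemma wavelength_le n k : wavelength n k <= n%:R.
Proof.
rewrite /wavelength ler_pdivrMr ?kap_gt0// ler_peMr// ler1n.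
by rewrite -(ltr0n R) kap_gt0.
Qed.

Lemma freq_sin n k : (0 < n)%N -> (0 < k)%N -> (k < 2 * n)%N ->
  (2 * wavelength n k)^-1 <= sin (freq R n k / 2).
Proof.
move=> n0 k0 kn.
have n0R : 0 < n%:R :> R by rewrite ltr0n.
have H (j : nat) : (0 < j)%N -> (j <= n)%N -> j%:R / n%:R / 2 <= sin (freq R n j / 2).
  move=> j0 jn.
  have jR : j%:R / n%:R <= 1 :> R by rewrite ler_pdivrMr// mul1r ler_nat.
  have jR0 : 0 < j%:R / n%:R :> R by rewrite divr_gt0 ?ltr0n.
  have p2 := @pi_ge2 R.
  have -> : freq R n j / 2 = (pi / 2) * (j%:R / n%:R) by rewrite /freq; ring.
  apply: le_trans (sin_ge_half _); last by apply/andP; split; nra.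
  nra.
have -> : (2 * wavelength n k)^-1 = (kap n k)%:R / n%:R / 2.
  rewrite /wavelength; field.
  by rewrite !gt_eqF// kap_gt0.
have [kn'|nk] := leqP k n.
  have -> : kap n k = k by rewrite /kap; lia.
  exact: H.
have -> : kap n k = (2 * n - k)%N by rewrite /kap; lia.
have -> : sin (freq R n k / 2) = sin (freq R n (2 * n - k) / 2).
  have -> : freq R n (2 * n - k) / 2 = - (freq R n k / 2) + pi.
    by rewrite /freq natrB 1?ltnW// natrM; field; rewrite gt_eqF.
  by rewrite sinDpi sinN opprK.
by apply: H; lia.
Qed.

Lemma fejer_le_wavelength n k m : (0 < n)%N -> (k < 2 * n)%N -> (m <= n)%N ->
  fejer (freq R n k) m <= 4 * wavelength n k ^+ 2.
Proof.
move=> n0 kn mn.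
have w1 := wavelength_ge1 n0 kn.
have [k0|k0] := posnP k.
  apply: le_trans (fejer_le_sqr _ _) _.
  have -> : wavelength n k = n%:R by rewrite /wavelength k0 /kap min0n divr1.
  have : m%:R <= n%:R :> R by rewrite ler_nat.
  by have : 0 <= m%:R :> R by []; nra.
have h1 := freq_sin n0 k0 kn; have h2 := fejer_le_sin (freq R n k) m.
set s := sin _ in h1 h2; set w := wavelength _ _ in w1 h1 *.
set F := fejer _ _ in h2 *.
have F0 : 0 <= F by exact: fejer_ge0.
have w0 : 0 < (2 * w)^-1 by rewrite invr_gt0; lra.
have h3 : (2 * w)^-1 ^+ 2 * F <= 1.
  apply: le_trans h2; rewrite ler_wpM2r// lerXn2r ?nnegrE//; apply/ltW => //.
  exact: lt_le_trans h1.
have -> : F = (2 * w) ^+ 2 * ((2 * w)^-1 ^+ 2 * F) by field; rewrite gt_eqF//; lra.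
have -> : 4 * w ^+ 2 = (2 * w) ^+ 2 * 1 by ring.
by rewrite ler_wpM2l// sqr_ge0.
Qed.

Lemma fejer_ge_wavelength n k m : (0 < n)%N -> (k < 2 * n)%N ->
  4 * m%:R <= wavelength n k -> m%:R ^+ 2 / 4 <= fejer (freq R n k) m.
Proof.
move=> n0 kn hm.
have n0R : 0 < n%:R :> R by rewrite ltr0n.
have p4 : pi <= 4 :> R by have := @pihalf_lt2 R; lra.
have p0 := @pi_gt0 R.
have H (j : nat) : (j <= kap n k)%N -> m%:R ^+ 2 / 4 <= fejer (freq R n j) m.
  move=> jk; apply: fejer_ge; first by rewrite /freq divr_ge0// mulr_ge0// ltW.
  move: hm; rewrite /wavelength ler_pdivlMr ?kap_gt0// => hm.
  rewrite /freq mulrA ler_pdivrMr// mul1r; apply: le_trans hm.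
  have jkR : j%:R <= (kap n k)%:R :> R by rewrite ler_nat.
  rewrite mulrA; apply: ler_pM => //; first by rewrite mulr_ge0// ltW.
  by rewrite mulrC ler_wpM2r.
have [kn'|nk] := leqP k n; first by apply: H; rewrite /kap; lia.
have -> : fejer (freq R n k) m = fejer (freq R n (2 * n - k)) m.
  have E : freq R n k = - freq R n (2 * n - k) + pi *+ 2.
    rewrite /freq natrB 1?ltnW// natrM -mulr_natr; field; by rewrite gt_eqF.
  have E2 (a : nat) : a%:R * freq R n k =
      - (a%:R * freq R n (2 * n - k)) + (pi *+ 2) *+ a.
    by rewrite E mulrDr mulrN mulr_natl.
  rewrite /fejer /cosum /sinsum -[in RHS](sqrrN (\sum_(a < m) sin _)) -sumrN.
  congr (_ ^+ 2 + _ ^+ 2); apply: eq_bigr => a _; rewrite E2 periodicn.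
  - by rewrite cosN.
  - exact: cosD2pi.
  - by rewrite sinN.
  - exact: sinD2pi.
by apply: H; rewrite /kap; lia.
Qed.

(** Each j is reached at most from j and 2n - j, and j = 1 once more from k = 0; the factor 3 covers
    all cases. *)
Lemma sum_kap n (f : nat -> R) : (0 < n)%N -> (forall j, 0 <= f j) ->
  \sum_(k < 2 * n) f (kap n k) <= 3 * \sum_(1 <= j < n.+1) f j.
Proof.
move=> n0 f0.
rewrite -(big_mkord xpredT (fun k => f (kap n k))).
rewrite (@big_cat_nat _ _ _ n) ?leq_pmull//=.
have S1 : \sum_(n <= k < 2 * n) f (kap n k) <= \sum_(1 <= j < n.+1) f j.
  rewrite big_nat_rev/= le_eqVlt; apply/orP; left; apply/eqP.
  rewrite (_ : 2 * n = n + n)%N; last by lia.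
  rewrite -{1}[n]add0n big_addn addnK [RHS]big_add1/=.
  by apply: eq_big_nat => j /andP[_ jn]; congr f; rewrite /kap; lia.
have S0 : \sum_(1 <= j < n) f j <= \sum_(1 <= j < n.+1) f j.
  by rewrite [leRHS]big_nat_recr//= lerDl.
have S2 : \sum_(0 <= k < n) f (kap n k) <= 2 * \sum_(1 <= j < n.+1) f j.
  rewrite big_ltn//.
  have -> : kap n 0 = 1%N by rewrite /kap; lia.
  have -> : \sum_(1 <= k < n) f (kap n k) = \sum_(1 <= k < n) f k.
    by apply: eq_big_nat => j /andP[j1 jn]; congr f; rewrite /kap; lia.
  have : f 1%N <= \sum_(1 <= j < n.+1) f j.
    by rewrite [leRHS]big_ltn// lerDl sumr_ge0.
  lra.
lra.
Qed.

Lemma spectral_mixseq A B p q n k :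
  spectral (mixseq A B p q) n k =
  A * spectral (@dseq R p) n k + B * spectral (dseq q) n k.
Proof.
rewrite /spectral !mulrDr !mulr_sumr.
have -> : \sum_(1 <= m < n) bend (mixseq A B p q) m * fejer (freq R n k) m =
  \sum_(1 <= m < n) A * (bend (@dseq R p) m * fejer (freq R n k) m) +
  \sum_(1 <= m < n) B * (bend (@dseq R q) m * fejer (freq R n k) m).
  rewrite -big_split/=; apply: eq_bigr => m _; rewrite /bend /mixseq; ring.
rewrite /mixseq; ring.
Qed.

End FrequencyBounds.

(** * Upper and lower bounds of the spectral weights *)

Section GaussianPair.
Variable R : realType.

Section FixedExponent.
Variables (p0 b : R).
Hypothesis (hp0 : 1 < p0 < 2) (hb : b = (p0 - 1) / 4).

Let b0 : 0 < b. Proof. by move: hp0 => /andP[? ?]; rewrite hb; lra. Qed.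
Let b1 : b <= 1 / 4. Proof. by move: hp0 => /andP[? ?]; rewrite hb; lra. Qed.

Lemma twoside_le_small (x : R) : 0 < x -> x <= 1 -> twoside b x <= 2 * x `^ (- b).
Proof.
move=> x0 x1; rewrite /twoside.
have : x `^ b <= x `^ (- b) by apply: powR_le1_ge => //; have := b0; lra.
lra.
Qed.

Lemma twoside_le_large (x : R) : 1 <= x -> twoside b x <= 2 * x `^ b.
Proof.
move=> x1; rewrite /twoside.
have : x `^ (- b) <= x `^ b by apply: powR_gt0_le => //; have := b0; lra.
lra.
Qed.

(** The decay exponents, in m / u, of the sums below and above the wavelength u. With b = (p0 - 1) /
    4 the first is less than 1 and the second greater than 1, so both sums are of order u. *)
Definition alow : R := 2 - p0 + b.
Definition bhigh : R := 4 - p0 - b.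
Definition Csum : R := 2 / (1 - alow) + 8 * (2 `^ (bhigh - 1) / (bhigh - 1)).

Lemma alow_range : 0 <= alow < 1.
Proof. by move: hp0 => /andP[? ?]; have := b0; rewrite /alow hb => ?; apply/andP; split; lra. Qed.

Lemma bhigh_gt1 : 1 < bhigh.
Proof. by move: hp0 => /andP[? ?]; rewrite /bhigh hb; lra. Qed.

Lemma Csum_ge0 : 0 <= Csum.
Proof.
have /andP[_ h] := alow_range; have h2 := bhigh_gt1.
have q1 : 0 <= 2 / (1 - alow) by rewrite divr_ge0//; lra.
have q2 : 0 <= 2 `^ (bhigh - 1) / (bhigh - 1) by rewrite divr_ge0 ?powR_ge0//; lra.
rewrite /Csum; lra.
Qed.

(** The sum is split at m = u. Below, F is bounded by m^2, as without cancellation; above,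
    oscillation caps it at 4 u^2. Both halves are of order u^(p0 - 1), and [twoside] only shifts
    their exponents by b. *)
Lemma weighted_sum (u : R) n (F : nat -> R) : 1 <= u ->
  (forall m, (1 <= m < n)%N -> 0 <= F m) ->
  (forall m, (1 <= m < n)%N -> F m <= m%:R ^+ 2) ->
  (forall m, (1 <= m < n)%N -> F m <= 4 * u ^+ 2) ->
  \sum_(1 <= m < n) m%:R `^ (p0 - 4) * twoside b (m%:R / u) * F m <=
  Csum * u `^ (p0 - 1).
Proof.
move=> u1 F0 F1 F2; have u0 : 0 < u by lra.
rewrite (bigID (fun m : nat => m%:R <= u))/=.
have /andP[a0 a1] := alow_range; have bh := bhigh_gt1.
have up : u `^ (p0 - 1) = u `^ (p0 - 2) * u.
  by rewrite -{3}(powRr1 (ltW u0)) -powR_addr//; congr powR; ring.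
have sc (m : nat) (r : R) : (0 < m)%N -> m%:R `^ r = u `^ r * (m%:R / u) `^ r.
  move=> m0; rewrite -powRM ?divr_ge0 ?(ltW u0)//; congr powR; field.
  by rewrite gt_eqF.
have -> : Csum * u `^ (p0 - 1) = 2 * u `^ (p0 - 2) * (u / (1 - alow)) +
   8 * u `^ (p0 - 2) * (2 `^ (bhigh - 1) / (bhigh - 1) * u).
  by rewrite up /Csum; ring.
apply: lerD.
  apply: (@le_trans _ _ (\sum_(1 <= m < n | m%:R <= u)
     2 * u `^ (p0 - 2) * (m%:R / u) `^ (- alow))).
    rewrite big_nat_cond [leRHS]big_nat_cond; apply: ler_sum => m /andP[mn mu].
    have m0 : (0 < m)%N by case/andP: mn.
    have m0R : 0 < m%:R :> R by rewrite ltr0n.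
    have x0 : 0 < m%:R / u by rewrite divr_gt0.
    have x1 : m%:R / u <= 1 by rewrite ler_pdivrMr// mul1r.
    have T := twoside_le_small x0 x1.
    apply: (@le_trans _ _ (m%:R `^ (p0 - 4) * (2 * (m%:R / u) `^ (- b)) * m%:R ^+ 2)).
      apply: ler_pM; rewrite ?mulr_ge0 ?powR_ge0 ?twoside_ge0 ?F0 ?F1//.
      by rewrite ler_wpM2l ?powR_ge0.
    have -> : m%:R `^ (p0 - 4) * (2 * (m%:R / u) `^ (- b)) * m%:R ^+ 2 =
       2 * (m%:R `^ (p0 - 4) * m%:R `^ 2) * (m%:R / u) `^ (- b).
      by rewrite powR_mulrn ?ler0n//; ring.
    rewrite -powR_addr// (_ : p0 - 4 + 2 = p0 - 2); last by ring.
    rewrite sc// -!mulrA -powR_addr// (_ : p0 - 2 - b = - alow)//.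
    by rewrite /alow; ring.
  rewrite -mulr_sumr ler_wpM2l ?mulr_ge0 ?powR_ge0//.
  by apply: sum_low => //; rewrite a0 a1.
apply: (@le_trans _ _ (\sum_(1 <= m < n | u < m%:R)
     8 * u `^ (p0 - 2) * (m%:R / u) `^ (- bhigh))).
  rewrite big_nat_cond [leRHS]big_nat_cond.
  rewrite [leRHS](eq_bigl (fun i => (0 < i < n)%N && ~~ (i%:R <= u))); last first.
    by move=> i; rewrite -ltNge.
  apply: ler_sum => m /andP[mn]; rewrite -ltNge => mu.
  have m0 : (0 < m)%N by case/andP: mn.
  have m0R : 0 < m%:R :> R by rewrite ltr0n.
  have x1 : 1 <= m%:R / u by rewrite ler_pdivlMr// mul1r ltW.
  have x0 : 0 < m%:R / u by lra.
  have T := twoside_le_large x1.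
  apply: (@le_trans _ _ (m%:R `^ (p0 - 4) * (2 * (m%:R / u) `^ b) * (4 * u ^+ 2))).
    apply: ler_pM; rewrite ?mulr_ge0 ?powR_ge0 ?twoside_ge0 ?F0 ?F2//.
    by rewrite ler_wpM2l ?powR_ge0.
  rewrite sc//.
  have -> : u `^ (p0 - 4) * (m%:R / u) `^ (p0 - 4) * (2 * (m%:R / u) `^ b) * (4 * u ^+ 2) =
     8 * (u `^ (p0 - 4) * u `^ 2) * ((m%:R / u) `^ (p0 - 4) * (m%:R / u) `^ b).
    by rewrite powR_mulrn ?(ltW u0)//; ring.
  rewrite -!powR_addr// (_ : p0 - 4 + 2 = p0 - 2); last by ring.
  by rewrite (_ : p0 - 4 + b = - bhigh)// /bhigh; ring.
rewrite -mulr_sumr ler_wpM2l ?mulr_ge0 ?powR_ge0//.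
exact: sum_high.
Qed.

(** 12 = 8 + 4. The end slope gives 2 * 4, since [twoside] is at most 2 (n / u)^b and the kernel at
    most 4 u^2; the constant term lives at k = 0 only, where u = n, and gives 2 * 2. *)
Lemma spectral_bound d n k K : (3 <= n)%N -> (k < 2 * n)%N -> 0 <= K ->
  tame p0 b d (wavelength R n k) K n ->
  `|spectral d n k| <= (Csum + 12) * K * wavelength R n k `^ (p0 - 1).
Proof.
move=> n3 kn K0 [h1 h2 h3].
have /andP[p0l p0r] := hp0; have bq := b1; have bp := b0.
have n0 : (0 < n)%N by lia.
have n0R : 0 < n%:R :> R by rewrite ltr0n.
set u := wavelength R n k in h1 h2 h3 *.
have u1 : 1 <= u by exact: wavelength_ge1.
have u0 : 0 < u by lra.
have un : u <= n%:R by exact: wavelength_le.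
have x1 : 1 <= n%:R / u by rewrite ler_pdivlMr// mul1r.
have x0 : 0 < n%:R / u by lra.
have T := twoside_le_large x1.
have sc (r : R) : n%:R `^ r = u `^ r * (n%:R / u) `^ r.
  rewrite -powRM ?divr_ge0 ?(ltW u0)//; congr powR; field.
  by rewrite gt_eqF.
have F0 m : 0 <= fejer (freq R n k) m by exact: fejer_ge0.
rewrite /spectral.
have -> : (Csum + 12) * K * u `^ (p0 - 1) = K * (Csum * u `^ (p0 - 1)) +
  K * (8 * u `^ (p0 - 1)) + K * (4 * u `^ (p0 - 1)) by ring.
apply: le_trans (ler_normD _ _) _; apply: lerD.
  apply: le_trans (ler_normD _ _) _; apply: lerD.
    apply: le_trans (ler_norm_sum _ _ _) _.
    apply: (@le_trans _ _ (K * \sum_(1 <= m < n)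
       m%:R `^ (p0 - 4) * twoside b (m%:R / u) * fejer (freq R n k) m)).
      rewrite mulr_sumr big_nat_cond [leRHS]big_nat_cond; apply: ler_sum => m /andP[mn _].
      by rewrite normrM (ger0_norm (F0 m)) mulrA ler_wpM2r// h1.
    rewrite ler_wpM2l//; apply: weighted_sum => // m /andP[m1 mn].
      exact: fejer_le_sqr.
    by apply: fejer_le_wavelength => //; exact: ltnW.
  rewrite normrM (ger0_norm (F0 n)).
  apply: le_trans (ler_wpM2r (F0 n) h2) _; rewrite -mulrA ler_wpM2l//.
  apply: (@le_trans _ _ (n%:R `^ (p0 - 3) * (2 * (n%:R / u) `^ b) * (4 * u ^+ 2))).
    apply: ler_pM; rewrite ?mulr_ge0 ?powR_ge0 ?twoside_ge0//.
      by rewrite ler_wpM2l ?powR_ge0.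
    exact: fejer_le_wavelength.
  rewrite sc.
  have -> : u `^ (p0 - 3) * (n%:R / u) `^ (p0 - 3) * (2 * (n%:R / u) `^ b) * (4 * u ^+ 2) =
     8 * (u `^ (p0 - 3) * u `^ 2) * ((n%:R / u) `^ (p0 - 3) * (n%:R / u) `^ b).
    by rewrite powR_mulrn ?(ltW u0)//; ring.
  rewrite -!powR_addr// (_ : p0 - 3 + 2 = p0 - 1); last by ring.
  rewrite ler_piMr ?mulr_ge0 ?powR_ge0//.
  by have := powR_gt0_le x1 (_ : p0 - 3 + b <= 0); rewrite powRr0; apply; lra.
have [k0|k0] := eqVneq k 0%N; last first.
  by rewrite muln0 mul0r normr0 mulr_ge0// mulr_ge0// powR_ge0.
have un2 : u = n%:R by rewrite /u /wavelength k0 /kap min0n divr1.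
rewrite muln1 normrM ger0_norm//.
apply: le_trans (ler_wpM2l _ h3) _ => //.
rewrite un2 divff ?gt_eqF// /twoside !powR1 mulrCA ler_wpM2l//.
have -> : n%:R `^ (p0 - 1) = n%:R `^ (p0 - 2) * n%:R :> R.
  by rewrite -{3}(powRr1 (ltW n0R)) -powR_addr//; congr powR; ring.
by rewrite natrM le_eqVlt; apply/orP; left; apply/eqP; ring.
Qed.

(** The first entry serves wavelengths below 24, where only the bend at 1 is kept and u^(p0 - 1) <=
    24; the second serves the longer ones and is [clow p0 / 4 / 16], from [fejer_bend_ge] and
    [sum_lower]. *)
Definition cS : R := Num.min (bend (dseq p0) 1 / 24) (clow p0 / 64).

Lemma clow_gt0 : 0 < clow p0.
Proof. by rewrite /clow divr_gt0// ffact4_gt0. Qed.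

Lemma cS_gt0 : 0 < cS.
Proof. by rewrite /cS lt_min; apply/andP; split; apply: divr_gt0 => //; [exact: bend1_gt0 hp0 hb|exact: clow_gt0]. Qed.

Lemma fejer_bend_ge n k m : (0 < n)%N -> (k < 2 * n)%N -> (3 <= m)%N ->
  4 * m%:R <= wavelength R n k ->
  clow p0 / 4 * m%:R `^ (p0 - 2) <= bend (dseq p0) m * fejer (freq R n k) m.
Proof.
move=> n0 kn m3 mu.
have m0R : 0 < m%:R :> R by rewrite ltr0n (leq_trans _ m3).
have -> : clow p0 / 4 * m%:R `^ (p0 - 2) = clow p0 * m%:R `^ (p0 - 4) * (m%:R ^+ 2 / 4).
  have -> : m%:R `^ (p0 - 2) = m%:R `^ (p0 - 4) * m%:R `^ 2.
    by rewrite -powR_addr//; congr powR; ring.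
  by rewrite powR_mulrn ?ler0n//; ring.
apply: ler_pM.
- by rewrite mulr_ge0 ?powR_ge0// ltW// clow_gt0.
- by rewrite divr_ge0// sqr_ge0.
- exact: bend_ge.
- exact: fejer_ge_wavelength.
Qed.

(** Only 3 <= m <= M is kept, M being the integral part of u / 4, and each term is bounded below by
    the last because p0 < 2. The threshold 24 gives M >= 6, hence M - 2 >= M / 2 terms, and M >= u /
    8: the factor 16 is 2 * 8. *)
Lemma sum_lower (f : nat -> R) (c u : R) n : 0 <= c -> 24 <= u <= n%:R ->
  (forall m, (1 <= m)%N -> 0 <= f m) ->
  (forall m, (3 <= m)%N -> 4 * m%:R <= u -> c * m%:R `^ (p0 - 2) <= f m) ->
  c / 16 * u `^ (p0 - 1) <= \sum_(1 <= m < n) f m.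
Proof.
move=> c0 /andP[u24 un] f0 fl; have /andP[p0l p0r] := hp0.
have u0 : 0 < u by lra.
have [M M1 M2] : exists2 M : nat, M%:R <= u / 4 & u / 4 < M%:R + 1.
  exists (Num.truncn (u / 4)).
    by have /andP[] : (Num.truncn (u / 4))%:R <= u / 4 < (Num.truncn (u / 4)).+1%:R by apply: truncn_itv; lra.
  by rewrite natr1; have /andP[] : (Num.truncn (u / 4))%:R <= u / 4 < (Num.truncn (u / 4)).+1%:R by apply: truncn_itv; lra.
have M5 : (5 < M)%N by rewrite -(ltr_nat R); lra.
have Mn : (M < n)%N by rewrite -(ltr_nat R); lra.
have M0R : 0 < M%:R :> R by rewrite ltr0n (leq_trans _ M5).
have n3 : (3 <= n)%N by apply: leq_trans (ltnW Mn); exact: (leq_trans (isT : (3 <= 6)%N) M5).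
have pos a b' : (1 <= a)%N -> 0 <= \sum_(a <= m < b') f m.
  move=> a1; rewrite big_nat_cond sumr_ge0// => m /andP[/andP[am _] _].
  by apply: f0; exact: leq_trans a1 am.
rewrite (@big_cat_nat _ _ _ 3 1 n)//= ler_wpDl ?pos//.
rewrite (@big_cat_nat _ _ _ M.+1 3 n)//=; last exact: (leq_trans (isT : (3 <= 6)%N) (leqW M5)).
rewrite ler_wpDr ?pos//.
apply: (@le_trans _ _ (\sum_(3 <= m < M.+1) c * M%:R `^ (p0 - 2))); last first.
  apply: ler_sum_nat => m /andP[m3 mM].
  have m0R : 0 < m%:R :> R by rewrite ltr0n (leq_trans _ m3).
  have mMR : m%:R <= M%:R :> R by rewrite ler_nat -ltnS.
  apply: le_trans (fl _ m3 _); last by lra.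
  by rewrite ler_wpM2l//; apply: powR_base_ge => //; lra.
rewrite sumr_const_nat -[leRHS]mulr_natl subSS natrB; last exact: (leq_trans (isT : (2 <= 6)%N) M5).
have e1 : M%:R `^ (p0 - 1) = M%:R `^ (p0 - 2) * M%:R.
  by rewrite -{3}(powRr1 (ltW M0R)) -powR_addr//; congr powR; ring.
have e2 : 8^-1 * u `^ (p0 - 1) <= M%:R `^ (p0 - 1).
  apply: (@le_trans _ _ ((8^-1 * u) `^ (p0 - 1))).
    rewrite powRM ?(ltW u0)// ler_wpM2r ?powR_ge0//.
    rewrite -[leLHS](powRr1 (_ : 0 <= 8^-1))//.
    by apply: powR_le1_ge => //; lra.
  by apply: powR_base_le; lra.
have e3 : M%:R `^ (p0 - 1) / 2 <= (M%:R - 2) * M%:R `^ (p0 - 2).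
  rewrite e1; have : 4 <= M%:R :> R by rewrite (ler_nat _ 4) (leq_trans _ M5).
  by have := powR_ge0 (M%:R : R) (p0 - 2); nra.
rewrite mulrCA -mulrA ler_wpM2l//; lra.
Qed.

(** The bends, the end slope and the end value are all nonnegative, so any selection of bends bounds
    the weight from below. *)
Lemma spectral_lower n k : (3 <= n)%N -> (k < 2 * n)%N ->
  cS * wavelength R n k `^ (p0 - 1) <= spectral (dseq p0) n k.
Proof.
move=> n3 kn; have /andP[p0l p0r] := hp0.
have n0 : (0 < n)%N by lia.
set u := wavelength R n k.
have u1 : 1 <= u by exact: wavelength_ge1.
have u0 : 0 < u by lra.
have un : u <= n%:R by exact: wavelength_le.
have up0 : 0 < u `^ (p0 - 1) by exact: powR_gt0.
have B0 m : (1 <= m)%N -> 0 <= bend (dseq p0) m * fejer (freq R n k) m.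
  by move=> m1; rewrite mulr_ge0 ?fejer_ge0// (bend_ge0 hp0 hb).
have H : \sum_(1 <= m < n) bend (dseq p0) m * fejer (freq R n k) m
    <= spectral (dseq p0) n k.
  rewrite /spectral -addrA lerDl addr_ge0//.
    by rewrite mulr_ge0 ?fejer_ge0// (slope_ge0 hp0).
  by rewrite mulr_ge0// (dseq_ge0 hp0)//; lia.
apply: le_trans H.
have [u24|u24] := ltP u 24.
  rewrite big_ltn; last by lia.
  have -> : fejer (freq R n k) 1 = 1.
    by rewrite /fejer /cosum /sinsum !big_ord1 mul0r cos0 sin0 expr1n expr0n addr0.
  rewrite mulr1 ler_wpDr//.
    by rewrite big_nat_cond sumr_ge0// => m /andP[/andP[m1 _] _]; apply: B0; lia.
  have q : u `^ (p0 - 1) <= 24.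
    apply: (@le_trans _ _ (u `^ 1)); first by apply: powR_gt0_le => //; lra.
    by rewrite powRr1; lra.
  have c1 : cS <= bend (dseq p0) 1 / 24 by rewrite /cS ge_min lexx.
  have := bend1_gt0 hp0 hb; have := cS_gt0; nra.
have c2 : cS <= clow p0 / 4 / 16 by rewrite /cS ge_min; apply/orP; right; lra.
apply: le_trans (ler_wpM2r (ltW up0) c2) _.
apply: sum_lower => //.
- by rewrite divr_ge0// ltW// clow_gt0.
- by rewrite u24 un.
- by move=> m m3 m4; apply: fejer_bend_ge.
Qed.

End FixedExponent.
End GaussianPair.

(** * Two Gaussian representations over the same frequencies *)

Section PairConstruction.
Variable R : realType.

(** The weight is linear in the sequence, so the rescaled difference of weights is the weight of a
    [mixseq], of order |p1 - p0| by [tame_diff]. Division by the lower bound, which carries the same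
    power of the wavelength, leaves a relative error uniform in n and k. *)
Lemma spectral_ratio (p0 : R) : 1 < p0 < 2 ->
  exists C1 C2 d0 : R, [/\ 0 < C1, 0 < C2, 0 < d0 &
  forall n k (p1 : R), (3 <= n)%N -> (k < 2 * n)%N -> 0 <= p1 <= 2 ->
    `|p1 - p0| <= d0 ->
    [/\ 0 < spectral (dseq p0) n k,
        spectral (dseq p0) n k <= C2 * wavelength R n k `^ (p0 - 1) &
        `|wavelength R n k `^ (- (p1 - p0)) * spectral (dseq p1) n k
           - spectral (dseq p0) n k|
        <= C1 * `|p1 - p0| * spectral (dseq p0) n k]].
Proof.
move=> hp0; have /andP[p0l p0r] := hp0.
pose b := (p0 - 1) / 4; have hb : b = (p0 - 1) / 4 by [].
have b0 : 0 < b by rewrite /b; lra.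
have CS := Csum_ge0 hp0 hb.
have c0 := cS_gt0 hp0 hb.
pose K := Kmix b + 15 * Ksmall b.
have Ks0 : 0 <= Ksmall b by exact: Ksmall_ge0 hp0 hb.
have Km0 : 0 <= Kmix b.
  have bi : 0 <= b^-1 by rewrite invr_ge0 ltW.
  by have := mulr_ge0 (ler0n R 162) bi; rewrite /Kmix; lra.
have K0 : 0 <= K by rewrite /K; lra.
have Kse : 0 <= Kself R by rewrite /Kself addr_ge0 ?mulr_ge0// ?exprn_ge0.
exists ((Csum p0 b + 12) * K / cS p0 + 1), ((Csum p0 b + 12) * Kself R + 1), (b / 2).
have Cp : 0 <= Csum p0 b + 12 by lra.
split.
- by rewrite ltr_wpDl// divr_ge0 ?mulr_ge0// ltW.
- by rewrite ltr_wpDl// mulr_ge0.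
- by lra.
move=> n k p1 n3 kn hp1 hd.
have n0 : (0 < n)%N by exact: leq_trans n3.
have u1 := wavelength_ge1 R n0 kn.
set u := wavelength R n k in u1 *.
have u0 : 0 < u by lra.
have low := spectral_lower hp0 hb n3 kn.
have up0 : 0 < u `^ (p0 - 1) by exact: powR_gt0.
split.
- by apply: lt_le_trans low; rewrite mulr_gt0.
- apply: le_trans (ler_norm _) _.
  apply: le_trans (spectral_bound hp0 hb n3 kn Kse (tame_self hp0 hb u1 n3)) _.
  by rewrite -/u ler_wpM2r ?(ltW up0)//; lra.
have KD : 0 <= K * `|p1 - p0| by rewrite mulr_ge0.
have := spectral_bound hp0 hb n3 kn KD (tame_diff hp0 hb hp1 hd u1 n3).
rewrite spectral_mixseq mulN1r -/u => /le_trans; apply.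
apply: (@le_trans _ _ ((Csum p0 b + 12) * K / cS p0 * `|p1 - p0| * (cS p0 * u `^ (p0 - 1)))).
  by rewrite le_eqVlt; apply/orP; left; apply/eqP; field; rewrite gt_eqF.
apply: ler_pM => //.
- by rewrite !mulr_ge0// invr_ge0 ltW.
- by rewrite mulr_ge0 ?(ltW c0) ?(ltW up0).
- by rewrite ler_wpM2r//; lra.
Qed.

Lemma pw_dist (p : R) i i' : p != 0 ->
  \sum_(l < i) \sum_(l' < i') dseq p (distn l l') = pw p i + pw p i' - pw p (distn i i').
Proof.
by move=> p0; rewrite -second_difference// /pw powR0.
Qed.

(** The eigenvectors on the grid: sums of a cosine or of a sine, the boolean telling which. *)
Definition wave n (q : 'I_(2 * n) * bool) (i : nat) : R :=
  if q.2 then cosum (freq R n q.1) i else sinsum (freq R n q.1) i.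

Lemma sum_pair_bool n (f : 'I_(2 * n) * bool -> R) :
  \sum_q f q = \sum_(k < 2 * n) (f (k, true) + f (k, false)).
Proof.
rewrite (eq_bigr (fun q => f (q.1, q.2))); last by case.
rewrite -(pair_bigA _ (fun k b => f (k, b)))/=.
by apply: eq_bigr => k _; rewrite big_bool.
Qed.

Lemma cov_wave (p : R) n i i' (c : 'I_(2 * n) * bool -> R) V : (0 < n)%N -> p != 0 ->
  (i <= n)%N -> (i' <= n)%N ->
  (forall k b, c (k, b) = V * spectral (dseq p) n k / (4 * n%:R)) ->
  V / 2 * (pw p i + pw p i' - pw p (distn i i')) =
  \sum_q c q * (wave q i * wave q i').
Proof.
move=> n0 pn0 hi hi' hc.
have n0R : 0 < n%:R :> R by rewrite ltr0n.
rewrite sum_pair_bool.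
transitivity (V / (4 * n%:R) * \sum_(k < 2 * n) spectral (dseq p) n k *
    (cosum (freq R n k) i * cosum (freq R n k) i' +
     sinsum (freq R n k) i * sinsum (freq R n k) i')).
  by rewrite -spectral_cov// pw_dist// natrM; field; rewrite gt_eqF.
by rewrite mulr_sumr; apply: eq_bigr => k _; rewrite !hc /wave /=; ring.
Qed.

Lemma sqrt_sub1_norm (x : R) : 0 <= x -> (1 - Num.sqrt x) ^+ 2 <= (x - 1) ^+ 2.
Proof.
move=> x0; have s0 := sqrtr_ge0 x; rewrite -{2}(sqr_sqrtr x0).
set s := Num.sqrt x in s0 *.
rewrite (_ : s ^+ 2 - 1 = (1 - s) * (- (1 + s))); last by ring.
by rewrite exprMn ler_peMr ?sqr_ge0// sqrrN; nra.
Qed.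

(** [A0] and [A1] are the loadings of the two signals on independent centred Gaussians, of standard
    deviation 1 for the first signal and [r q] for the second. The factor N^(p1 - p0) makes both
    spectra comparable at frequency N; the last two conclusions are the costs of the low and of the
    high frequencies. *)
Lemma gaussian_pair (p0 V : R) : 1 < p0 < 2 -> 0 < V ->
  exists C d0 : R, [/\ 0 < C, 0 < d0 &
  forall (n : nat) (N p1 : R), (3 <= n)%N -> 1 <= N -> N `^ (p0 + 1) = n%:R ->
    0 < p1 <= 2 -> `|p1 - p0| <= d0 ->
  exists (A0 A1 : 'I_(2 * n) * bool -> nat -> R) (r : 'I_(2 * n) * bool -> R),
  [/\ (forall q, 0 < r q),
      (forall i i', (i <= n)%N -> (i' <= n)%N ->
        V / 2 * n%:R `^ (- p0) * (pw p0 i + pw p0 i' - pw p0 (distn i i')) =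
        \sum_q A0 q i * A0 q i'),
      (forall i i', (i <= n)%N -> (i' <= n)%N ->
        V * N `^ (p1 - p0) / 2 * n%:R `^ (- p1) *
          (pw p1 i + pw p1 i' - pw p1 (distn i i')) =
        \sum_q r q ^+ 2 * (A1 q i * A1 q i')),
      \sum_q (1 - r q) ^+ 2 <= C * (p1 - p0) ^+ 2 * N &
      \sum_q \sum_(i < n.+1) (A0 q i - A1 q i) ^+ 2 <= C * (p1 - p0) ^+ 2 * N]].
Proof.
move=> hp0 V0; have /andP[p0l p0r] := hp0.
have [C1 [C2 [d1 [C10 C20 d10 HS]]]] := spectral_ratio hp0.
pose b := (p0 - 1) / 4; have hb : b = (p0 - 1) / 4 by [].
have b0 : 0 < b by rewrite /b; lra.
have b1 : b <= 1 / 4 by rewrite /b; lra.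
pose C3 := 4 / b + C1.
have C30 : 0 < C3 by rewrite /C3 addr_gt0// divr_gt0.
(* Decay exponent of the high frequencies once the square of the [twoside] factor is paid for; it
   exceeds 1. *)
pose be := p0 + 1 - 2 * b.
have be1 : 1 < be by rewrite /be /b; lra.
(* Here 24 = 2 * 4 * 3: cosine and sine, the square of the 2 in [twoside_le_small], and
   [sum_kap]. *)
pose Ca := 24 * C3 ^+ 2 / (1 - 2 * b).
pose Cb := 24 * (V * C2 * C3 ^+ 2 * (2 `^ (be - 1) / (be - 1))).
have Ca0 : 0 < Ca.
  by rewrite /Ca; apply: divr_gt0; [apply: mulr_gt0 => //; exact: exprn_gt0|lra].
have Cb0 : 0 < Cb.
  apply: mulr_gt0 => //; apply: mulr_gt0; last by rewrite divr_gt0 ?powR_gt0//; lra.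
  by apply: mulr_gt0; [exact: mulr_gt0|exact: exprn_gt0].
exists (Ca + Cb), (Num.min d1 (Num.min (b / 2) (1 / (2 * C1)))); split.
- exact: addr_gt0.
- by rewrite !lt_min d10 /=; apply/andP; split; apply: divr_gt0 => //; exact: mulr_gt0.
move=> n N p1 n3 N1 Nn /andP[p10 p12]; rewrite !le_min => /and3P[D1 D2 D3].
have n0 : (0 < n)%N by exact: leq_trans n3.
have n0R : 0 < n%:R :> R by rewrite ltr0n.
have n1R : 1 <= n%:R :> R by rewrite ler1n.
have N0 : 0 < N by lra.
set D := p1 - p0 in D1 D2 D3 *.
have hp1 : 0 <= p1 <= 2 by rewrite ltW.
pose S0 k := spectral (dseq p0) n k : R; pose S1 k := spectral (dseq p1) n k : R.
pose y k : R := (kap n k)%:R / N.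
have y0 k : 0 < y k by rewrite divr_gt0 ?kap_gt0.
(* The ratio of the variances of the two signals at frequency k. It is y^(-D) times a factor 1 +
   O(D): close to 1 where y = 1, that is at N, and drifting like a small power of y away from it. *)
pose R2 k := (N / n%:R) `^ D * (S1 k / S0 k).
have HR k : (k < 2 * n)%N -> [/\ 0 < S0 k, 0 < R2 k &
    `|R2 k - 1| <= C3 * `|D| * twoside b (y k)].
  move=> kn; have [s0 _ sd] := HS n k p1 n3 kn hp1 D1.
  rewrite -/(S0 k) -/(S1 k) -/D in s0 sd.
  pose rho := wavelength R n k `^ (- D) * S1 k / S0 k.
  have hr : `|rho - 1| <= C1 * `|D|.
    have -> : rho - 1 = (wavelength R n k `^ (- D) * S1 k - S0 k) / S0 k.
      by rewrite /rho; field; rewrite gt_eqF.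
    by rewrite normrM normfV (gtr0_norm s0) ler_pdivrMr.
  have C1D : C1 * `|D| <= 1 / 2.
    move: D3; rewrite ler_pdivlMr ?mulr_gt0//; lra.
  have /andP[r1 r2] : 1 / 2 <= rho <= 3 / 2.
    by move: (le_trans hr C1D); rewrite ler_norml => /andP[w1 w2]; clear - w1 w2; apply/andP; split; lra.
  have eR : R2 k = y k `^ (- D) * rho.
    have w0 : 0 < wavelength R n k by rewrite divr_gt0 ?kap_gt0.
    have nN0 : 0 <= n%:R / N by rewrite divr_ge0 ?(ltW n0R) ?(ltW N0).
    have e : y k * wavelength R n k = n%:R / N.
      by rewrite /y /wavelength; field; rewrite !gt_eqF// kap_gt0.
    have e2 : N / n%:R = (n%:R / N) `^ (-1) by rewrite powR_inv1// invf_div.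
    rewrite /R2 /rho !mulrA e2 -powRrM mulN1r -e powRM ?(ltW w0) ?(ltW (y0 k))//.
  split => //; first by rewrite eR mulr_gt0 ?powR_gt0//; lra.
  have -> : R2 k - 1 = rho * (y k `^ (- D) - 1) + (rho - 1) by rewrite eR; ring.
  apply: le_trans (ler_normD _ _) _; rewrite normrM.
  have t1 := twoside_ge1 (ltW b0) (y0 k).
  have q := powR_sub1_norm (y0 k) b0 (_ : `|- D| <= b / 2).
  rewrite normrN in q; have {}q := q D2.
  have rn : `|rho| <= 2 by rewrite ger0_norm; clear - r1 r2; lra.
  have q2 : `|rho| * `|y k `^ (- D) - 1| <= 2 * (2 / b * `|D| * twoside b (y k)).
    exact: ler_pM.
  have q3 : `|rho - 1| <= C1 * `|D| * twoside b (y k).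
    by apply: le_trans hr _; rewrite ler_peMr// mulr_ge0// ltW.
  apply: le_trans (lerD q2 q3) _.
  by rewrite /C3 le_eqVlt; apply/orP; left; apply/eqP; ring.
pose al k := Num.sqrt (V * n%:R `^ (- p0) * S0 k / (4 * n%:R)).
have al2 k : (k < 2 * n)%N -> al k ^+ 2 = V * n%:R `^ (- p0) * S0 k / (4 * n%:R).
  move=> kn; have [s0 _ _] := HR _ kn.
  by rewrite sqr_sqrtr// divr_ge0 ?mulr_ge0 ?powR_ge0// ltW.
pose low k := (kap n k)%:R <= N.
(* Up to N the ratio is a change of variance under equal loadings, beyond N a change of loading
   under equal variances. *)
pose rr (q : 'I_(2 * n) * bool) := if low q.1 then Num.sqrt (R2 q.1) else 1.
pose ss (q : 'I_(2 * n) * bool) := if low q.1 then 1 else Num.sqrt (R2 q.1).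
pose A0 (q : 'I_(2 * n) * bool) i := al q.1 * wave q i.
have sR k : (k < 2 * n)%N -> Num.sqrt (R2 k) ^+ 2 = R2 k.
  by move=> kn; have [_ s0 _] := HR _ kn; rewrite sqr_sqrtr// ltW.
have dev k : (k < 2 * n)%N ->
    (1 - Num.sqrt (R2 k)) ^+ 2 <= C3 ^+ 2 * D ^+ 2 * twoside b (y k) ^+ 2.
  move=> kn; have [_ s0 s1] := HR _ kn.
  apply: le_trans (sqrt_sub1_norm (ltW s0)) _.
  rewrite -[leLHS]real_normK ?num_real// -[D ^+ 2]real_normK ?num_real// -!exprMn.
  by rewrite lerXn2r ?nnegrE// !mulr_ge0 ?twoside_ge0// ltW.
exists A0, (fun q i => ss q * A0 q i), rr; split.
- move=> [k c]; rewrite /rr/=; case: ifP => // _.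
  by rewrite sqrtr_gt0; have [] := HR k (ltn_ord k).
- move=> i i' hi hi'.
  transitivity (V * n%:R `^ (- p0) / 2 * (pw p0 i + pw p0 i' - pw p0 (distn i i'))).
    by ring.
  rewrite (@cov_wave p0 n i i' (fun q => al q.1 ^+ 2))//.
  + by apply: eq_bigr => q _; rewrite /A0; ring.
  + by rewrite gt_eqF//; lra.
  + by move=> k c; rewrite /= al2.
- move=> i i' hi hi'.
  transitivity (V * N `^ D * n%:R `^ (- p1) / 2 * (pw p1 i + pw p1 i' - pw p1 (distn i i'))).
    by ring.
  rewrite (@cov_wave p1 n i i' (fun q => R2 q.1 * al q.1 ^+ 2))//.
  + apply: eq_bigr => -[k c] _; rewrite /A0 /rr /ss /=.
    by case: ifP => _; rewrite -{1}(sR k (ltn_ord k)); ring.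
  + by rewrite gt_eqF.
  + move=> k c /=; rewrite al2// /R2.
    have [s0 _ _] := HR k (ltn_ord k).
    have -> : n%:R `^ (- p1) = n%:R `^ (- p0) * n%:R `^ (- D).
      by rewrite -powR_addr//; congr powR; rewrite /D; ring.
    rewrite powRM ?invr_ge0 ?(ltW N0)// -powR_inv1// -powRrM mulN1r.
    by rewrite -/(S1 k); field; rewrite !gt_eqF.
- apply: (@le_trans _ _ (Ca * D ^+ 2 * N)); last first.
    have : 0 <= Cb * D ^+ 2 * N.
      by apply: mulr_ge0 (ltW N0); apply: mulr_ge0; [exact: ltW|exact: sqr_ge0].
    by rewrite (mulrDl Ca) (mulrDl (Ca * _)) => ?; rewrite lerDl.
  rewrite sum_pair_bool.
  pose g (j : nat) : R := if j%:R <= N then (j%:R / N) `^ (- (2 * b)) else 0.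
  have g0 j : 0 <= g j by rewrite /g; case: ifP => // _; exact: powR_ge0.
  apply: (@le_trans _ _ (\sum_(k < 2 * n) 8 * (C3 ^+ 2 * D ^+ 2) * g (kap n k))).
    apply: ler_sum => k _; rewrite /rr /g /=; rewrite -/(low k); case: ifPn => lk.
      have dk := dev k (ltn_ord k).
      have yk1 : y k <= 1 by rewrite /y ler_pdivrMr// mul1r.
      have T := twoside_le_small hp0 hb (y0 k) yk1.
      have T2 : twoside b (y k) ^+ 2 <= 4 * y k `^ (- (2 * b)).
        have -> : 4 * y k `^ (- (2 * b)) = (2 * y k `^ (- b)) ^+ 2.
          rewrite exprMn -(@powR_mulrn _ (y k `^ _)) ?powR_ge0// -powRrM.
          by congr (_ * _ `^ _); ring.
        by rewrite lerXn2r ?nnegrE ?twoside_ge0// mulr_ge0 ?powR_ge0.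
      have CD : 0 <= C3 ^+ 2 * D ^+ 2 by rewrite mulr_ge0 ?sqr_ge0.
      have := ler_wpM2l CD T2; rewrite -/(y k); lra.
    by rewrite subrr expr0n addr0 mulr0.
  rewrite -mulr_sumr.
  have CD : 0 <= 8 * (C3 ^+ 2 * D ^+ 2).
    by apply: mulr_ge0 => //; apply: mulr_ge0; exact: sqr_ge0.
  apply: le_trans (ler_wpM2l CD (sum_kap n0 g0)) _.
  have := @sum_low R (2 * b) N n.+1 (ltac:(apply/andP; split; lra)) N1.
  rewrite big_mkcond/= -/g => gs.
  have -> : Ca * D ^+ 2 * N = 8 * (C3 ^+ 2 * D ^+ 2) * (3 * (N / (1 - 2 * b))).
    by rewrite /Ca; ring.
  by rewrite ler_wpM2l// ler_wpM2l.
- apply: (@le_trans _ _ (Cb * D ^+ 2 * N)); last first.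
    have : 0 <= Ca * D ^+ 2 * N.
      by apply: mulr_ge0 (ltW N0); apply: mulr_ge0; [exact: ltW|exact: sqr_ge0].
    by rewrite (mulrDl Ca) (mulrDl (Ca * _)) => ?; rewrite lerDr.
  rewrite sum_pair_bool.
  pose h (j : nat) : R := if N < j%:R then (j%:R / N) `^ (- be) else 0.
  have h0 j : 0 <= h j by rewrite /h; case: ifP => // _; exact: powR_ge0.
  apply: (@le_trans _ _ (\sum_(k < 2 * n) 8 * (V * C2 * C3 ^+ 2 * D ^+ 2) * h (kap n k))).
    apply: ler_sum => k _; rewrite /ss /h /= ltNge -/(low k); case: ifPn => lk /=.
      by rewrite mulr0 -big_split/= big1// => i _; rewrite !mul1r !subrr expr0n addr0.
    have kn := ltn_ord k; have dk := dev k kn.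
    have [s0 s1 _] := HS n k p1 n3 kn hp1 D1; rewrite -/(S0 k) in s0 s1.
    set u := wavelength R n k in s1.
    have u0 : 0 < u by rewrite divr_gt0 ?kap_gt0.
    have yk1 : 1 <= y k by rewrite /y ler_pdivlMr// mul1r ltW// ltNge.
    have T := twoside_le_large hp0 hb yk1.
    have T2 : twoside b (y k) ^+ 2 <= 4 * y k `^ (2 * b).
      have -> : 4 * y k `^ (2 * b) = (2 * y k `^ b) ^+ 2.
        rewrite exprMn -(@powR_mulrn _ (y k `^ _)) ?powR_ge0// -powRrM.
        by congr (_ * _ `^ _); ring.
      by rewrite lerXn2r ?nnegrE ?twoside_ge0// mulr_ge0 ?powR_ge0.
    have -> : \sum_(i < n.+1) (A0 (k, true) i - Num.sqrt (R2 k) * A0 (k, true) i) ^+ 2 +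
       \sum_(i < n.+1) (A0 (k, false) i - Num.sqrt (R2 k) * A0 (k, false) i) ^+ 2 =
       (1 - Num.sqrt (R2 k)) ^+ 2 * (al k ^+ 2 * \sum_(i < n.+1) fejer (freq R n k) i).
      rewrite -big_split/= !mulr_sumr; apply: eq_bigr => i _.
      by rewrite /A0 /wave /fejer /=; ring.
    have F : \sum_(i < n.+1) fejer (freq R n k) i <= 8 * n%:R * u ^+ 2.
      apply: (@le_trans _ _ (\sum_(i < n.+1) 4 * u ^+ 2)).
        by apply: ler_sum => i _; apply: fejer_le_wavelength => //; rewrite -ltnS.
      rewrite sumr_const card_ord -[leLHS]mulr_natl.
      have : n.+1%:R <= 2 * n%:R :> R by rewrite -[n.+1%:R]natr1; lra.
      have := sqr_ge0 u; nra.
    have F0 : 0 <= \sum_(i < n.+1) fejer (freq R n k) i.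
      by apply: sumr_ge0 => i _; exact: fejer_ge0.
    have al2k : al k ^+ 2 <= V * n%:R `^ (- p0) * (C2 * u `^ (p0 - 1)) / (4 * n%:R).
      rewrite al2// ler_wpM2r ?invr_ge0 ?mulr_ge0//.
      by rewrite ler_wpM2l ?mulr_ge0 ?powR_ge0 ?(ltW V0).
    have CD : 0 <= C3 ^+ 2 * D ^+ 2 by rewrite mulr_ge0 ?sqr_ge0.
    apply: (@le_trans _ _ (C3 ^+ 2 * D ^+ 2 * (4 * y k `^ (2 * b)) *
       (V * n%:R `^ (- p0) * (C2 * u `^ (p0 - 1)) / (4 * n%:R) * (8 * n%:R * u ^+ 2)))).
      apply: ler_pM.
      - exact: sqr_ge0.
      - by apply: mulr_ge0 => //; exact: sqr_ge0.
      - by apply: le_trans dk _; rewrite ler_wpM2l.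
      - by apply: ler_pM => //; exact: sqr_ge0.
    (* As N^(p0 + 1) = n, the energy of the signal over the whole grid at frequency kap is of order
       (N / kap)^(p0 + 1), hence of order 1 at N. This is what singles out N. *)
    have E1 : n%:R `^ (- p0) * (u `^ (p0 - 1) * u ^+ 2) = y k `^ (- (p0 + 1)).
      rewrite -powR_mulrn ?(ltW u0)// -powR_addr// (_ : p0 - 1 + 2 = p0 + 1); last by ring.
      have -> : u = n%:R * (kap n k)%:R `^ (-1) by rewrite powR_inv1 ?ltW ?kap_gt0.
      rewrite powRM ?powR_ge0// -powRrM mulrA -powR_addr//.
      rewrite (_ : - p0 + (p0 + 1) = 1) ?powRr1//; last by ring.
      rewrite -Nn /y powRM ?invr_ge0 ?(ltW N0) ?(ltW (kap_gt0 _ _ _))//.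
      rewrite -(@powR_inv1 _ N) ?(ltW N0)// -powRrM mulrC.
      by congr (_ `^ _ * _ `^ _); ring.
    have E2 : y k `^ (- be) = y k `^ (2 * b) * y k `^ (- (p0 + 1)).
      by rewrite -powR_addr//; congr powR; rewrite /be; ring.
    rewrite -/(y k) E2 -E1 le_eqVlt; apply/orP; left; apply/eqP.
    by field; rewrite gt_eqF.
  rewrite -mulr_sumr.
  have CD : 0 <= 8 * (V * C2 * C3 ^+ 2 * D ^+ 2).
    apply: mulr_ge0 => //; apply: mulr_ge0; last exact: sqr_ge0.
    by apply: mulr_ge0; [exact/ltW/mulr_gt0|exact: sqr_ge0].
  apply: le_trans (ler_wpM2l CD (sum_kap n0 h0)) _.
  have := @sum_high R be N n.+1 be1 N1.
  rewrite big_mkcond/= -/h => hs.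
  have -> : Cb * D ^+ 2 * N =
    8 * (V * C2 * C3 ^+ 2 * D ^+ 2) * (3 * (2 `^ (be - 1) / (be - 1) * N)).
    by rewrite /Cb; ring.
  by rewrite ler_wpM2l// ler_wpM2l.
Qed.

End PairConstruction.

(** * Integration against a density, and integrals of derivatives *)

Section Density.
Context d (T : measurableType d) (R : realType).
Variables (mu : {sigma_finite_measure set T -> \bar R}) (nu : probability T R).
Variable p : T -> R.
Hypotheses (mp : measurable_fun setT p) (p0 : forall x, 0 <= p x).
Hypothesis nup : forall A, measurable A -> nu A = (\int[mu]_(x in A) (p x)%:E)%E.

Lemma density_dominates : nu `<< mu.
Proof.
apply/null_content_dominatesP => A mA muA; rewrite nup//.
by apply: null_set_integral => //; apply/measurable_EFinP/measurable_funTS.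
Qed.

(** Both functions have the same integral over every measurable set; this opens the change of
    variables formula for Radon-Nikodym derivatives to the explicit p. *)
Lemma density_ae : ae_eq mu setT (Radon_Nikodym_SigmaFinite.f nu mu) (EFin \o p).
Proof.
have dom := density_dominates.
apply: integral_ae_eq => //.
- exact: Radon_Nikodym_SigmaFinite.f_integrable.
- exact/measurable_EFinP.
- by move=> E _ mE; rewrite -Radon_Nikodym_SigmaFinite.f_integral//; exact: nup.
Qed.

Lemma ge0_integral_density (g : T -> \bar R) : measurable_fun setT g ->
  (forall x, 0 <= g x)%E ->
  (\int[nu]_x g x = \int[mu]_x (g x * (p x)%:E))%E.
Proof.
move=> mg g0; have dom := density_dominates.
rewrite -(Radon_Nikodym_SigmaFinite.change_of_variables dom)//.
apply: ae_eq_integral => //.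
- apply: emeasurable_funM => //.
  exact: measurable_int (Radon_Nikodym_SigmaFinite.f_integrable dom).
- by apply: emeasurable_funM => //; exact/measurable_EFinP.
- by apply: ae_eqe_mul2l; exact: density_ae.
Qed.

Lemma integrable_density (g : T -> R) : measurable_fun setT g ->
  mu.-integrable setT (fun x => (g x * p x)%:E) ->
  nu.-integrable setT (EFin \o g).
Proof.
move=> mg /integrableP[_ h]; apply/integrableP; split; first exact/measurable_EFinP.
rewrite ge0_integral_density//=; last first.
  by apply/measurable_EFinP; exact: measurableT_comp.
apply: le_lt_trans h; rewrite le_eqVlt; apply/orP; left; apply/eqP.
by apply: eq_integral => x _; rewrite -EFinM /= normrM (ger0_norm (p0 x)).
Qed.

Lemma Rintegral_density (g : T -> R) : measurable_fun setT g ->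
  mu.-integrable setT (fun x => (g x * p x)%:E) ->
  \int[nu]_x g x = \int[mu]_x (g x * p x).
Proof.
move=> mg ig; have dom := density_dominates.
have ing := integrable_density mg ig.
rewrite /Rintegral -(Radon_Nikodym_change_of_variables dom)//.
congr fine; apply: ae_eq_integral => //.
- apply: emeasurable_funM; first exact/measurable_EFinP.
  apply: (measurable_int mu); exact: Radon_Nikodym_integrable.
- exact: (measurable_int mu ig).
- rewrite (_ : (fun x => (g x * p x)%:E) = (fun x => (g x)%:E * (EFin \o p) x)%E); last first.
    by apply/funext => x; rewrite EFinM.
  apply: ae_eqe_mul2l; apply: ae_eq_trans density_ae.
  exact/ae_eq_sym/ae_eq_Radon_Nikodym_SigmaFinite.
Qed.

End Density.

Section IntegralOfDerivative.
Variable R : realType.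
Notation mu := (@lebesgue_measure R).

(** The fundamental theorem on [m - n - 1, m + n + 1] and dominated convergence; the bound on F
    makes the boundary terms O(1 / n). *)
Lemma Rintegral_derivative0 (F f : R -> R) (m C : R) :
  (forall x : R, is_derive x 1 F (f x)) -> continuous f ->
  mu.-integrable setT (EFin \o f) ->
  (forall x, `|F x| * `|x - m| <= C) -> \int[mu]_x f x = 0.
Proof.
move=> dF cf intf FC.
have mf : measurable_fun setT f by exact: continuous_measurable_fun.
pose I (n : nat) : set R := `[m - n.+1%:R, m + n.+1%:R]%classic.
have E n : (\int[mu]_(x in I n) (f x)%:E = (F (m + n.+1%:R) - F (m - n.+1%:R))%:E)%E.
  rewrite (@continuous_FTC2 _ _ F)//.
  - by rewrite ltrBlDr -addrA ltrDl -natrD ltr0n.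
  - exact: continuous_subspaceT.
  - have dd x : derivable F x 1 by have [] := dF x.
    have cF x : F @ x --> F x.
      exact: (differentiable_continuous (proj1 (derivable1_diffP _ _) (dd x))).
    split=> // ; first by apply: cvg_at_right_filter; exact: cF.
    by apply: cvg_at_left_filter; exact: cF.
  - by move=> x _; rewrite derive1E; have [_ ->] := dF x.
have L1 : (fun n => \int[mu]_(x in I n) (f x)%:E)%E @ \oo --> (\int[mu]_x (f x)%:E)%E.
  under eq_fun do rewrite integral_mkcond.
  have [] := @dominated_convergence _ _ _ mu setT measurableT
     (fun n => (EFin \o f) \_ (I n)) (EFin \o f) (abse \o (EFin \o f)).
  - move=> n; apply/(measurable_restrictT _ _).1; first exact: measurable_itv.
    by apply/measurable_funTS/measurable_EFinP.
  - exact/measurable_EFinP.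
  - apply: aeW => x _; apply: cvg_near_cst.
    near=> n; rewrite /restrict /I mem_set//=.
    rewrite in_itv/= -ler_distlC.
    near: n; exists (Num.truncn `|m - x|) => // n /= hn.
    rewrite (le_trans (ltW (truncnS_gt _)))// ler_nat ltnS//.
  - exact: integrable_abse.
  - apply: aeW => x n _; rewrite /restrict; case: ifPn => //= _.
    by rewrite lee_fin normr0 normr_ge0.
  - by move=> _ _; apply.
have L2 : (fun n => \int[mu]_(x in I n) (f x)%:E)%E @ \oo --> 0%E.
  under eq_fun do rewrite E.
  apply: cvg_EFin; first by apply: nearW.
  apply/cvgrPdist_le => /= e e0.
  have C0 : 0 <= C by apply: le_trans (FC 0); rewrite mulr_ge0.
  near=> n; rewrite sub0r normrN.
  have b (s : R) : `|s| = n.+1%:R -> `|F (m + s)| <= C / n.+1%:R.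
    move=> hs; rewrite ler_pdivlMr//; have := FC (m + s).
    by rewrite addrAC subrr add0r hs.
  apply: le_trans (ler_normB _ _) _.
  have b1 := b n.+1%:R (ger0_norm (ler0n _ _)).
  have b2 := b (- n.+1%:R) (ltac:(by rewrite normrN ger0_norm)).
  apply: le_trans (lerD b1 b2) _.
  rewrite -mulrDl ler_pdivrMr// mulrC -ler_pdivrMr//.
  near: n; exists (Num.truncn ((C + C) / e)) => // n /= hn.
  by rewrite (le_trans (ltW (truncnS_gt _)))// ler_nat ltnS.
by rewrite /Rintegral (cvg_unique _ L1 L2).
Unshelve. all: by end_near. Qed.

End IntegralOfDerivative.

Lemma normal_pdf_expR (R : realType) (m s x : R) : s != 0 ->
  normal_pdf m s x = normal_peak s * expR (- (x - m) ^+ 2 / (s ^+ 2 *+ 2)).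
Proof. by move=> s0; rewrite /normal_pdf (negPf s0). Qed.

(** * Normal laws: moments and characteristic functions *)

Section NormalFacts.
Variable R : realType.
Notation mu := (@lebesgue_measure R).
Variables (m s : R).
Hypothesis s0 : s != 0.

Notation pdf := (normal_pdf m s).

Let ss0 : 0 < s ^+ 2. Proof. by rewrite exprn_even_gt0. Qed.

Lemma peak_const_ge0 : 0 <= 4 * s ^+ 2 * normal_peak s.
Proof.
by apply: mulr_ge0; [apply: mulr_ge0 => //; exact: sqr_ge0|exact: normal_peak_ge0].
Qed.

Lemma is_derive_pdf (x : R) : is_derive x 1 pdf (- ((x - m) / s ^+ 2 * pdf x)).
Proof.
have -> : pdf = (fun y => normal_peak s * expR (- (y - m) ^+ 2 / (s ^+ 2 *+ 2))).
  by apply/funext => y; exact: normal_pdf_expR.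
have H1 : is_derive x 1 (fun y : R => - (y - m) ^+ 2 / (s ^+ 2 *+ 2)) (- ((x - m) / s ^+ 2)).
  apply: is_derive_eq.
  rewrite /GRing.scale /= -mulr_natr; field.
  by rewrite s0.
have H2 := @is_derive1_comp _ (@expR R) _ x _ _ (is_derive_expR _) H1.
have H3 := @is_deriveZ _ _ _ _ (normal_peak s) _ _ _ H2.
apply: is_derive_eq.
by rewrite /GRing.scale /=; ring.
Qed.

Lemma expR_mul_le1 (t : R) : t * expR (- t) <= 1.
Proof.
rewrite -(ler_pM2r (expR_gt0 t)) -mulrA -expRD addNr expR0 mulr1 mul1r.
by have := expR_ge1Dx t; lra.
Qed.

(** Half of the exponent absorbs the square, by t exp(-t) <= 1; what is left is a Gaussian profile
    of standard deviation sqrt 2 * s, hence integrable. *)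
Lemma pdf_sqr_le x : (x - m) ^+ 2 * pdf x <= 4 * s ^+ 2 * normal_peak s *
  expR (- (x - m) ^+ 2 / ((Num.sqrt 2 * s) ^+ 2 *+ 2)).
Proof.
rewrite normal_pdf_expR// exprMn sqr_sqrtr//.
pose t := (x - m) ^+ 2 / (4 * s ^+ 2).
have -> : - (x - m) ^+ 2 / (s ^+ 2 *+ 2) = - t + - t.
  by rewrite /t -mulr_natr; field; rewrite s0.
have -> : - (x - m) ^+ 2 / (2 * s ^+ 2 *+ 2) = - t.
  by rewrite /t -mulr_natr; field; rewrite s0.
have -> : (x - m) ^+ 2 = 4 * s ^+ 2 * t by rewrite /t; field; rewrite s0.
rewrite expRD.
have -> : 4 * s ^+ 2 * t * (normal_peak s * (expR (- t) * expR (- t))) =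
   4 * s ^+ 2 * normal_peak s * (t * expR (- t) * expR (- t)) by ring.
rewrite ler_wpM2l ?peak_const_ge0//.
by rewrite ler_piMl ?expR_ge0// expR_mul_le1.
Qed.

Lemma pdf_sqr_bound x : (x - m) ^+ 2 * pdf x <= 4 * s ^+ 2 * normal_peak s.
Proof.
apply: le_trans (pdf_sqr_le x) _.
rewrite ler_piMr ?peak_const_ge0//.
by rewrite -expR0 ler_expR mulNr oppr_le0 divr_ge0 ?sqr_ge0 ?mulrn_wge0 ?sqr_ge0.
Qed.

Definition pdf_const : R := 4 * s ^+ 2 * normal_peak s + normal_peak s.

Lemma pdf_le_const x : (1 + (x - m) ^+ 2) * pdf x <= pdf_const.
Proof.
rewrite mulrDl mul1r addrC lerD ?pdf_sqr_bound//.
exact: normal_pdf_ub.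
Qed.

Lemma measurable_center_pow k : measurable_fun setT (fun x : R => (x - m) ^+ k * pdf x).
Proof.
apply: measurable_funM; last exact: measurable_normal_pdf.
by apply: measurable_funX; apply: measurable_funB.
Qed.

Lemma integrable_center2 : mu.-integrable setT (fun x => ((x - m) ^+ 2 * pdf x)%:E).
Proof.
have c0 : Num.sqrt 2 * s != 0 by rewrite mulf_neq0// sqrtr_eq0 -ltNge.
pose C := 4 * s ^+ 2 * normal_peak s / normal_peak (Num.sqrt 2 * s).
have I := integrableZl measurableT C (integrable_normal_pdf m (Num.sqrt 2 * s)).
apply: le_integrable I => //; first by apply/measurable_EFinP; exact: measurable_center_pow.
move=> x _; rewrite -EFinM !abse_EFin lee_fin.
rewrite ger0_norm; last by rewrite mulr_ge0 ?sqr_ge0 ?normal_pdf_ge0.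
apply: le_trans (ler_norm _); apply: le_trans (pdf_sqr_le x) _.
rewrite normal_pdf_expR// [leRHS]mulrA /C divfK//.
by rewrite gt_eqF// normal_peak_gt0.
Qed.

Lemma integrable_center1 (g : R -> R) : measurable_fun setT g ->
  (forall x, `|g x| <= 1 + (x - m) ^+ 2) ->
  mu.-integrable setT (fun x => (g x * pdf x)%:E).
Proof.
move=> mg hg.
have I := integrableD measurableT (integrable_normal_pdf m s) integrable_center2.
apply: le_integrable I => //.
  by apply/measurable_EFinP; apply: measurable_funM => //; exact: measurable_normal_pdf.
move=> x _; rewrite /= lee_fin.
rewrite normrM (ger0_norm (normal_pdf_ge0 _ _ _)).
apply: le_trans (ler_norm _).
by rewrite -[X in X + _]mul1r -mulrDl ler_wpM2r ?normal_pdf_ge0.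
Qed.

Lemma pdf_mean0 : \int[mu]_x ((x - m) * pdf x) = 0.
Proof.
have H := @Rintegral_derivative0 _ pdf (fun x => - ((x - m) / s ^+ 2 * pdf x)) m pdf_const.
have mc : measurable_fun setT (fun x : R => x - m) by apply: measurable_funB.
have I1 : mu.-integrable setT (fun x => ((x - m) * pdf x)%:E).
  apply: integrable_center1 => // x.
  have := sqr_ge0 (`|x - m| - 1); rewrite sqrrB -[X in _ -> _ <= _ + X]real_normK ?num_real// => h.
  have := normr_ge0 (x - m); move: h; rewrite expr1n mulr1 -mulr_natr.
  nra.
have E : \int[mu]_x (- ((x - m) / s ^+ 2 * pdf x)) = - (s ^+ 2)^-1 * \int[mu]_x ((x - m) * pdf x).
  rewrite -RintegralZl//; apply: eq_Rintegral => x _; ring.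
have : - (s ^+ 2)^-1 * \int[mu]_x ((x - m) * pdf x) = 0.
  rewrite -E; apply: H.
  - exact: is_derive_pdf.
  - move=> x; apply: cvgN; apply: cvgM; last exact: continuous_normal_pdf.
    by apply: cvgM; [apply: cvgB; [exact: cvg_id|exact: cvg_cst]|exact: cvg_cst].
  - rewrite (_ : EFin \o _ = (fun x => ((- (s ^+ 2)^-1)%:E * ((x - m) * pdf x)%:E)%E)).
      exact: integrableZl.
    by apply/funext => x /=; rewrite -EFinM; congr EFin; ring.
  - move=> x; apply: le_trans (pdf_le_const x).
    rewrite (ger0_norm (normal_pdf_ge0 _ _ _)) mulrC ler_wpM2r ?normal_pdf_ge0//.
    by rewrite -[(x - m) ^+ 2]real_normK ?num_real//; have := sqr_ge0 (`|x - m| - 1); nra.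
move/eqP; rewrite mulf_eq0 oppr_eq0 invr_eq0 (gt_eqF ss0)/= => /eqP //.
Qed.

(** The derivative of (x - m) pdf(x) is pdf(x) - (x - m)^2 pdf(x) / s^2, and its integral
    vanishes. *)
Lemma pdf_var : \int[mu]_x ((x - m) ^+ 2 * pdf x) = s ^+ 2.
Proof.
have H := @Rintegral_derivative0 _ (fun x => (x - m) * pdf x)
  (fun x => pdf x - (s ^+ 2)^-1 * ((x - m) ^+ 2 * pdf x)) m pdf_const.
have I2 := integrableZl measurableT (s ^+ 2)^-1 integrable_center2.
have E : \int[mu]_x (pdf x - (s ^+ 2)^-1 * ((x - m) ^+ 2 * pdf x)) =
   1 - (s ^+ 2)^-1 * \int[mu]_x ((x - m) ^+ 2 * pdf x).
  rewrite RintegralB//; first last.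
  - exact: integrable_normal_pdf.
  rewrite RintegralZl//; last exact: integrable_center2.
  by rewrite {1}/Rintegral integral_normal_pdf.
have : 1 - (s ^+ 2)^-1 * \int[mu]_x ((x - m) ^+ 2 * pdf x) = 0.
  rewrite -E; apply: H.
  - move=> x.
    have h1 : is_derive x 1 (fun x : R => x - m) (1 : R).
      by apply: is_derive_eq; rewrite subr0.
    have := is_deriveM h1 (is_derive_pdf x).
    move/is_derive_eq; apply; rewrite /GRing.scale /=; ring.
  - move=> x; apply: cvgB; first exact: continuous_normal_pdf.
    apply: cvgM; first exact: cvg_cst.
    apply: cvgM; last exact: continuous_normal_pdf.
    apply: (continuous_comp (f := fun x : R => x - m) (g := fun y : R => y ^+ 2)); last exact: exprn_continuous.
    by apply: cvgB; [exact: cvg_id|exact: cvg_cst].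
  - rewrite (_ : EFin \o _ = (fun x => (pdf x)%:E - ((s ^+ 2)^-1)%:E * ((x - m) ^+ 2 * pdf x)%:E)%E).
      by apply: integrableB => //; exact: integrable_normal_pdf.
    by apply/funext => x.
  - move=> x; apply: le_trans (pdf_le_const x).
    rewrite normrM (ger0_norm (normal_pdf_ge0 _ _ _)) mulrAC -expr2 real_normK ?num_real//.
    by rewrite ler_wpM2r ?normal_pdf_ge0// lerDr.
by move/eqP; rewrite subr_eq0 => /eqP h; rewrite -[RHS]mulr1 h mulVKf ?gt_eqF.
Qed.

End NormalFacts.

Section NormalTransform.
Variable R : realType.
Notation mu := (@lebesgue_measure R).
Variables (m s : R).

Lemma normal_probE (A : set R) : normal_prob m s A = (\int[mu]_(x in A) (normal_pdf m s x)%:E)%E.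
Proof. by []. Qed.

Hypothesis s0 : s != 0.

Let mpdf := @measurable_normal_pdf R m s.
Let pdf0 := @normal_pdf_ge0 R m s.

Lemma normal_integrable (g : R -> R) : measurable_fun setT g ->
  (forall x, `|g x| <= 1 + (x - m) ^+ 2) ->
  (normal_prob m s).-integrable setT (EFin \o g).
Proof.
move=> mg hg; apply: (@integrable_density _ _ _ mu _ _ mpdf pdf0) => //.
exact: integrable_center1.
Qed.

Lemma normal_Rintegral (g : R -> R) : measurable_fun setT g ->
  (forall x, `|g x| <= 1 + (x - m) ^+ 2) ->
  \int[normal_prob m s]_x g x = \int[mu]_x (g x * normal_pdf m s x).
Proof.
move=> mg hg; apply: (@Rintegral_density _ _ _ mu _ _ mpdf pdf0) => //.
exact: integrable_center1.
Qed.

Let mc : measurable_fun setT (fun x : R => x - m). Proof. by apply: measurable_funB. Qed.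

Lemma norm_le_1sqr (t : R) : `|t| <= 1 + t ^+ 2.
Proof.
rewrite -[t ^+ 2]real_normK ?num_real//; have := sqr_ge0 (`|t| - 1).
by have := normr_ge0 t; nra.
Qed.

Lemma normal_mean0 : \int[normal_prob m s]_x (x - m) = 0.
Proof.
rewrite normal_Rintegral//; first exact: pdf_mean0.
by move=> x; exact: norm_le_1sqr.
Qed.

Lemma normal_var : \int[normal_prob m s]_x ((x - m) ^+ 2) = s ^+ 2.
Proof.
rewrite normal_Rintegral//; first exact: pdf_var.
  exact: measurable_funX.
by move=> x; rewrite ger0_norm ?sqr_ge0// lerDr.
Qed.

End NormalTransform.

Section NormalFourier.
Variable R : realType.
Notation mu := (@lebesgue_measure R).
Variables (s b : R).
Hypothesis s0 : s != 0.
Notation pdf := (normal_pdf 0 s).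

Let F (c : R) := \int[mu]_x (cos (c * x + b) * pdf x).

Let mcs (c : R) : measurable_fun setT (fun x : R => cos (c * x + b)).
Proof.
apply: (measurableT_comp (continuous_measurable_fun (@continuous_cos R))).
by apply: measurable_funD => //; exact: measurable_funM.
Qed.

Let msn (c : R) : measurable_fun setT (fun x : R => sin (c * x + b)).
Proof.
apply: (measurableT_comp (continuous_measurable_fun (@continuous_sin R))).
by apply: measurable_funD => //; exact: measurable_funM.
Qed.

Let b01 (x t : R) : `|t| <= 1 -> `|t| <= 1 + (x - 0) ^+ 2.
Proof. by move=> h; apply: le_trans h _; rewrite lerDl sqr_ge0. Qed.

Let icos (c : R) : mu.-integrable setT (fun x => (cos (c * x + b) * pdf x)%:E).
Proof. by apply: integrable_center1 => // x; apply: b01; exact: cos_max. Qed.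

Let xsin (c x : R) : `|x * sin (c * x + b)| <= 1 + (x - 0) ^+ 2.
Proof.
rewrite normrM subr0; apply: le_trans (norm_le_1sqr x).
by rewrite ler_piMr// sin_max.
Qed.

Let ixsin (c : R) : mu.-integrable setT (fun x => (x * sin (c * x + b) * pdf x)%:E).
Proof. by apply: integrable_center1 => //; apply: measurable_funM => //. Qed.

Lemma is_derive_lin (c x : R) : is_derive c 1 (fun c : R => c * x + b) x.
Proof. by apply: is_derive_eq; rewrite /GRing.scale /= mulr1 mulr0 addr0 add0r. Qed.

Let dcos (c x : R) : is_derive c 1 (fun c => cos (c * x + b) * pdf x)
  (- (x * sin (c * x + b) * pdf x)).
Proof.
have H := @is_derive1_comp _ (@cos R) (fun c => c * x + b) c _ _ (is_derive_cos _) (is_derive_lin c x).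
apply: is_derive_eq; rewrite /GRing.scale /=; ring.
Qed.

(* Gaussian integration by parts: the integral of (sin(cx + b) pdf(x))' vanishes. *)
Let stein (c : R) : \int[mu]_x (x * sin (c * x + b) * pdf x) = s ^+ 2 * c * F c.
Proof.
have ss0 : 0 < s ^+ 2 by rewrite exprn_even_gt0.
pose f x := c * (cos (c * x + b) * pdf x) - (s ^+ 2)^-1 * (x * sin (c * x + b) * pdf x).
have H := @Rintegral_derivative0 _ (fun x => sin (c * x + b) * pdf x) f 0 (pdf_const s).
have E : \int[mu]_x f x = c * F c - (s ^+ 2)^-1 * \int[mu]_x (x * sin (c * x + b) * pdf x).
  rewrite /f RintegralB//.
  - by rewrite (RintegralZl c measurableT (icos c)) (RintegralZl _ measurableT (ixsin c)).
  - exact: (integrableZl measurableT c (icos c)).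
  - exact: (integrableZl measurableT (s ^+ 2)^-1 (ixsin c)).
have : \int[mu]_x f x = 0.
  apply: H.
  - move=> x.
    have h1 : is_derive x 1 (fun x : R => c * x + b) c.
      by apply: is_derive_eq; rewrite /GRing.scale /= mulr1 addr0.
    have h2 := @is_derive1_comp _ (@sin R) (fun x => c * x + b) x _ _ (is_derive_sin _) h1.
    have := is_deriveM h2 (is_derive_pdf 0 s0 x).
    move/is_derive_eq; apply; rewrite /f /GRing.scale /= subr0; ring.
  - have cl (x : R) : {for x, continuous (fun x => c * x + b)}.
      apply: cvgD; last exact: cvg_cst.
      by apply: cvgM; [exact: cvg_cst|exact: cvg_id].
    move=> x; apply: cvgB; apply: cvgM; do ?exact: cvg_cst.
      apply: cvgM; last exact: continuous_normal_pdf.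
      by apply: (continuous_comp (cl x)); exact: continuous_cos.
    apply: cvgM; last exact: continuous_normal_pdf.
    apply: cvgM; first exact: cvg_id.
    by apply: (continuous_comp (cl x)); exact: continuous_sin.
  - rewrite (_ : EFin \o f = (fun x => c%:E * (cos (c * x + b) * pdf x)%:E - ((s ^+ 2)^-1)%:E * (x * sin (c * x + b) * pdf x)%:E)%E).
      by apply: integrableB => //; exact: integrableZl.
    by apply/funext => x.
  - move=> x; apply: le_trans (pdf_le_const 0 s0 x).
    rewrite normrM (ger0_norm (normal_pdf_ge0 _ _ _)) mulrAC ler_wpM2r ?normal_pdf_ge0//.
    apply: le_trans (norm_le_1sqr _); rewrite subr0.
    by rewrite ler_piMl// sin_max.
rewrite E => /eqP; rewrite subr_eq0 => /eqP h.
by rewrite -mulrA h mulVKf ?gt_eqF.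
Qed.

Let is_derive_F (c : R) : is_derive c 1 F (- (s ^+ 2 * c * F c)).
Proof.
pose f (c x : R) := cos (c * x + b) * pdf x.
have Ic : `]c - 1, c + 1[%classic c by rewrite /= in_itv/=; apply/andP; split; lra.
have d1 (c' x : R) : partial1of2 f c' x = - (x * sin (c' * x + b) * pdf x).
  by rewrite partial1of2E; have [_ ->] := dcos c' x.
have A1 (x : R) : `]c - 1, c + 1[%classic x -> mu.-integrable setT (EFin \o f x).
  by move=> _; exact: icos.
have A2 (x y : R) : `]c - 1, c + 1[%classic x -> setT y -> derivable (f ^~ y) x 1.
  by move=> _ _; have [] := dcos x y.
pose G (y : R) : R := (1 + (y - 0) ^+ 2) * pdf y.
have A3 y : 0 <= G y.
  by rewrite /G mulr_ge0 ?normal_pdf_ge0// addr_ge0 ?sqr_ge0.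
have A4 : mu.-integrable setT (EFin \o G).
  apply: integrable_center1 => //.
    by apply: measurable_funD => //; apply: measurable_funX; apply: measurable_funB.
  by move=> x; rewrite ger0_norm// addr_ge0 ?sqr_ge0.
have A5 (x y : R) : `]c - 1, c + 1[%classic x -> setT y -> `|partial1of2 f x y| <= G y.
  move=> _ _; rewrite d1 normrN normrM (ger0_norm (normal_pdf_ge0 _ _ _)).
  by rewrite /G ler_wpM2r ?normal_pdf_ge0.
apply: DeriveDef.
  exact: (derivable_under_integral measurableT Ic A1 A2 A3 A4 A5).
rewrite -derive1E (differentiation_under_integral measurableT Ic A1 A2 A3 A4 A5).
under eq_Rintegral do rewrite d1.
rewrite -stein (_ : (fun x => _) = (fun x => -1 * (x * sin (c * x + b) * pdf x))).
  by rewrite (RintegralZl (-1) measurableT (ixsin c)) mulN1r.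
by apply/funext => x; rewrite mulN1r.
Qed.

(** Differentiation under the integral and [stein] give F' = - s^2 c F, so F exp(c^2 s^2 / 2) is
    constant. The phase b keeps everything real: b = 0 and b = - pi / 2 give the two parts of the
    characteristic function. *)
Lemma normal_fourier (c : R) :
  \int[normal_prob 0 s]_x cos (c * x + b) = cos b * expR (- (c ^+ 2 * s ^+ 2 / 2)).
Proof.
rewrite normal_Rintegral//; last by move=> x; apply: b01; exact: cos_max.
rewrite -/(F c).
pose H c := F c * expR (c ^+ 2 * s ^+ 2 / 2).
have dH (c' : R) : is_derive c' 1 H 0.
  have h1 : is_derive c' 1 (fun c : R => c ^+ 2 * s ^+ 2 / 2) (c' * s ^+ 2).
    by apply: is_derive_eq; rewrite /GRing.scale /= !mulr0 !add0r !mulr1; field.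
  have h2 := @is_derive1_comp _ (@expR R) _ c' _ _ (is_derive_expR _) h1.
  have := is_deriveM (is_derive_F c') h2.
  move/is_derive_eq; apply; rewrite /GRing.scale /=; ring.
have : H c = H 0 by exact: is_derive_0_is_cst.
rewrite /H expr0n/= mul0r mul0r expR0 mulr1 => e.
have -> : F c = F 0 * expR (- (c ^+ 2 * s ^+ 2 / 2)).
  by rewrite -e -mulrA -expRD subrr expR0 mulr1.
congr (_ * _); rewrite /F.
under eq_Rintegral do rewrite mul0r add0r.
rewrite RintegralZl//; last exact: integrable_normal_pdf.
by rewrite /Rintegral integral_normal_pdf/= mulr1.
Qed.

End NormalFourier.

(** * Bounded functions, tests and iterated integrals *)

Section Bounded.
Context d (T : measurableType d) (R : realType).

Definition bmeas (h : T -> R) : Prop :=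
  measurable_fun setT h /\ exists C, forall x, `|h x| <= C.

(** Randomised tests instead of events: integrating out one variable of a test gives a test, so
    bounds pass through products and mixtures. *)
Definition test (h : T -> R) : Prop :=
  measurable_fun setT h /\ forall x, 0 <= h x <= 1.

Lemma test_bmeas h : test h -> bmeas h.
Proof.
move=> [mh h01]; split => //; exists 1 => x.
by have /andP[h0 h1] := h01 x; rewrite ger0_norm.
Qed.

Lemma bmeas_integrable (P : probability T R) h : bmeas h ->
  P.-integrable setT (EFin \o h).
Proof.
move=> [mh [C hC]]; apply: measurable_bounded_integrable => //.
  by rewrite [X in (X < _)%E]probability_setT ltry.
exists C; split => //; first exact: num_real.
by move=> x Cx t _; apply: le_trans (hC t) (ltW Cx).
Qed.

Lemma bmeasD h g : bmeas h -> bmeas g -> bmeas (fun x => h x + g x).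
Proof.
move=> [mh [C hC]] [mg [C' gC]]; split; first exact: measurable_funD.
by exists (C + C') => x; rewrite (le_trans (ler_normD _ _))// lerD.
Qed.

Lemma bmeasM h g : bmeas h -> bmeas g -> bmeas (fun x => h x * g x).
Proof.
move=> [mh [C hC]] [mg [C' gC]]; split; first exact: measurable_funM.
by exists (C * C') => x; rewrite normrM ler_pM.
Qed.

Lemma bmeas_cst c : bmeas (fun=> c).
Proof. by split => //; exists `|c|. Qed.

Lemma Rint_ge0 (P : probability T R) h : (forall x, 0 <= h x) -> 0 <= \int[P]_x h x.
Proof. by move=> h0; exact: Rintegral_ge0. Qed.

Lemma Rint_le (P : probability T R) h g : bmeas h -> bmeas g ->
  (forall x, h x <= g x) -> \int[P]_x h x <= \int[P]_x g x.
Proof.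
by move=> bh bg hg; apply: le_Rintegral => //; exact: bmeas_integrable.
Qed.

Lemma RintD (P : probability T R) h g : bmeas h -> bmeas g ->
  \int[P]_x (h x + g x) = \int[P]_x h x + \int[P]_x g x.
Proof. by move=> bh bg; rewrite RintegralD//; exact: bmeas_integrable. Qed.

Lemma RintZ (P : probability T R) c h : bmeas h ->
  \int[P]_x (c * h x) = c * \int[P]_x h x.
Proof. by move=> bh; rewrite RintegralZl//; exact: bmeas_integrable. Qed.

Lemma Rint_cst (P : probability T R) c : \int[P]_x (fun=> c) x = c.
Proof. by rewrite Rintegral_cst// [X in fine X]probability_setT mulr1. Qed.

Lemma RintEFin (P : probability T R) h : bmeas h ->
  (\int[P]_x (h x)%:E)%E = (\int[P]_x h x)%:E.
Proof.
by move=> bh; rewrite /Rintegral fineK//; apply: integrable_fin_num => //; exact: bmeas_integrable.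
Qed.

Lemma Rint_bound (P : probability T R) h C : bmeas h -> (forall x, `|h x| <= C) ->
  `|\int[P]_x h x| <= C.
Proof.
move=> bh hC; apply: le_trans (le_normr_Rintegral _ (bmeas_integrable P bh)) _ => //.
rewrite -[leRHS](Rint_cst P); apply: Rint_le => //; last exact: bmeas_cst.
by case: bh => mh _; split; [exact: measurableT_comp|exists C => x; rewrite normr_id].
Qed.

Lemma Rint_test (P : probability T R) h : test h -> 0 <= \int[P]_x h x <= 1.
Proof.
move=> th; have bh := test_bmeas th; have [_ h01] := th.
apply/andP; split; first by apply: Rint_ge0 => x; have /andP[] := h01 x.
rewrite -[leRHS](Rint_cst P); apply: Rint_le => //; first exact: bmeas_cst.
by move=> x; have /andP[] := h01 x.
Qed.

Lemma testC h : test h -> test (fun x => 1 - h x).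
Proof.
move=> [mh h01]; split; first exact: measurable_funB.
by move=> x; have := h01 x; lra.
Qed.

Lemma Rint_C (P : probability T R) h : test h -> \int[P]_x (1 - h x) = 1 - \int[P]_x h x.
Proof.
move=> th; rewrite RintegralB//; last exact/bmeas_integrable/test_bmeas.
  by rewrite (Rint_cst P).
exact: (bmeas_integrable P (bmeas_cst 1)).
Qed.

Lemma Rint_indic (P : probability T R) A : measurable A -> (P A = (\int[P]_x \1_A x)%:E)%E.
Proof.
move=> mA; rewrite -RintEFin ?integral_indic ?setIT//.
split; first exact: measurable_indic.
by exists 1 => x; rewrite indicE; case: (_ \in _); rewrite ?normr1 ?normr0.
Qed.

Lemma test_indic A : measurable A -> test (\1_A : T -> R).
Proof.
move=> mA; split; first exact: measurable_indic.
by move=> x; rewrite indicE; case: (_ \in _); rewrite /= lexx ?ler01.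
Qed.

End Bounded.

Section Fubini.
Context d1 d2 (T1 : measurableType d1) (T2 : measurableType d2) (R : realType).
Variables (P : probability T1 R) (Q : probability T2 R).

Lemma bmeas_comp (f : T1 -> T2) (h : T2 -> R) : measurable_fun setT f ->
  bmeas h -> bmeas (h \o f).
Proof.
by move=> mf [mh [C hC]]; split; [exact: measurableT_comp|exists C => x; exact: hC].
Qed.

Lemma test_comp (f : T1 -> T2) (h : T2 -> R) : measurable_fun setT f ->
  test h -> test (h \o f).
Proof.
by move=> mf [mh h01]; split; [exact: measurableT_comp|move=> x; exact: h01].
Qed.

Lemma bmeas_section (h : T1 * T2 -> R) x : bmeas h -> bmeas (fun y => h (x, y)).
Proof.
move=> [mh [C hC]]; split; last by exists C => y; exact: hC.
exact: measurableT_comp mh (measurable_pair1 x).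
Qed.

Lemma test_section (h : T1 * T2 -> R) x : test h -> test (fun y => h (x, y)).
Proof.
move=> [mh hC]; split; last by move=> y; exact: hC.
exact: measurableT_comp mh (measurable_pair1 x).
Qed.

Lemma bmeas_inner (h : T1 * T2 -> R) : bmeas h -> bmeas (fun x => \int[Q]_y h (x, y)).
Proof.
move=> bh; have [mh [C hC]] := bh; split; last first.
  by exists C => x; apply: Rint_bound => //; exact: bmeas_section.
apply/measurable_EFinP.
have := measurable_fubini_F (bmeas_integrable (P \x Q)%E bh).
apply: eq_measurable_fun => x _.
by rewrite /fubini_F /= -RintEFin//; exact: bmeas_section.
Qed.

Lemma test_inner (h : T1 * T2 -> R) : test h -> test (fun x => \int[Q]_y h (x, y)).
Proof.
move=> th; split; first by have [] := bmeas_inner (test_bmeas th).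
by move=> x; apply: Rint_test; exact: test_section.
Qed.

Lemma Rint_prod (h : T1 * T2 -> R) : bmeas h ->
  \int[(P \x Q)%E]_z h z = \int[P]_x \int[Q]_y h (x, y).
Proof.
move=> bh; rewrite [LHS]/Rintegral -(integral12_prod_meas1 (bmeas_integrable (P \x Q)%E bh)).
congr fine; apply: eq_integral => x _.
by rewrite /fubini_F /= -RintEFin//; exact: bmeas_section.
Qed.

Lemma Rint_distribution (X : {mfun T1 >-> T2}) (h : T2 -> R) : bmeas h ->
  \int[distribution P X]_y h y = \int[P]_x h (X x).
Proof.
move=> bh; have mX : measurable_fun setT X by [].
rewrite /Rintegral integral_distribution//.
  by case: bh => mh _; exact/measurable_EFinP.
exact: (bmeas_integrable P (bmeas_comp mX bh)).
Qed.

End Fubini.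

(** * The affinity of two probabilities, and Cauchy-Schwarz *)

Section Affinity.
Variable R : realType.
Implicit Types a b t z : R.

(** The Bhattacharyya coefficient of the Bernoulli laws of parameters a and b. *)
Definition aff a b : R := Num.sqrt (a * b) + Num.sqrt ((1 - a) * (1 - b)).

Lemma sqrt_amgm a b : 0 <= a -> 0 <= b -> Num.sqrt (a * b) <= (a + b) / 2.
Proof.
move=> a0 b0; rewrite sqrtrM//.
have := sqr_ge0 (Num.sqrt a - Num.sqrt b); rewrite sqrrB !sqr_sqrtr// -mulr_natr; lra.
Qed.

Lemma aff_ge0 a b : 0 <= aff a b.
Proof. by rewrite addr_ge0 ?sqrtr_ge0. Qed.

Lemma aff_le1 a b : 0 <= a <= 1 -> 0 <= b <= 1 -> aff a b <= 1.
Proof.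
move=> /andP[a0 a1] /andP[b0 b1]; rewrite /aff.
have := sqrt_amgm a0 b0.
have := @sqrt_amgm (1 - a) (1 - b); rewrite !subr_ge0 a1 b1 => /(_ isT isT); lra.
Qed.

(** The geometric mean is the infimum of weighted arithmetic means, which are linear in a and b: an
    integral form of Cauchy-Schwarz then follows by integrating each of them. *)
Lemma amgm_le_sqrt a b z : 0 <= a -> 0 <= b ->
  (forall l, 0 < l -> z <= (l * a + b / l) / 2) -> z <= Num.sqrt (a * b).
Proof.
move=> a0 b0 H.
have [z0|z0] := leP z 0; first exact: le_trans z0 (sqrtr_ge0 _).
have ap : 0 < a.
  rewrite lt_neqAle a0 andbT; apply/eqP => ae.
  have l0 : 0 < (b + 1) / z by rewrite divr_gt0//; lra.
  have := H _ l0; rewrite -ae mulr0 add0r invf_div mulrA.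
  rewrite ler_pdivlMr// ler_pdivlMr; last lra.
  nra.
have bp : 0 < b.
  rewrite lt_neqAle b0 andbT; apply/eqP => be.
  have l0 : 0 < z / (a + 1) by rewrite divr_gt0//; lra.
  have := H _ l0; rewrite -be mul0r addr0.
  rewrite ler_pdivlMr// mulrAC ler_pdivlMr; last lra.
  nra.
have sa : 0 < Num.sqrt a by rewrite sqrtr_gt0.
have sb : 0 < Num.sqrt b by rewrite sqrtr_gt0.
(* The optimal weight; it needs a and b positive, which suitable weights have forced since z > 0. *)
have := H _ (divr_gt0 sb sa).
rewrite -{2}(sqr_sqrtr a0) -{2}(sqr_sqrtr b0) invf_div sqrtrM//.
have -> : (Num.sqrt b / Num.sqrt a * Num.sqrt a ^+ 2 + Num.sqrt b ^+ 2 *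
   (Num.sqrt a / Num.sqrt b)) / 2 = Num.sqrt a * Num.sqrt b; last by [].
by field; rewrite !gt_eqF.
Qed.

Lemma sqrt_weighted_amgm a b l : 0 <= a -> 0 <= b -> 0 < l ->
  Num.sqrt (a * b) <= (l * a + b / l) / 2.
Proof.
move=> a0 b0 l0; have -> : a * b = (l * a) * (b / l) by field; rewrite gt_eqF.
by apply: sqrt_amgm; [rewrite mulr_ge0// ltW|rewrite divr_ge0// ltW].
Qed.

(** The affinity is at most sqrt b + sqrt (1 - a), so one of the two roots is at least 1/4: a test
    cannot make both errors small. *)
Lemma aff_half a b : 0 <= a <= 1 -> 0 <= b <= 1 -> 2^-1 <= aff a b ->
  16^-1 <= Num.max (1 - a) b.
Proof.
move=> /andP[a0 a1] /andP[b0 b1] h.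
have h1 : Num.sqrt (a * b) <= Num.sqrt b by rewrite ler_wsqrtr// ler_piMl.
have h2 : Num.sqrt ((1 - a) * (1 - b)) <= Num.sqrt (1 - a).
  by rewrite ler_wsqrtr// ler_piMr; lra.
have [q|q] := leP 4^-1 (Num.sqrt b).
  rewrite le_max; apply/orP; right; have := sqr_sqrtr b0; nra.
rewrite le_max; apply/orP; left.
have a10 : 0 <= 1 - a by lra.
have := sqr_sqrtr a10; move: h; rewrite /aff; nra.
Qed.

End Affinity.

Section CauchySchwarz.
Context d (T : measurableType d) (R : realType).
Variable mu : {measure set T -> \bar R}.

Lemma measurable_sqrt (u : T -> R) : measurable_fun setT u ->
  measurable_fun setT (fun x => Num.sqrt (u x)).
Proof.
by move=> mu_; apply: (measurableT_comp (continuous_measurable_fun (@sqrt_continuous R))).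
Qed.

Lemma integrable_sqrtM (u w : T -> R) :
  mu.-integrable setT (EFin \o u) -> mu.-integrable setT (EFin \o w) ->
  (forall x, 0 <= u x) -> (forall x, 0 <= w x) ->
  mu.-integrable setT (EFin \o (fun x => Num.sqrt (u x * w x))).
Proof.
move=> iu iw u0 w0.
apply: (@le_integrable _ _ _ _ _ _ _ ((EFin \o u) \+ (EFin \o w))%E) => //; last exact: integrableD.
  apply/measurable_EFinP; apply: measurable_sqrt; apply: measurable_funM.
    by apply/measurable_EFinP; exact: (measurable_int mu).
  by apply/measurable_EFinP; exact: (measurable_int mu).
move=> x _; rewrite /= lee_fin ger0_norm ?sqrtr_ge0// ger0_norm ?addr_ge0//.
apply: le_trans (sqrt_amgm (u0 x) (w0 x)) _; have := u0 x; have := w0 x; lra.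
Qed.

Lemma Rintegral_CS (u w : T -> R) :
  mu.-integrable setT (EFin \o u) -> mu.-integrable setT (EFin \o w) ->
  (forall x, 0 <= u x) -> (forall x, 0 <= w x) ->
  \int[mu]_x Num.sqrt (u x * w x) <= Num.sqrt ((\int[mu]_x u x) * \int[mu]_x w x).
Proof.
move=> iu iw u0 w0; apply: amgm_le_sqrt; try exact: Rintegral_ge0.
move=> l l0.
have iu' := integrableZl measurableT (l / 2) iu.
have iw' := integrableZl measurableT (l^-1 / 2) iw.
have -> : (l * \int[mu]_x u x + (\int[mu]_x w x) / l) / 2 =
   \int[mu]_x (l / 2 * u x + l^-1 / 2 * w x).
  rewrite RintegralD//.
  by rewrite RintegralZl// RintegralZl//; ring.
apply: le_Rintegral => //; first exact: integrable_sqrtM.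
  by have := integrableD measurableT iu' iw'.
move=> x _; apply: le_trans (sqrt_weighted_amgm (u0 x) (w0 x) l0) _.
by rewrite le_eqVlt; apply/orP; left; apply/eqP; ring.
Qed.

End CauchySchwarz.

(** * Affinity bounds: from densities, and along products *)

Section SubAffine.
Context d (T : measurableType d) (R : realType).

(* M carries (a multiple of) the geometric mean of P0 and P1. *)
Definition sub_affine (P0 P1 M : probability T R) (rho : R) : Prop :=
  forall h0 h1 : T -> R, test h0 -> test h1 ->
  rho * \int[M]_x aff (h0 x) (h1 x) <= aff (\int[P0]_x h0 x) (\int[P1]_x h1 x).

(** Only a constant lower bound is passed on, so nothing is asked of the geometric mean beyond its
    total mass. It serves the noise, whereas [sub_affine] serves the Gaussian coefficients, over
    which a varying bound must be averaged. *)
Definition aff_bound (P0 P1 : probability T R) (rho : R) : Prop :=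
  forall (h0 h1 : T -> R) t, test h0 -> test h1 -> 0 <= t ->
  (forall x, t <= aff (h0 x) (h1 x)) ->
  rho * t <= aff (\int[P0]_x h0 x) (\int[P1]_x h1 x).

Lemma measurable_aff (h0 h1 : T -> R) : measurable_fun setT h0 -> measurable_fun setT h1 ->
  measurable_fun setT (fun x => aff (h0 x) (h1 x)).
Proof.
move=> m0 m1; apply: measurable_funD; apply: measurable_sqrt; apply: measurable_funM => //.
  exact: measurable_funB.
exact: measurable_funB.
Qed.

Lemma test_aff (h0 h1 : T -> R) : test h0 -> test h1 -> test (fun x => aff (h0 x) (h1 x)).
Proof.
move=> [m0 b0] [m1 b1]; split; first exact: measurable_aff.
by move=> x; rewrite aff_ge0/= aff_le1.
Qed.

Section Densities.
Variables (mu : {sigma_finite_measure set T -> \bar R}) (P0 P1 : probability T R).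
Variables f0 f1 : T -> R.
Hypotheses (mf0 : measurable_fun setT f0) (mf1 : measurable_fun setT f1).
Hypotheses (pf0 : forall x, 0 <= f0 x) (pf1 : forall x, 0 <= f1 x).
Hypothesis P0E : forall A, measurable A -> P0 A = (\int[mu]_(x in A) (f0 x)%:E)%E.
Hypothesis P1E : forall A, measurable A -> P1 A = (\int[mu]_(x in A) (f1 x)%:E)%E.

Lemma density_integrable (P : probability T R) (f : T -> R) : measurable_fun setT f ->
  (forall x, 0 <= f x) ->
  (forall A, measurable A -> P A = (\int[mu]_(x in A) (f x)%:E)%E) ->
  mu.-integrable setT (EFin \o f).
Proof.
move=> mf f_ge PE; apply/integrableP; split; first exact/measurable_EFinP.
rewrite (_ : (\int[mu]_x _)%E = P setT); first by rewrite probability_setT ltry.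
by rewrite PE//; apply: eq_integral => x _ /=; rewrite ger0_norm.
Qed.

Lemma test_density_integrable (P : probability T R) (f h : T -> R) : measurable_fun setT f ->
  (forall x, 0 <= f x) ->
  (forall A, measurable A -> P A = (\int[mu]_(x in A) (f x)%:E)%E) -> test h ->
  mu.-integrable setT (EFin \o (fun x => h x * f x)).
Proof.
move=> mf f_ge PE [mh h01]; apply: le_integrable (density_integrable mf f_ge PE) => //.
  by apply/measurable_EFinP; exact: measurable_funM.
move=> x _ /=; rewrite lee_fin; have /andP[h0 h1] := h01 x.
by rewrite normrM ler_piMl// ger0_norm.
Qed.

Lemma Rint_test_density (P : probability T R) (f h : T -> R) : measurable_fun setT f ->
  (forall x, 0 <= f x) ->
  (forall A, measurable A -> P A = (\int[mu]_(x in A) (f x)%:E)%E) -> test h ->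
  \int[P]_x h x = \int[mu]_x (h x * f x).
Proof.
move=> mf f_ge PE th; rewrite (Rintegral_density mf f_ge PE)//.
  by case: th.
exact: (test_density_integrable mf f_ge PE th).
Qed.

Lemma integrable_geometric :
  mu.-integrable setT (EFin \o (fun x => Num.sqrt (f0 x * f1 x))).
Proof.
apply: integrable_sqrtM => //; first exact: density_integrable P0E.
exact: density_integrable P1E.
Qed.

Lemma integrable_geometric_test h : test h ->
  mu.-integrable setT (EFin \o (fun x => h x * Num.sqrt (f0 x * f1 x))).
Proof.
move=> [mh h01]; apply: le_integrable integrable_geometric => //.
  apply/measurable_EFinP; apply: measurable_funM => //.
  by apply: measurable_sqrt; exact: measurable_funM.
move=> x _ /=; rewrite lee_fin; have /andP[h0 h1] := h01 x.
by rewrite normrM ler_piMl// ger0_norm.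
Qed.

(** Cauchy-Schwarz for the tests and once more for their complements. *)
Lemma aff_density (h0 h1 : T -> R) : test h0 -> test h1 ->
  \int[mu]_x (aff (h0 x) (h1 x) * Num.sqrt (f0 x * f1 x)) <=
  aff (\int[P0]_x h0 x) (\int[P1]_x h1 x).
Proof.
move=> t0 t1.
have H (k0 k1 : T -> R) : test k0 -> test k1 ->
    \int[mu]_x (Num.sqrt (k0 x * k1 x) * Num.sqrt (f0 x * f1 x)) <=
    Num.sqrt ((\int[P0]_x k0 x) * \int[P1]_x k1 x).
  move=> tk0 tk1; have [_ b0] := tk0; have [_ b1] := tk1.
  rewrite (Rint_test_density mf0 pf0 P0E tk0) (Rint_test_density mf1 pf1 P1E tk1).
  have p0 x : 0 <= k0 x * f0 x by rewrite mulr_ge0//; have /andP[] := b0 x.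
  have p1 x : 0 <= k1 x * f1 x by rewrite mulr_ge0//; have /andP[] := b1 x.
  apply: le_trans (Rintegral_CS _ _ p0 p1).
  - rewrite le_eqVlt; apply/orP; left; apply/eqP; apply: eq_Rintegral => x _.
    rewrite -sqrtrM; last by rewrite mulr_ge0//; [have /andP[] := b0 x|have /andP[] := b1 x].
    by congr Num.sqrt; ring.
  - exact: test_density_integrable P0E tk0.
  - exact: test_density_integrable P1E tk1.
have tg (k0 k1 : T -> R) : test k0 -> test k1 -> test (fun x => Num.sqrt (k0 x * k1 x)).
  move=> [m0 b0] [m1 b1]; split; first by apply: measurable_sqrt; exact: measurable_funM.
  move=> x; have /andP[x0 x1] := b0 x; have /andP[y0 y1] := b1 x.
  by rewrite sqrtr_ge0/= (le_trans (sqrt_amgm x0 y0))//; lra.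
rewrite /aff -(Rint_C P0 t0) -(Rint_C P1 t1).
apply: le_trans (lerD (H _ _ t0 t1) (H _ _ (testC t0) (testC t1))).
rewrite -RintegralD//.
- by rewrite le_eqVlt; apply/orP; left; apply/eqP; apply: eq_Rintegral => x _; rewrite mulrDl.
- by apply: integrable_geometric_test; exact: tg.
- by apply: integrable_geometric_test; apply: (tg _ _ (testC t0) (testC t1)).
Qed.

Lemma sub_affine_density (M : probability T R) (fM : T -> R) rho :
  measurable_fun setT fM -> (forall x, 0 <= fM x) ->
  (forall A, measurable A -> M A = (\int[mu]_(x in A) (fM x)%:E)%E) ->
  (forall x, Num.sqrt (f0 x * f1 x) = rho * fM x) -> sub_affine P0 P1 M rho.
Proof.
move=> mfM pfM ME hrho h0 h1 t0 t1; apply: le_trans (aff_density t0 t1).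
have ta := test_aff t0 t1.
rewrite (Rint_test_density mfM pfM ME ta) -RintegralZl//; last first.
  exact: test_density_integrable ME ta.
rewrite le_eqVlt; apply/orP; left; apply/eqP; apply: eq_Rintegral => x _.
by rewrite hrho mulrCA.
Qed.

Lemma aff_bound_density rho :
  rho <= \int[mu]_x Num.sqrt (f0 x * f1 x) -> aff_bound P0 P1 rho.
Proof.
move=> hrho h0 h1 t t0 t1 t_ge ht; apply: le_trans (aff_density t0 t1).
have ig := integrable_geometric.
apply: (@le_trans _ _ (t * \int[mu]_x Num.sqrt (f0 x * f1 x))).
  by rewrite mulrC ler_wpM2l.
rewrite -RintegralZl//; apply: le_Rintegral => //.
- exact: (integrableZl measurableT t ig).
- by apply: integrable_geometric_test; exact: test_aff.
- by move=> x _; rewrite ler_wpM2r ?sqrtr_ge0.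
Qed.

End Densities.

Lemma sub_affine_refl (P : probability T R) : sub_affine P P P 1.
Proof.
move=> h0 h1 t0 t1; rewrite mul1r.
have b0 := test_bmeas t0; have b1 := test_bmeas t1.
have H (k0 k1 : T -> R) : test k0 -> test k1 ->
    \int[P]_x Num.sqrt (k0 x * k1 x) <= Num.sqrt ((\int[P]_x k0 x) * \int[P]_x k1 x).
  move=> tk0 tk1; apply: Rintegral_CS.
  - exact: (bmeas_integrable P (test_bmeas tk0)).
  - exact: (bmeas_integrable P (test_bmeas tk1)).
  - by move=> x; have [_ /(_ x)/andP[]] := tk0.
  - by move=> x; have [_ /(_ x)/andP[]] := tk1.
have tg (k0 k1 : T -> R) : test k0 -> test k1 -> bmeas (fun x => Num.sqrt (k0 x * k1 x)).
  move=> [m0 c0] [m1 c1]; apply: test_bmeas; split; first by apply: measurable_sqrt; exact: measurable_funM.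
  move=> x; have /andP[x0 x1] := c0 x; have /andP[y0 y1] := c1 x.
  by rewrite sqrtr_ge0/= (le_trans (sqrt_amgm x0 y0))//; lra.
rewrite /aff (RintD P (tg _ _ t0 t1) (tg _ _ (testC t0) (testC t1))).
rewrite -(Rint_C P t0) -(Rint_C P t1); apply: lerD; first exact: H.
exact: (H _ _ (testC t0) (testC t1)).
Qed.

End SubAffine.

Section SubAffineClosure.
Context d1 d2 (T1 : measurableType d1) (T2 : measurableType d2) (R : realType).

(** Inner integrals of tests are tests, so the bound of the first factor applies to them; the bound
    of the second factor is then integrated under [M]. *)
Lemma sub_affine_prod (P0 P1 M : probability T1 R) (Q0 Q1 N : probability T2 R) rho sig :
  0 <= rho -> sub_affine P0 P1 M rho -> sub_affine Q0 Q1 N sig ->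
  sub_affine (P0 \x Q0)%E (P1 \x Q1)%E (M \x N)%E (rho * sig).
Proof.
move=> rho0 HP HQ h0 h1 t0 t1.
have ta := test_aff t0 t1.
have i0 := test_inner P0 Q0 t0; have i1 := test_inner P1 Q1 t1.
rewrite (Rint_prod M N (test_bmeas ta)) (Rint_prod P0 Q0 (test_bmeas t0)) (Rint_prod P1 Q1 (test_bmeas t1)).
apply: le_trans (HP _ _ i0 i1); rewrite -mulrA ler_wpM2l//.
have bi := test_bmeas (test_inner M N ta).
rewrite -(RintZ M sig bi); apply: Rint_le.
- exact: (bmeasM (bmeas_cst _ sig) bi).
- exact/test_bmeas/test_aff.
- by move=> x; apply: HQ; exact: test_section.
Qed.

Lemma aff_bound_prod (P0 P1 : probability T1 R) (Q0 Q1 : probability T2 R) rho sig :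
  0 <= sig -> aff_bound P0 P1 rho -> aff_bound Q0 Q1 sig ->
  aff_bound (P0 \x Q0)%E (P1 \x Q1)%E (rho * sig).
Proof.
move=> s0 HP HQ h0 h1 t t0 t1 t_ge ht.
have i0 := test_inner P0 Q0 t0; have i1 := test_inner P1 Q1 t1.
rewrite (Rint_prod P0 Q0 (test_bmeas t0)) (Rint_prod P1 Q1 (test_bmeas t1)).
rewrite -mulrA; apply: HP => //; first exact: mulr_ge0.
by move=> x; apply: HQ => //; exact: test_section.
Qed.

Lemma sub_affine_distribution (P0 P1 M : probability T1 R) (X : {mfun T1 >-> T2}) rho :
  sub_affine P0 P1 M rho ->
  sub_affine (distribution P0 X) (distribution P1 X) (distribution M X) rho.
Proof.
move=> H h0 h1 t0 t1; have mX : measurable_fun setT X by [].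
rewrite (Rint_distribution M X (test_bmeas (test_aff t0 t1))).
rewrite (Rint_distribution P0 X (test_bmeas t0)) (Rint_distribution P1 X (test_bmeas t1)).
by apply: H; exact: (test_comp mX).
Qed.

Lemma aff_bound_distribution (P0 P1 : probability T1 R) (X : {mfun T1 >-> T2}) rho :
  aff_bound P0 P1 rho -> aff_bound (distribution P0 X) (distribution P1 X) rho.
Proof.
move=> H h0 h1 t t0 t1 t_ge ht; have mX : measurable_fun setT X by [].
rewrite (Rint_distribution P0 X (test_bmeas t0)) (Rint_distribution P1 X (test_bmeas t1)).
by apply: H => //; exact: (test_comp mX).
Qed.

End SubAffineClosure.

(** * Product laws on tuples and their determination by orthants *)

Section TupleProduct.
Variable R : realType.
Local Notation RR := (measurableTypeR R).

Definition tcons n (z : RR * n.-tuple RR) : n.+1.-tuple RR := [tuple of z.1 :: z.2].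

Lemma measurable_tcons n : measurable_fun setT (@tcons n).
Proof. exact: measurable_cons. Qed.

HB.instance Definition _ n := isMeasurableFun.Build _ _ _ _ (@tcons n) (@measurable_tcons n).

(** The law of independent coordinates with laws P 0, P 1, ...; families indexed by [nat] make the
    recursion a plain shift. *)
Fixpoint tprod n (P : nat -> probability RR R) : probability (n.-tuple RR) R :=
  match n with
  | 0 => \d_[tuple]
  | n.+1 => distribution (P 0%N \x tprod n (P \o succn))%E (@tcons n)
  end.

Lemma tprodS n (P : nat -> probability RR R) (h : n.+1.-tuple RR -> R) : bmeas h ->
  \int[tprod n.+1 P]_z h z = \int[P 0%N]_x \int[tprod n (P \o succn)]_y h (tcons (x, y)).
Proof.
move=> bh; rewrite [tprod _ _]/= Rint_distribution// Rint_prod//.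
exact: (bmeas_comp (@measurable_tcons n)).
Qed.

Lemma Rint_dirac d (T : measurableType d) (a : T) (h : T -> R) : bmeas h ->
  \int[\d_a : probability T R]_x h x = h a.
Proof.
move=> [mh _]; rewrite /Rintegral integral_dirac//; last exact/measurable_EFinP.
by rewrite diracT mul1e.
Qed.

Lemma sub_affine_tprod n (P0 P1 M : nat -> probability RR R) (rho : nat -> R) :
  (forall i, 0 <= rho i) -> (forall i, (i < n)%N -> sub_affine (P0 i) (P1 i) (M i) (rho i)) ->
  sub_affine (tprod n P0) (tprod n P1) (tprod n M) (\prod_(i < n) rho i).
Proof.
elim: n P0 P1 M rho => [|n IH] P0 P1 M rho r0 H.
  by rewrite big_ord0; exact: sub_affine_refl.
rewrite big_ord_recl; apply: sub_affine_distribution; apply: sub_affine_prod => //.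
  exact: H.
by apply: (IH _ _ _ (rho \o succn)) => [i|i hi]; [exact: r0|exact: H].
Qed.

Lemma aff_bound_tprod n (P0 P1 : nat -> probability RR R) (rho : nat -> R) :
  (forall i, 0 <= rho i) -> (forall i, (i < n)%N -> aff_bound (P0 i) (P1 i) (rho i)) ->
  aff_bound (tprod n P0) (tprod n P1) (\prod_(i < n) rho i).
Proof.
elim: n P0 P1 rho => [|n IH] P0 P1 rho r0 H.
  rewrite big_ord0 => h0 h1 t t0 t1 t_ge ht; rewrite mul1r.
  by rewrite (Rint_dirac _ (test_bmeas t0)) (Rint_dirac _ (test_bmeas t1)); exact: ht.
rewrite big_ord_recl; apply: aff_bound_distribution; apply: aff_bound_prod => //.
- by apply: prodr_ge0 => i _; exact: r0.
- exact: H.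
- by apply: (IH _ _ (rho \o succn)) => [i|i hi]; [exact: r0|exact: H].
Qed.

End TupleProduct.

Section TupleUniqueness.
Variable R : realType.
Local Notation RR := (measurableTypeR R).

Definition box n (B : 'I_n -> set RR) : set (n.-tuple RR) :=
  [set t | forall i, B i (tnth t i)].

Lemma boxE n (B : 'I_n -> set RR) :
  box B = \bigcap_(i in [set: 'I_n]) ((fun t : n.-tuple RR => tnth t i) @^-1` B i).
Proof. by apply/seteqP; split=> t /= h i => [_|]; exact: h. Qed.

Lemma measurable_box n (B : 'I_n -> set RR) : (forall i, measurable (B i)) ->
  measurable (box B).
Proof.
move=> mB; rewrite boxE; apply: fin_bigcap_measurable; first exact: finite_finset.
by move=> i _; rewrite -[X in measurable X]setTI; exact: measurable_tnth.
Qed.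

(** Open upper orthants: stable under intersection and generating, so a finite measure is determined
    by its values on them. *)
Definition hbox n (a : 'I_n -> R) : set (n.-tuple RR) :=
  box (fun i => `]a i, +oo[%classic).

Lemma measurable_hbox n (a : 'I_n -> R) : measurable (hbox a).
Proof. by apply: measurable_box => i; exact: measurable_itv. Qed.

Lemma hboxP n (a : 'I_n -> R) t : hbox a t <-> forall i, a i < tnth t i.
Proof. by split=> h i; have := h i; rewrite /= in_itv/= andbT. Qed.

Lemma tuple_lower_bound n (t : n.-tuple RR) : exists k : nat, forall i, - k%:R < tnth t i.
Proof.
exists (\sum_(i < n) (Num.truncn (`|tnth t i|%R)).+1)%N => i.
rewrite ltrNl; apply: le_lt_trans (ler_norm _) _; rewrite normrN.
apply: lt_le_trans (truncnS_gt _) _; rewrite ler_nat.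
by rewrite (bigD1 i)//= (leq_trans _ (leq_addr _ _))//.
Qed.

Lemma tuple_measurable_hbox n :
  @measurable _ (n.-tuple RR) = <<s [set A | exists a, A = hbox a] >>.
Proof.
set G := [set A | exists a, A = hbox a].
apply/seteqP; split; last first.
  apply: smallest_sub; first exact: sigma_algebra_measurable.
  by move=> _ [a ->]; exact: measurable_hbox.
apply: smallest_sub; first exact: smallest_sigma_algebra.
rewrite -bigcup_seq => A [i /= _ [B mB <-]].
pose T' := g_sigma_algebraType G.
suff : measurable_fun setT ((fun t => tnth t i) : T' -> RR).
  by move=> /(_ measurableT B mB).
apply: (@measurability _ _ _ _ _ _ (@RGenOInfty.G R)).
  exact: RGenOInfty.measurableE.
move=> _ [_ [x ->] <-]; rewrite setTI.
(* The other coordinates are released by sending their lower ends to minus infinity. *)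
have -> : (fun t : T' => tnth t i) @^-1` `]x, +oo[%classic =
    \bigcup_k hbox (fun j => if j == i then x else - k%:R).
  apply/seteqP; split=> t /=.
    rewrite in_itv/= andbT => xt; have [k hk] := tuple_lower_bound t.
    by exists k => //; apply/hboxP => j; case: eqVneq => [->|_].
  by move=> [k _ /hboxP /(_ i)]; rewrite eqxx in_itv/= andbT.
apply: sigma_algebra_bigcup => k; apply: sub_sigma_algebra.
by exists (fun j => if j == i then x else - k%:R).
Qed.

Lemma tuple_measure_unique n (m1 m2 : {measure set (n.-tuple RR) -> \bar R}) :
  (m1 setT < +oo)%E -> (forall a, m1 (hbox a) = m2 (hbox a)) ->
  forall A, measurable A -> m1 A = m2 A.
Proof.
move=> m1oo H A mA.
apply: (measure_unique [set A | exists a, A = hbox a] (fun k => hbox (fun=> - k%:R))) => //.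
- exact: tuple_measurable_hbox.
- move=> _ _ [a ->] [b ->]; exists (fun i => Num.max (a i) (b i)).
  apply/seteqP; split=> t.
    by move=> [/hboxP h1 /hboxP h2]; apply/hboxP => i; rewrite gt_max h1 h2.
  by move=> /hboxP h; split; apply/hboxP => i; have := h i; rewrite gt_max => /andP[].
- by move=> k; exists (fun=> - k%:R).
- apply/seteqP; split=> // t _; have [k hk] := tuple_lower_bound t.
  by exists k => //; apply/hboxP.
- by move=> _ [a ->]; exact: H.
- move=> k; apply: le_lt_trans m1oo; apply: le_measure => //; rewrite inE//.
  exact: measurable_hbox.
Qed.

Lemma tprod_box n (P : nat -> probability RR R) (B : nat -> set RR) :
  (forall i, measurable (B i)) ->
  (tprod n P (box (fun i : 'I_n => B i)) = \prod_(i < n) P i (B i))%E.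
Proof.
elim: n P B => [|n IH] P B mB.
  by rewrite big_ord0 /= diracE mem_set// => -[].
rewrite big_ord_recl/= -(IH (P \o succn) (B \o succn))//; last by move=> i; exact: mB.
rewrite -(product_measure1E (P 0%N) (tprod n (P \o succn)))//; last first.
  by apply: measurable_box => i; exact: mB.
rewrite /distribution /pushforward; congr (_ _).
apply/seteqP; split=> [[x y] /= h|[x y] /= [h0 h] i].
  split; first exact: (h ord0).
  by move=> i; have := h (lift ord0 i); rewrite tnthS.
have [->//|i0] := eqVneq i ord0.
have [j ->] : exists j, i = lift ord0 j.
  by case: (unliftP ord0 i) i0 => [j ->|->]; [exists j|rewrite eqxx].
by rewrite tnthS; exact: h.
Qed.

End TupleUniqueness.

(** * A law on tuples is determined by its characteristic function *)

Section TrigonometricClass.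
Context d (T : measurableType d) (R : realType).
Variables (m1 m2 : probability T R) (K : Type) (phase : K -> T -> R).

(* Multipliers that preserve equality of integrals against all test phases. *)
Definition same (f : T -> R) : Prop :=
  bmeas f /\ forall k, \int[m1]_x (f x * cos (phase k x)) = \int[m2]_x (f x * cos (phase k x)).

Definition multiplier (g : T -> R) : Prop :=
  bmeas g /\ forall f, same f -> same (fun x => f x * g x).

Hypothesis mphase : forall k, measurable_fun setT (phase k).
Hypothesis phase_sum : forall k l, exists s, forall x, phase s x = phase k x + phase l x.
Hypothesis phase_diff : forall k l, exists s, forall x, phase s x = phase k x - phase l x.

Lemma bmeas_cos k : bmeas (fun x => cos (phase k x)).
Proof.
split; last by exists 1 => x; exact: cos_max.
exact: (measurableT_comp (continuous_measurable_fun (@continuous_cos R))).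
Qed.

Lemma multiplier_cst c : multiplier (fun=> c).
Proof.
split; first exact: bmeas_cst.
move=> f [bf H]; split; first exact: bmeasM bf (bmeas_cst _ _).
have E (m : probability T R) k : \int[m]_x (f x * c * cos (phase k x)) = c * \int[m]_x (f x * cos (phase k x)).
  rewrite -RintZ; last exact: bmeasM (bmeas_cos k).
  by apply: eq_Rintegral => x _; ring.
by move=> k; rewrite !E H.
Qed.

Lemma multiplierD g h : multiplier g -> multiplier h -> multiplier (fun x => g x + h x).
Proof.
move=> [bg Hg] [bh Hh]; split; first exact: bmeasD.
move=> f sf; have [bf _] := sf; split; first exact: bmeasM bf (bmeasD bg bh).
have E (m : probability T R) k : \int[m]_x (f x * (g x + h x) * cos (phase k x)) =
    \int[m]_x (f x * g x * cos (phase k x)) + \int[m]_x (f x * h x * cos (phase k x)).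
  rewrite -RintD; last 2 first.
  - exact: bmeasM (bmeasM bf bg) (bmeas_cos k).
  - exact: bmeasM (bmeasM bf bh) (bmeas_cos k).
  by apply: eq_Rintegral => x _; ring.
by move=> k; rewrite !E (proj2 (Hg f sf)) (proj2 (Hh f sf)).
Qed.

Lemma multiplierM g h : multiplier g -> multiplier h -> multiplier (fun x => g x * h x).
Proof.
move=> [bg Hg] [bh Hh]; split; first exact: bmeasM.
move=> f sf; have := Hh _ (Hg _ sf).
by under [in X in X -> _]eq_fun do rewrite -mulrA.
Qed.

Lemma multiplierX g n : multiplier g -> multiplier (fun x => g x ^+ n).
Proof.
move=> mg; elim: n => [|n IH]; first exact: multiplier_cst.
have := multiplierM mg IH.
by under [in X in X -> _]eq_fun do rewrite -exprS.
Qed.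

(** A product of cosines is half the sum of the cosines of the sum and of the difference, and these
    are again admissible phases. *)
Lemma multiplier_cos k : multiplier (fun x => cos (phase k x)).
Proof.
split; first exact: bmeas_cos.
move=> f [bf H]; split; first exact: bmeasM bf (bmeas_cos k).
move=> l; have [s hs] := phase_sum k l; have [t ht] := phase_diff k l.
have E (m : probability T R) : \int[m]_x (f x * cos (phase k x) * cos (phase l x)) =
   2^-1 * (\int[m]_x (f x * cos (phase s x)) + \int[m]_x (f x * cos (phase t x))).
  rewrite -RintD; last 2 first.
  - exact: bmeasM bf (bmeas_cos s).
  - exact: bmeasM bf (bmeas_cos t).
  rewrite -RintZ; last exact: bmeasD (bmeasM bf (bmeas_cos s)) (bmeasM bf (bmeas_cos t)).
  by apply: eq_Rintegral => x _; rewrite hs ht cosD cosB; field.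
by rewrite !E !H.
Qed.

(** Dominated convergence. Together with sums and products it leads from cosines to indicators
    without inverting a Fourier transform. *)
Lemma multiplier_limit (g_ : nat -> T -> R) (g : T -> R) : (forall n, multiplier (g_ n)) ->
  (forall n x, `|g_ n x| <= 1) -> measurable_fun setT g ->
  (forall x, g_ n x @[n --> \oo] --> g x) -> multiplier g.
Proof.
move=> mg_ g1 mg cg.
have bg : bmeas g.
  split => //; exists 1 => x; rewrite ler_norml; apply/andP; split.
    apply: (@closed_cvg _ _ _ _ (g_ ^~ x) (fun y => - 1 <= y) (@closed_ge R (- 1)) _ _ (cg x)); apply: nearW => n /=.
    by have := g1 n x; rewrite ler_norml => /andP[].
  apply: (@closed_cvg _ _ _ _ (g_ ^~ x) (fun y => y <= 1) (@closed_le R 1) _ _ (cg x)); apply: nearW => n /=.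
  by have := g1 n x; rewrite ler_norml => /andP[].
split => // f sf; have [bf _] := sf; split; first exact: bmeasM.
move=> k; have [mf [C hC]] := bf.
have L (m : probability T R) : (\int[m]_x (f x * g_ n x * cos (phase k x))%:E)%E
    @[n --> \oo] --> (\int[m]_x (f x * g x * cos (phase k x))%:E)%E.
  have [] := @dominated_convergence _ _ _ m setT measurableT
    (fun n x => (f x * g_ n x * cos (phase k x))%:E)
    (fun x => (f x * g x * cos (phase k x))%:E) (cst C%:E).
  - move=> n; apply/measurable_EFinP.
    by have [] := bmeasM (bmeasM bf (proj1 (mg_ n))) (bmeas_cos k).
  - by apply/measurable_EFinP; have [] := bmeasM (bmeasM bf bg) (bmeas_cos k).
  - apply: aeW => x _; apply: cvg_EFin; first by apply: nearW.
    by apply: cvgM; last exact: cvg_cst; apply: cvgM; [exact: cvg_cst|exact: cg].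
  - exact: (bmeas_integrable m (bmeas_cst _ C)).
  - apply: aeW => x n _; rewrite abse_EFin lee_fin !normrM.
    apply: le_trans (hC x); rewrite -mulrA ler_piMr//.
    by rewrite mulr_ile1// ?cos_max// g1.
  - by move=> _ _; apply.
have E n : (\int[m1]_x (f x * g_ n x * cos (phase k x))%:E)%E =
           (\int[m2]_x (f x * g_ n x * cos (phase k x))%:E)%E.
  have b := bmeasM (bmeasM bf (proj1 (mg_ n))) (bmeas_cos k).
  rewrite (RintEFin m1 b) (RintEFin m2 b); congr EFin.
  exact: (proj2 ((proj2 (mg_ n)) _ sf)).
have := L m1; under eq_fun do rewrite E; move=> L1.
by rewrite /Rintegral (cvg_unique _ L1 (L m2)).
Qed.

End TrigonometricClass.

Section TrigonometricStep.
Variable R : realType.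
Implicit Types (w s z : R).

(** Bernoulli's inequality in the form (1 - w)^M <= 1 / (1 + M w), which needs no bound on M w. *)
Lemma bernoulli_recip w M : 0 <= w <= 1 -> (1 - w) ^+ M * (1 + M%:R * w) <= 1.
Proof.
move=> /andP[w0 w1]; elim: M => [|M IH]; first by rewrite mul0r addr0 expr0 mulr1.
apply: le_trans IH; rewrite exprSr -mulrA ler_wpM2l ?exprn_ge0 ?subr_ge0//.
rewrite -natr1; have : 0 <= M%:R :> R by []; nra.
Qed.

Lemma bernoulli_compl w M : 0 <= w <= 1 -> 1 - M%:R * w <= (1 - w) ^+ M.
Proof.
move=> /andP[w0 w1]; elim: M => [|M IH]; first by rewrite mul0r subr0 expr0.
rewrite exprSr -natr1.
have : (1 - M%:R * w) * (1 - w) <= (1 - w) ^+ M * (1 - w).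
  by rewrite ler_wpM2r// subr_ge0.
have : 0 <= M%:R :> R by []; nra.
Qed.

Lemma bernoulli_growth s j : 0 <= s -> 1 + j%:R * s <= (1 + s) ^+ j.
Proof.
move=> s0; elim: j => [|j IH]; first by rewrite mul0r addr0 expr0.
rewrite exprSr -natr1.
have : (1 + j%:R * s) * (1 + s) <= (1 + s) ^+ j * (1 + s) by rewrite ler_wpM2r//; lra.
have : 0 <= j%:R :> R by []; nra.
Qed.

Definition wavestep (k : nat) z : R := (1 + sin ((z - k%:R^-1) / k%:R)) / 2.

(** A trigonometric polynomial in z that tends to the indicator of z > 0. With j = k^3 and w =
    [wavestep k z], 1 - (1 - w^j)^(2^j) is near 1 when 2^j w^j is large and near 0 when it is small,
    and 2^j w^j = (1 + sin)^j. Division by k stretches the period beyond any fixed z. For large k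
    the sine is at least z / (4 k) if z > 0, and, thanks to the shift by 1 / k, at most - 1 / (2
    k^2) if z <= 0; the power k^3 outweighs both. *)
Definition trigstep (k : nat) z : R :=
  1 - (1 - wavestep k z ^+ (k ^ 3)) ^+ (2 ^ (k ^ 3)).

Lemma wavestep01 k z : 0 <= wavestep k z <= 1.
Proof.
rewrite /wavestep; have := sin_geN1 ((z - k%:R^-1) / k%:R).
by have := sin_le1 ((z - k%:R^-1) / k%:R); lra.
Qed.

Lemma wavestep_pow01 k z j : 0 <= wavestep k z ^+ j <= 1.
Proof.
have /andP[w0 w1] := wavestep01 k z.
by rewrite exprn_ge0//= exprn_ile1.
Qed.

Lemma trigstep01 k z : 0 <= trigstep k z <= 1.
Proof.
have /andP[w0 w1] := wavestep_pow01 k z (k ^ 3).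
rewrite /trigstep; set w := _ ^+ (k ^ 3) in w0 w1 *.
have : 0 <= (1 - w) ^+ (2 ^ (k ^ 3)) <= 1.
  by rewrite exprn_ge0 ?subr_ge0//= exprn_ile1 ?subr_ge0// gerBl.
lra.
Qed.

Lemma two_wavestep k z j :
  (2 ^ j)%:R * wavestep k z ^+ j = (1 + sin ((z - k%:R^-1) / k%:R)) ^+ j.
Proof. by rewrite /wavestep natrX -exprMn mulrC divfK. Qed.

Lemma trigstep_pos k z : 0 < z -> 2 <= k%:R * z -> z <= k%:R ->
  1 - 4 / (k%:R * z) <= trigstep k z.
Proof.
move=> z0 kz zk; have k0 : 0 < k%:R :> R by exact: lt_le_trans zk.
have kz0 : 0 < k%:R * z by rewrite mulr_gt0.
have k1 : 1 <= k%:R :> R by rewrite ler1n -(ltr0n R).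
rewrite /trigstep; set w := _ ^+ (k ^ 3); set M := (2 ^ _)%N.
have b := @bernoulli_recip _ M (wavestep_pow01 k z (k ^ 3)); rewrite -/w in b.
pose s := sin ((z - k%:R^-1) / k%:R).
have ik : k%:R^-1 <= z / 2.
  by rewrite -[k%:R^-1]mul1r ler_pdivrMr//; lra.
have t1 : z / (2 * k%:R) <= (z - k%:R^-1) / k%:R.
  by rewrite invfM mulrA ler_wpM2r ?invr_ge0 ?(ltW k0)//; lra.
have t2 : (z - k%:R^-1) / k%:R <= pi / 2.
  apply: (@le_trans _ _ 1); last exact: pihalf_ge1.
  rewrite ler_pdivrMr// mul1r (le_trans _ zk)// gerBl invr_ge0 ltW//.
have t0 : 0 < z / (2 * k%:R) by rewrite divr_gt0 ?mulr_gt0.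
have s1 : z / (4 * k%:R) <= s.
  apply: le_trans (sin_ge_half _); last by rewrite t2 andbT; lra.
  have -> : z / (4 * k%:R) = z / (2 * k%:R) / 2 by field; rewrite gt_eqF.
  by rewrite ler_wpM2r.
have s0 : 0 <= s by apply: le_trans s1; rewrite divr_ge0 ?mulr_ge0 ?(ltW z0) ?(ltW k0).
have g := bernoulli_growth (k ^ 3) s0.
rewrite /s -two_wavestep -/w -/M -/s in g.
have big : k%:R * z / 4 <= M%:R * w.
  apply: (@le_trans _ _ ((k ^ 3)%:R * (z / (4 * k%:R)))); last first.
    have : (k ^ 3)%:R * (z / (4 * k%:R)) <= (k ^ 3)%:R * s by rewrite ler_wpM2l.
    lra.
  rewrite natrX (_ : k%:R ^+ 3 * _ = k%:R * (k%:R * z / 4)); last by field; rewrite gt_eqF.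
  by rewrite ler_peMl// divr_ge0// ltW.
have p0 : 0 <= (1 - w) ^+ M.
  by have := wavestep_pow01 k z (k ^ 3); rewrite -/w => /andP[? ?]; rewrite exprn_ge0// subr_ge0.
suff : (1 - w) ^+ M <= 4 / (k%:R * z) by lra.
rewrite ler_pdivlMr//; nra.
Qed.

Lemma trigstep_neg k z : z <= 0 -> 1 - z <= k%:R -> trigstep k z <= 2 / k%:R.
Proof.
move=> z0 zk; have k0 : 0 < k%:R :> R by apply: lt_le_trans zk; lra.
have k1 : 1 <= k%:R :> R by lra.
rewrite /trigstep; set w := _ ^+ (k ^ 3); set M := (2 ^ _)%N.
have b := bernoulli_compl M (wavestep_pow01 k z (k ^ 3)); rewrite -/w in b.
apply: (@le_trans _ _ (M%:R * w)); first lra.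
rewrite /M /w two_wavestep.
set s := sin _.
have ik : k%:R^-1 <= 1 :> R by rewrite invf_le1.
have ik0 : 0 < k%:R^-1 :> R by rewrite invr_gt0.
pose t := (k%:R^-1 - z) / k%:R.
have st : s = - sin t by rewrite /s /t -sinN; congr sin; ring.
have t0 : k%:R^-1 ^+ 2 <= t.
  by rewrite /t expr2 ler_wpM2r ?(ltW ik0)//; lra.
have i20 : 0 < k%:R^-1 ^+ 2 :> R by rewrite exprn_gt0.
have t1 : t <= pi / 2.
  by apply: (@le_trans _ _ 1); [rewrite /t ler_pdivrMr// mul1r; lra|exact: pihalf_ge1].
have s1 : t / 2 <= sin t by apply: sin_ge_half; rewrite t1 andbT; lra.
pose q : R := k%:R^-1 ^+ 2 / 2.
have q0 : 0 <= q by rewrite /q divr_ge0// ltW.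
have i21 : k%:R^-1 ^+ 2 <= 1 :> R by rewrite exprn_ile1// ltW.
have q1 : q <= 1 by rewrite /q; lra.
have c := @bernoulli_recip q (k ^ 3); rewrite q0 q1 in c; have {}c := c isT.
have h : (1 + s) ^+ (k ^ 3) <= (1 - q) ^+ (k ^ 3).
  rewrite lerXn2r ?nnegrE//; last by rewrite st /q; lra.
  - by have := sin_geN1 ((z - k%:R^-1) / k%:R); rewrite -/s; lra.
  - by rewrite subr_ge0.
apply: le_trans h _.
have e : (k ^ 3)%:R * q = k%:R / 2 by rewrite natrX /q; field; rewrite gt_eqF.
rewrite e in c.
have p0 : 0 <= (1 - q) ^+ (k ^ 3) by rewrite exprn_ge0// subr_ge0.
rewrite ler_pdivlMr//; nra.
Qed.

Lemma cvg_trigstep z : (fun n => trigstep n z) @ \oo --> ((0 < z)%R%:R : R).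
Proof.
apply/cvgrPdist_le => e e0.
have big (c : R) : \forall n \near \oo, c <= n%:R.
  near=> n; apply: (le_trans (ltW (truncnS_gt _))).
  by rewrite ler_nat; near: n; exact: nbhs_infty_ge.
have [z0|z0] := ltP 0 z.
  near=> n.
  have n1 : z <= n%:R by near: n.
  have n2 : 2 / z <= n%:R by near: n.
  have n3 : 4 / (e * z) <= n%:R by near: n.
  have n0 : 0 < n%:R :> R by exact: lt_le_trans n1.
  have h := @trigstep_pos n z z0 _ n1.
  have {}h := h (ltac:(by rewrite -ler_pdivrMr)).
  have /andP[_ h1] := trigstep01 n z.
  rewrite /= ger0_norm ?subr_ge0//.
  have : 4 / (n%:R * z) <= e.
    rewrite ler_pdivrMr ?mulr_gt0//; move: n3; rewrite ler_pdivrMr ?mulr_gt0//; lra.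
  lra.
near=> n.
have n1 : 1 - z <= n%:R by near: n.
have n3 : 2 / e <= n%:R by near: n.
have n0 : 0 < n%:R :> R by apply: lt_le_trans n1; lra.
have h := trigstep_neg z0 n1; have /andP[h1 _] := trigstep01 n z.
rewrite /= sub0r normrN ger0_norm//; apply: le_trans h _.
by rewrite ler_pdivrMr// mulrC -ler_pdivrMr.
Unshelve. all: by end_near. Qed.

End TrigonometricStep.

(** * Equality of laws through linear combinations *)

Section CramerWold.
Variable R : realType.
Local Notation RR := (measurableTypeR R).
Variable n : nat.

Definition affine (cb : ('I_n -> R) * R) (t : n.-tuple RR) : R :=
  \sum_(i < n) cb.1 i * tnth t i + cb.2.

Lemma measurable_affine cb : measurable_fun setT (affine cb).
Proof.
apply: measurable_funD => //; apply: measurable_sum => i.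
by apply: measurable_funM => //; exact: measurable_tnth.
Qed.

Lemma affine_sum k l : exists s, forall x, affine s x = affine k x + affine l x.
Proof.
exists (fun i => k.1 i + l.1 i, k.2 + l.2) => x; rewrite /affine /=.
under eq_bigr do rewrite mulrDl.
by rewrite big_split/= addrACA.
Qed.

Lemma affine_diff k l : exists s, forall x, affine s x = affine k x - affine l x.
Proof.
exists (fun i => k.1 i - l.1 i, k.2 - l.2) => x; rewrite /affine /=.
under eq_bigr do rewrite mulrBl.
by rewrite sumrB opprD addrACA.
Qed.

Variables m1 m2 : probability (n.-tuple RR) R.
Hypothesis fourier : forall c b,
  \int[m1]_t cos (affine (c, b) t) = \int[m2]_t cos (affine (c, b) t).

Let mult := multiplier m1 m2 affine.

Lemma mult_trigstep k i (a : R) : mult (fun t => trigstep k (tnth t i - a)).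
Proof.
have mD := @multiplierD _ _ _ m1 m2 _ affine measurable_affine.
have mM := @multiplierM _ _ _ m1 m2 _ affine.
have mX := @multiplierX _ _ _ m1 m2 _ affine measurable_affine.
have mC := @multiplier_cst _ _ _ m1 m2 _ affine measurable_affine.
have comp g : mult g -> mult (fun t => 1 - g t).
  move=> mg; have := mD _ _ (mC 1) (mM _ _ (mC (-1)) mg).
  by under [in X in X -> _]eq_fun do rewrite mulN1r.
apply: (comp _ (mX _ _ (comp _ (mX _ _ _)))); rewrite /wavestep.
(* The phase depends on coordinate i alone, with slope 1 / k; the offset - pi / 2 turns the sine of
   [wavestep] into a cosine. *)
have := mM _ _ (mD _ _ (mC 1) (multiplier_cos m1 m2 measurable_affine affine_sum affine_diff
  (fun j => (if j == i then k%:R^-1 else 0), (- a - k%:R^-1) / k%:R - pi / 2))) (mC 2^-1).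
congr (mult _); apply/funext => t; congr ((1 + _) / 2).
rewrite -cosBpihalf; congr cos; rewrite /affine/= (bigD1 i)//= eqxx big1 ?addr0; last first.
  by move=> j /negPf ->; rewrite mul0r.
by ring.
Qed.

Lemma mult_step i (a : R) : mult (fun t => (a < tnth t i)%R%:R).
Proof.
apply: (@multiplier_limit _ _ _ m1 m2 _ affine measurable_affine
  (fun k t => trigstep k (tnth t i - a))).
- by move=> k; exact: mult_trigstep.
- by move=> k t; have /andP[h0 h1] := trigstep01 k (tnth t i - a); rewrite ger0_norm.
- rewrite (_ : (fun _ => _) = \1_[set t : n.-tuple RR | a < tnth t i]); last first.
    apply/funext => t; rewrite indicE.
    suff -> : (t \in [set t : n.-tuple RR | a < tnth t i]) = (a < tnth t i) by [].
    by apply/idP/idP; rewrite inE.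
  apply: measurable_indic.
  rewrite (_ : [set _ | _] = (fun t : n.-tuple RR => tnth t i) @^-1` `]a, +oo[%classic).
    by rewrite -[X in measurable X]setTI; apply: measurable_tnth => //; exact: measurable_itv.
  by apply/seteqP; split=> t /=; rewrite in_itv/= andbT.
- by move=> t; have := @cvg_trigstep R (tnth t i - a); rewrite subr_gt0.
Qed.

Lemma cramer_wold A : measurable A -> m1 A = m2 A.
Proof.
apply: tuple_measure_unique; first by rewrite [X in (X < _)%E]probability_setT ltry.
move=> a.
have H (r : seq 'I_n) : mult (fun t => \prod_(i <- r) (a i < tnth t i)%R%:R).
  elim: r => [|i r IH].
    have := @multiplier_cst _ _ _ m1 m2 _ affine measurable_affine 1.
    by under [in X in _ -> X]eq_fun do rewrite big_nil.
  have := @multiplierM _ _ _ m1 m2 _ affine _ _ (mult_step i (a i)) IH.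
  by under [in X in _ -> X]eq_fun do rewrite big_cons.
have s1 : same m1 m2 affine (fun=> 1).
  split; first exact: bmeas_cst.
  by move=> [c b]; under eq_Rintegral do rewrite mul1r; rewrite fourier; under [RHS]eq_Rintegral do rewrite mul1r.
(* By hypothesis the constant 1 has equal trigonometric integrals. Multiplied by the indicator of an
   orthant and read at the zero phase, it yields equal measures of the orthant. *)
have [_ K] := proj2 (H (enum 'I_n)) _ s1.
apply: (eq_trans (Rint_indic m1 (measurable_hbox a))).
apply: (eq_trans _ (esym (Rint_indic m2 (measurable_hbox a)))); congr EFin.
have := K ((fun=> 0), 0).
have E t : 1 * \prod_(i <- enum 'I_n) (a i < tnth t i)%R%:R * cos (affine ((fun=> 0), 0) t) = \1_(hbox a) t.
  have -> : affine ((fun=> 0), 0) t = 0.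
    by rewrite /affine/= big1 ?addr0// => i _; rewrite mul0r.
  rewrite mul1r cos0 mulr1.
  rewrite indicE big_enum/=; have [|h] := boolP (t \in hbox a).
    by rewrite inE => /hboxP h; rewrite big1// => i _; rewrite h.
  have [i hi] : exists i, ~~ (a i < tnth t i).
    by move: h; rewrite notin_setE => /hboxP/existsNP[i /negP hi]; exists i.
  by rewrite (bigD1 i)//= (negPf hi) mul0r.
by under eq_Rintegral do rewrite E; under [in X in _ = X -> _]eq_Rintegral do rewrite E.
Qed.

End CramerWold.

(** * Gaussian vectors as linear images of independent normals *)

Section NormalTuples.
Variable R : realType.
Local Notation RR := (measurableTypeR R).

Definition normals (r : nat -> R) (i : nat) : probability RR R := normal_prob 0 (r i).

Lemma measurable_lin n (c : nat -> R) (b : R) :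
  measurable_fun setT (fun z : n.-tuple RR => \sum_(i < n) c i * tnth z i + b).
Proof.
apply: measurable_funD => //; apply: measurable_sum => i.
by apply: measurable_funM => //; exact: measurable_tnth.
Qed.

Lemma lin_tcons n (c : nat -> R) (x : R) (y : n.-tuple RR) :
  \sum_(i < n.+1) c i * tnth (tcons (x, y)) i =
  c 0%N * x + \sum_(i < n) c i.+1 * tnth y i.
Proof.
rewrite big_ord_recl; congr (_ * _ + _).
by apply: eq_bigr => i _; rewrite tnthS.
Qed.

Lemma bmeas_cos_lin n (c : nat -> R) (b : R) :
  bmeas (fun z : n.-tuple RR => cos (\sum_(i < n) c i * tnth z i + b)).
Proof.
split; last by exists 1 => z; exact: cos_max.
exact: (measurableT_comp (continuous_measurable_fun (@continuous_cos R)) (measurable_lin c b)).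
Qed.

Lemma bmeas_cos_affine (c b : R) : bmeas (fun x : RR => cos (c * x + b)).
Proof.
split; last by exists 1 => z; exact: cos_max.
apply: (measurableT_comp (continuous_measurable_fun (@continuous_cos R))).
by apply: measurable_funD => //; exact: measurable_funM.
Qed.

Lemma normals_fourier n (r c : nat -> R) (b : R) : (forall i, r i != 0) ->
  \int[tprod n (normals r)]_z cos (\sum_(i < n) c i * tnth z i + b) =
  cos b * expR (- ((\sum_(i < n) c i ^+ 2 * r i ^+ 2) / 2)).
Proof.
elim: n r c b => [|n IH] r c b r0.
  rewrite /= (Rint_dirac _ (bmeas_cos_lin _ c b)) !big_ord0 add0r mul0r oppr0 expR0.
  by rewrite mulr1.
rewrite (tprodS (normals r) (bmeas_cos_lin _ c b)).
have E (x : R) : \int[tprod n (normals r \o succn)]_y cos (\sum_(i < n.+1) c i * tnth (tcons (x, y)) i + b)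
   = expR (- ((\sum_(i < n) c i.+1 ^+ 2 * r i.+1 ^+ 2) / 2)) * cos (c 0%N * x + b).
  rewrite mulrC -(IH (r \o succn) (c \o succn)); last by move=> i; exact: r0.
  by apply: eq_Rintegral => y _; rewrite lin_tcons addrAC addrC addrA; congr cos; rewrite addrAC addrC addrA.
transitivity (\int[normal_prob 0 (r 0%N)]_x
   (expR (- ((\sum_(i < n) c i.+1 ^+ 2 * r i.+1 ^+ 2) / 2)) * cos (c 0%N * x + b))).
  by apply: eq_Rintegral => x _; exact: E.
rewrite (RintZ _ _ (bmeas_cos_affine _ _)) normal_fourier// mulrCA -expRD.
by rewrite big_ord_recl; congr (_ * expR _); field.
Qed.

Lemma normal_quadratic (d e r : R) : r != 0 ->
  (\int[normal_prob 0 r]_x ((d * x + e) ^+ 2)%:E = (d ^+ 2 * r ^+ 2 + e ^+ 2)%:E)%E.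
Proof.
move=> r0.
have I1 : (normal_prob 0 r).-integrable setT (EFin \o (fun x : R => x - 0)).
  apply: normal_integrable => //; first exact: measurable_funB.
  by move=> x; exact: norm_le_1sqr.
have I2 : (normal_prob 0 r).-integrable setT (EFin \o (fun x : R => (x - 0) ^+ 2)).
  apply: normal_integrable => //; first by apply: measurable_funX; exact: measurable_funB.
  by move=> x; rewrite ger0_norm ?sqr_ge0// lerDr.
have E1 : (\int[normal_prob 0 r]_x (x - 0)%:E = 0)%E.
  by rewrite -[RHS](congr1 EFin (normal_mean0 0 r0)) /Rintegral fineK//; exact: integrable_fin_num.
have E2 : (\int[normal_prob 0 r]_x ((x - 0) ^+ 2)%:E = (r ^+ 2)%:E)%E.
  by rewrite -[in RHS](normal_var 0 r0) /Rintegral fineK//; exact: integrable_fin_num.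
have J2 := integrableZl measurableT (d ^+ 2) I2.
have J1 := integrableZl measurableT (2 * d * e) I1.
have J0 : (normal_prob 0 r).-integrable setT (fun=> (e ^+ 2)%:E).
  exact: (bmeas_integrable (normal_prob 0 r : probability RR R) (bmeas_cst _ (e ^+ 2))).
transitivity (\int[normal_prob 0 r]_x (((d ^+ 2)%:E * ((x - 0) ^+ 2)%:E + (2 * d * e)%:E * (x - 0)%:E) + (e ^+ 2)%:E))%E.
  by apply: eq_integral => x _; rewrite -!EFinM -!EFinD; congr EFin; ring.
rewrite integralD//; last exact: integrableD.
rewrite integralD// integralZl// integralZl// E1 E2 mule0 adde0 integral_cst//.
by rewrite [X in (_ + _ * X)%E]probability_setT mule1 -EFinM -EFinD.
Qed.

(** The cross terms vanish because the coordinates are centred. The square is unbounded, so the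
    recursion uses Tonelli's theorem with extended real values. *)
Lemma normals_quadratic n (r d : nat -> R) (e : R) : (forall i, r i != 0) ->
  (\int[tprod n (normals r)]_z ((\sum_(i < n) d i * tnth z i + e) ^+ 2)%:E =
   (\sum_(i < n) d i ^+ 2 * r i ^+ 2 + e ^+ 2)%:E)%E.
Proof.
have mq k (c : nat -> R) e' : measurable_fun setT (fun z : k.-tuple RR =>
    ((\sum_(i < k) c i * tnth z i + e') ^+ 2)%:E).
  by apply/measurable_EFinP; apply: measurable_funX; exact: measurable_lin.
elim: n r d e => [|n IH] r d e r0.
  rewrite [LHS]integral_dirac//; last exact: mq.
  by rewrite [X in (X * _)%E]diracT mul1e !big_ord0 !add0r.
rewrite [tprod _ _]/= ge0_integral_distribution; last 2 first.
- exact: mq.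
- by move=> y; rewrite lee_fin sqr_ge0.
rewrite fubini_tonelli1; last 2 first.
- by apply: (measurableT_comp (mq _ _ _)); exact: measurable_tcons.
- by move=> y; rewrite lee_fin sqr_ge0.
rewrite /fubini_F /=.
transitivity (\int[normal_prob 0 (r 0%N)]_x ((\sum_(i < n) d i.+1 ^+ 2 * r i.+1 ^+ 2)%:E +
    ((d 0%N * x + e) ^+ 2)%:E))%E.
  apply: eq_integral => x _; rewrite -EFinD -(IH (r \o succn) (d \o succn)); last by move=> i; exact: r0.
  by apply: eq_integral => y _; rewrite lin_tcons addrAC addrC.
rewrite ge0_integralD//; first last.
- apply/measurable_EFinP; apply: measurable_funX; apply: measurable_funD => //.
- by move=> x _; rewrite lee_fin sqr_ge0.
- move=> x _; rewrite lee_fin sumr_ge0// => i _; exact: mulr_ge0 (sqr_ge0 _) (sqr_ge0 _).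
rewrite normal_quadratic// integral_cst// [X in (_ * X)%E]probability_setT mule1.
by rewrite -EFinD big_ord_recl; congr EFin => /=; ring.
Qed.

Section LinearImage.
Variables (K N : nat) (A : nat -> nat -> R).

Definition linmap (z : K.-tuple RR) : N.-tuple RR :=
  [tuple \sum_(q < K) A q i * tnth z q | i < N].

Lemma measurable_linmap : measurable_fun setT linmap.
Proof.
apply/measurable_fun_tnthP => i.
rewrite (_ : _ \o _ = fun z => \sum_(q < K) A q i * tnth z q + 0).
  exact: (measurable_lin (fun q => A q i)).
by apply/funext => z; rewrite /= tnth_mktuple addr0.
Qed.

HB.instance Definition _ := isMeasurableFun.Build _ _ _ _ linmap measurable_linmap.

Lemma linmap_fourier (r : nat -> R) (c : 'I_N -> R) (b : R) : (forall i, r i != 0) ->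
  \int[distribution (tprod K (normals r)) linmap]_t cos (affine (c, b) t) =
  cos b * expR (- ((\sum_(i < N) \sum_(j < N) c i * c j *
                     \sum_(q < K) r q ^+ 2 * (A q i * A q j)) / 2)).
Proof.
move=> r0; rewrite Rint_distribution; last first.
  split; last by exists 1 => z; exact: cos_max.
  exact: (measurableT_comp (continuous_measurable_fun (@continuous_cos R)) (measurable_affine (c, b))).
pose cA q := \sum_(i < N) c i * A q i.
transitivity (\int[tprod K (normals r)]_z cos (\sum_(q < K) cA q * tnth z q + b)).
  apply: eq_Rintegral => z _; congr (cos (_ + _)); rewrite /=.
  under eq_bigr do rewrite tnth_mktuple mulr_sumr.
  rewrite exchange_big/=; apply: eq_bigr => q _; rewrite /cA mulr_suml.
  by apply: eq_bigr => i _; rewrite mulrA.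
rewrite normals_fourier//; congr (_ * expR (- (_ / 2))).
under [RHS]eq_bigr do under eq_bigr do rewrite mulr_sumr.
under [RHS]eq_bigr do rewrite exchange_big/=.
rewrite [RHS]exchange_big/=; apply: eq_bigr => q _.
rewrite expr2 /cA mulr_suml mulr_suml; apply: eq_bigr => i _.
rewrite mulr_sumr mulr_suml; apply: eq_bigr => j _; ring.
Qed.

End LinearImage.

End NormalTuples.

Section GaussianLaw.
Context d (T : measurableType d) (R : realType).
Variable P : probability T R.
Local Notation RR := (measurableTypeR R).

Lemma law_transfer_integrable (Z : {mfun T >-> RR}) (nu : probability RR R) (f : RR -> R) :
  (forall A, measurable A -> pushforward P Z A = nu A) -> measurable_fun setT f ->
  nu.-integrable setT (EFin \o f) -> P.-integrable setT (EFin \o (f \o Z)).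
Proof.
move=> H mf /integrableP[_ i]; apply/integrableP; split.
  by apply/measurable_EFinP; exact: measurableT_comp.
have mf' : measurable_fun setT (fun x : RR => `|f x|%:E).
  by apply/measurable_EFinP; exact: measurableT_comp.
have := @ge0_integral_distribution _ _ _ _ _ P Z (fun x => `|f x|%:E) mf' (fun x => normr_ge0 (f x)).
move=> e; rewrite (_ : (\int[P]_x _)%E = (\int[distribution P Z]_x `|f x|%:E)%E); last by rewrite e.
apply: le_lt_trans i; rewrite le_eqVlt; apply/orP; left; apply/eqP.
by apply: eq_measure_integral => A mA _; exact: H.
Qed.

Lemma law_transfer (Z : {mfun T >-> RR}) (nu : probability RR R) (f : RR -> R) :
  (forall A, measurable A -> pushforward P Z A = nu A) -> measurable_fun setT f ->
  nu.-integrable setT (EFin \o f) -> \int[P]_w f (Z w) = \int[nu]_x f x.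
Proof.
move=> H mf i; have iP := law_transfer_integrable H mf i.
rewrite /Rintegral; congr fine.
rewrite -(@integral_distribution _ _ _ _ _ P Z (EFin \o f))//; last exact/measurable_EFinP.
by apply: eq_measure_integral => A mA _; exact: H.
Qed.

(** A null s gives a point mass. Otherwise a zero mean forces m = 0, and the transform then depends
    on the second moment only. *)
Lemma gaussian_facts (Z : {mfun T >-> RR}) : gaussian P Z ->
  P.-integrable setT (fun w => (Z w ^+ 2)%:E) /\
  (\int[P]_w Z w = 0 -> forall b, \int[P]_w cos (Z w + b) =
     cos b * expR (- ((\int[P]_w (Z w ^+ 2)) / 2))).
Proof.
move=> [m [s H]].
have mid : measurable_fun setT (fun x : RR => x) by exact: measurable_id.
have m2 : measurable_fun setT (fun x : RR => x ^+ 2) by exact: measurable_funX.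
have mc b : measurable_fun setT (fun x : RR => cos (x + b)).
  by apply: (measurableT_comp (continuous_measurable_fun (@continuous_cos R))); exact: measurable_funD.
have [s0|s0] := eqVneq s 0.
  have Hd A : measurable A -> pushforward P Z A = (\d_(m : RR) : probability RR R) A.
    by move=> mA; have := H A mA; rewrite s0 eqxx.
  have id_ (f : RR -> R) : measurable_fun setT f ->
      (\d_(m : RR) : probability RR R).-integrable setT (EFin \o f).
    move=> mf; apply/integrableP; split; first exact/measurable_EFinP.
    rewrite integral_dirac//; last by apply/measurable_EFinP; exact: measurableT_comp.
    by rewrite [X in (X * _)%E]diracT mul1e ltry.
  have Rd (f : RR -> R) : measurable_fun setT f -> \int[P]_w f (Z w) = f m.
    move=> mf; rewrite (law_transfer Hd mf (id_ _ mf)) /Rintegral integral_dirac//.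
      by rewrite [X in (X * _)%E]diracT mul1e.
    exact/measurable_EFinP.
  split; first exact: (law_transfer_integrable Hd m2 (id_ _ m2)).
  rewrite (Rd _ mid) => m0 b; rewrite (Rd _ (mc b)) (Rd _ m2) m0.
  by rewrite add0r expr0n/= mul0r oppr0 expR0 mulr1.
have Hn A : measurable A -> pushforward P Z A = (normal_prob m s : probability RR R) A.
  by move=> mA; have := H A mA; rewrite (negPf s0).
have i1 : (normal_prob m s : probability RR R).-integrable setT (EFin \o (fun x : R => x - m)).
  apply: normal_integrable => //; first exact: measurable_funB.
  by move=> x; exact: norm_le_1sqr.
have i2 : (normal_prob m s : probability RR R).-integrable setT (EFin \o (fun x : R => (x - m) ^+ 2)).
  apply: normal_integrable => //; first by apply: measurable_funX; exact: measurable_funB.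
  by move=> x; rewrite ger0_norm ?sqr_ge0// lerDr.
have ic c := bmeas_integrable (normal_prob m s : probability RR R) (bmeas_cst _ c).
have iid : (normal_prob m s : probability RR R).-integrable setT (EFin \o (fun x : R => x)).
  have := integrableD measurableT i1 (ic m); apply: eq_integrable => // x _.
  by rewrite /= -EFinD subrK.
have isq : (normal_prob m s : probability RR R).-integrable setT (EFin \o (fun x : R => x ^+ 2)).
  have := integrableD measurableT (integrableD measurableT i2
     (integrableZl measurableT (2 * m) i1)) (ic (m ^+ 2)).
  by apply: eq_integrable => // x _ /=; congr EFin; ring.
split; first exact: (law_transfer_integrable Hn m2 isq).
rewrite (law_transfer Hn mid iid) => mean0.
have m0 : m = 0.
  have := normal_mean0 m s0; rewrite (RintegralB measurableT iid (ic m)).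
  by rewrite mean0 (Rint_cst (normal_prob m s : probability RR R)) sub0r => /eqP; rewrite oppr_eq0 => /eqP.
move=> b; have bc : bmeas (fun x : RR => cos (x + b)).
  by split; [exact: mc|exists 1 => x; exact: cos_max].
rewrite (law_transfer Hn (mc b) (bmeas_integrable _ bc)) (law_transfer Hn m2 isq) m0.
have := normal_fourier b s0 1; rewrite expr1n mul1r => e.
have -> : \int[normal_prob 0 s]_x (x ^+ 2) = s ^+ 2.
  rewrite -[RHS](normal_var 0 s0); apply: eq_Rintegral => x _; by rewrite subr0.
by rewrite -e; apply: eq_Rintegral => x _; rewrite mul1r.
Qed.

Lemma Rint_sum (I : Type) (s : seq I) (f : I -> T -> R) :
  (forall i, P.-integrable setT (EFin \o f i)) ->
  \int[P]_w (\sum_(i <- s) f i w) = \sum_(i <- s) \int[P]_w f i w.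
Proof.
move=> fi; elim: s => [|i s IH].
  rewrite big_nil; under eq_Rintegral do rewrite big_nil.
  exact: Rint_cst.
rewrite big_cons -IH -RintegralD//.
  by apply: eq_Rintegral => w _; rewrite big_cons.
rewrite (_ : _ \o _ = fun w => (\sum_(j <- s) (EFin \o f j) w)%E).
  by apply: integrable_sum => //.
by apply/funext => w /=; rewrite sumEFin.
Qed.

Definition random_tuple N (Z : 'I_N -> {mfun T >-> R}) (w : T) : N.-tuple RR :=
  [tuple Z i w | i < N].

Lemma measurable_random_tuple N (Z : 'I_N -> {mfun T >-> R}) :
  measurable_fun setT (random_tuple Z).
Proof.
apply/measurable_fun_tnthP => i.
rewrite (_ : _ \o _ = Z i); first exact: (measurable_funPT (Z i)).
by apply/funext => w; rewrite /= tnth_mktuple.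
Qed.

HB.instance Definition _ N (Z : 'I_N -> {mfun T >-> R}) :=
  isMeasurableFun.Build _ _ _ _ (random_tuple Z) (measurable_random_tuple Z).

Lemma integrable_prod_sqr (X Y : {mfun T >-> R}) :
  P.-integrable setT (fun w => (X w ^+ 2)%:E) ->
  P.-integrable setT (fun w => (Y w ^+ 2)%:E) ->
  P.-integrable setT (fun w => (X w * Y w)%:E).
Proof.
move=> iX iY; apply: (le_integrable _ _ _ (integrableD measurableT iX iY)) => //.
  by apply/measurable_EFinP; exact: measurable_funM.
move=> w _; rewrite /= lee_fin (ger0_norm (addr_ge0 (sqr_ge0 _) (sqr_ge0 _))).
rewrite ler_norml; have := sqr_ge0 (X w + Y w); have := sqr_ge0 (X w - Y w).
have := sqr_ge0 (X w); have := sqr_ge0 (Y w) => *.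
by apply/andP; split; lra.
Qed.

(** Equal covariances give every linear combination the same variance, hence equal characteristic
    functions. No inverse covariance occurs, so degenerate coordinates such as the value at time 0
    are covered. *)
Lemma gaussian_vector_law N (Z : 'I_N -> {mfun T >-> R}) K (A : nat -> nat -> R) (r : nat -> R) :
  (forall c : 'I_N -> R, gaussian P (fun w => \sum_(i < N) c i * Z i w)) ->
  (forall i, \int[P]_w Z i w = 0) ->
  (forall i j, \int[P]_w (Z i w * Z j w) = \sum_(q < K) r q ^+ 2 * (A q i * A q j)) ->
  (forall q, r q != 0) ->
  forall B, measurable B ->
  distribution P (random_tuple Z) B = distribution (tprod K (normals r)) (@linmap R K N A) B.
Proof.
move=> gZ Z0 ZZ r0.
have mlin (c : 'I_N -> R) : @measurable_fun _ _ T RR setT (fun w => \sum_(i < N) c i * Z i w : RR).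
  by apply: measurable_sum => i; exact: measurable_funM.
have iZ2 i : P.-integrable setT (fun w => (Z i w ^+ 2)%:E).
  have mZi : @measurable_fun _ _ T RR setT (Z i) by exact: (measurable_funPT (Z i)).
  pose Zi : {mfun T >-> RR} := @mfun_Sub _ _ T RR _ (mem_set mZi).
  have g : gaussian P Zi.
    have := gZ (fun j => (j == i)%:R).
    congr (gaussian P _); apply/funext => w /=; rewrite (bigD1 i)//= eqxx mul1r big1 ?addr0// => j /negPf ->.
    by rewrite mul0r.
  by have [] := gaussian_facts g.
have iZ i : P.-integrable setT (EFin \o Z i).
  have := integrableD measurableT (bmeas_integrable P (bmeas_cst _ 1)) (iZ2 i).
  apply: le_integrable => //; first exact/measurable_EFinP.
  move=> w _; rewrite /= lee_fin [leRHS]ger0_norm ?addr_ge0 ?sqr_ge0//.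
  exact: norm_le_1sqr.
apply: cramer_wold => c b; rewrite linmap_fourier// Rint_distribution; last first.
  split; last by exists 1 => z; exact: cos_max.
  exact: (measurableT_comp (continuous_measurable_fun (@continuous_cos R)) (measurable_affine (c, b))).
pose Zc : {mfun T >-> RR} := @mfun_Sub _ _ T RR _ (mem_set (mlin c)).
have gZc : gaussian P Zc by exact: gZ.
have E w : affine (c, b) (random_tuple Z w) = Zc w + b.
  by rewrite /affine /=; congr (_ + _); apply: eq_bigr => i _; rewrite tnth_mktuple.
have [_ H] := gaussian_facts gZc.
under eq_Rintegral do rewrite E.
rewrite H.
  congr (_ * expR (- (_ / 2))).
  have icc i j := integrableZl measurableT (c i * c j) (integrable_prod_sqr (iZ2 i) (iZ2 j)).
  transitivity (\int[P]_w (\sum_(i < N) \sum_(j < N) c i * c j * (Z i w * Z j w))).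
    apply: eq_Rintegral => w _; rewrite /= expr2 mulr_suml; apply: eq_bigr => i _.
    by rewrite mulr_sumr; apply: eq_bigr => j _; ring.
  rewrite Rint_sum; last first.
    move=> i; rewrite (_ : _ \o _ = fun w => (\sum_(j < N) ((c i * c j)%:E * (Z i w * Z j w)%:E))%E).
      by apply: integrable_sum => //.
    by apply/funext => w /=; rewrite sumEFin.
  apply: eq_bigr => i _; rewrite Rint_sum; last by move=> j; exact: icc.
  apply: eq_bigr => j _; rewrite RintegralZl//; last exact: integrable_prod_sqr.
  by rewrite ZZ.
transitivity (\int[P]_w (\sum_(i < N) c i * Z i w)); first by [].
rewrite Rint_sum; last by move=> i; exact: (integrableZl measurableT (c i) (iZ i)).
by rewrite big1// => i _; rewrite RintegralZl// Z0 mulr0.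
Qed.

End GaussianLaw.

(** * Hellinger regularity of the noise in the signal value *)

Section AffineChange.
Variable R : realType.
Local Notation RR := (measurableTypeR R).
Notation mu := (@lebesgue_measure R).

Definition shiftscale (x s : R) (u : RR) : RR := x + s * u.

Lemma measurable_shiftscale x s : measurable_fun setT (shiftscale x s).
Proof. by apply: measurable_funD => //; exact: measurable_funM. Qed.

HB.instance Definition _ x s :=
  isMeasurableFun.Build _ _ _ _ (shiftscale x s) (measurable_shiftscale x s).

(** Uniqueness of Lebesgue measure: the rescaled image measure has the right value on half-open
    intervals. *)
Lemma lebesgue_affine (x s : R) (A : set R) : 0 < s -> measurable A ->
  mu A = (s%:E * mu (shiftscale x s @^-1` A))%E.
Proof.
move=> s0 mA.
have s0' : 0 <= s by exact: ltW.
pose m1 : {measure set RR -> \bar R} :=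
  measure_function_pushforward__canonical__measure_function_Measure mu (measurable_shiftscale x s).
pose m' : {measure set RR -> \bar R} := mscale (NngNum s0') m1.
transitivity (m' A); last by [].
apply: lebesgue_measure_unique => // _ [[c e] _ <-].
transitivity (s%:E * mu (shiftscale x s @^-1` `]c, e]%classic))%E; last by [].
have -> : shiftscale x s @^-1` `]c, e]%classic = `](c - x) / s, (e - x) / s]%classic.
  apply/seteqP; split=> u /=; rewrite !in_itv/= /shiftscale.
    by move=> /andP[h1 h2]; rewrite ltr_pdivrMr// ler_pdivlMr//; apply/andP; split; lra.
  by rewrite ltr_pdivrMr// ler_pdivlMr// => /andP[h1 h2]; apply/andP; split; lra.
rewrite lebesgue_measure_itv/= lebesgue_measure_itv/= !lte_fin ltr_pM2r ?invr_gt0// ltrD2r.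
case: ifPn => _; last by rewrite mule0.
by rewrite -!EFinB -EFinM; congr EFin; field; rewrite gt_eqF.
Qed.

Lemma integral_affine (x s : R) (g : R -> \bar R) : 0 < s -> measurable_fun setT g ->
  (forall y, 0 <= g y)%E ->
  (\int[mu]_y g y = s%:E * \int[mu]_u g (x + s * u)%R)%E.
Proof.
move=> s0 mg g0; have s0' : 0 <= s by exact: ltW.
pose m1 : {measure set RR -> \bar R} :=
  measure_function_pushforward__canonical__measure_function_Measure mu (measurable_shiftscale x s).
pose m' : {measure set RR -> \bar R} := mscale (NngNum s0') m1.
rewrite (@eq_measure_integral _ _ _ _ m'); last first.
  by move=> A mA _; exact: lebesgue_affine.
rewrite ge0_integral_mscale//; congr (_ * _)%E.
by rewrite ge0_integral_pushforward.
Qed.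

End AffineChange.

Section NoiseHellinger.
Variable R : realType.
Local Notation RR := (measurableTypeR R).
Notation mu := (@lebesgue_measure R).
Variables (v v1 a a1 : R -> R) (am L M : R) (nu : probability RR R).
Hypothesis dv : forall u : R, is_derive u 1 v (v1 u).
Hypothesis cv1 : continuous v1.
Hypothesis da : forall x : R, is_derive x 1 a (a1 x).
Hypothesis ca1 : continuous a1.
Hypotheses (am0 : 0 < am) (aam : forall x, am <= a x) (a1L : forall x, `|a1 x| <= L).
Hypothesis nuE : forall A, measurable A -> nu A = (\int[mu]_(x in A) (expR (- v x))%:E)%E.
Hypothesis M0 : 0 <= M.
Hypothesis score : (\int[mu]_u (v1 u ^+ 2 * (1 + u ^+ 2) * expR (- v u))%:E <= M%:E)%E.

Let a0 x : 0 < a x. Proof. exact: lt_le_trans (aam x). Qed.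
Let an0 x : a x != 0. Proof. by rewrite gt_eqF. Qed.

Let contv : continuous v.
Proof.
by move=> u; have [d _] := dv u; apply: differentiable_continuous; exact/derivable1_diffP.
Qed.

Let conta : continuous a.
Proof.
by move=> u; have [d _] := da u; apply: differentiable_continuous; exact/derivable1_diffP.
Qed.

Let mp : measurable_fun setT (fun u : R => expR (- v u)).
Proof.
by apply: (measurableT_comp (continuous_measurable_fun (@continuous_expR R)));
  apply: measurableT_comp => //; exact: continuous_measurable_fun.
Qed.

Let mv1 : measurable_fun setT v1. Proof. exact: continuous_measurable_fun. Qed.

Definition noisy_density (x y : R) : R := expR (- v ((y - x) / a x)) / a x.

Let mres x : measurable_fun setT (fun y : R => (y - x) / a x).
Proof. by apply: measurable_funM => //; exact: measurable_funB. Qed.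

Lemma measurable_noisy_density x : measurable_fun setT (noisy_density x).
Proof. by apply: measurable_funM => //; exact: (measurableT_comp mp (mres x)). Qed.

Lemma noisy_density_ge0 x y : 0 <= noisy_density x y.
Proof. by rewrite divr_ge0 ?expR_ge0// ltW. Qed.

Definition noisy (x : R) : probability RR R := distribution nu (shiftscale x (a x)).

Lemma noisy_densityE x A : measurable A ->
  noisy x A = (\int[mu]_(y in A) (noisy_density x y)%:E)%E.
Proof.
move=> mA; have mB : measurable (shiftscale x (a x) @^-1` A).
  by rewrite -[X in measurable X]setTI; exact: measurable_shiftscale.
apply: (eq_trans (nuE mB)).
rewrite [LHS]integral_mkcond [RHS]integral_mkcond.
rewrite [RHS](integral_affine x (a0 x)); first last.
- by move=> y; rewrite /restrict; case: ifPn => // _; rewrite lee_fin noisy_density_ge0.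
- apply/(measurable_restrictT _ _).1 => //.
  by apply/measurable_funTS/measurable_EFinP; exact: measurable_noisy_density.
rewrite -ge0_integralZl//; last 3 first.
- apply: (measurableT_comp _ (measurable_shiftscale x (a x))).
  apply/(measurable_restrictT _ _).1 => //.
  by apply/measurable_funTS/measurable_EFinP; exact: measurable_noisy_density.
- by move=> y _; rewrite /restrict; case: ifPn => // _; rewrite lee_fin noisy_density_ge0.
- by rewrite lee_fin ltW.
apply: eq_integral => u _; rewrite /restrict.
have -> : (u \in shiftscale x (a x) @^-1` A) = (x + a x * u \in A).
  by apply/idP/idP; rewrite !inE.
case: ifPn => _; last by rewrite mule0.
rewrite -EFinM /noisy_density; congr EFin.
have -> : (x + a x * u - x) / a x = u by field.
by field.
Qed.

(** The square root of the density of x + a(x) xi at y, written as an exponential to make it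
    differentiable in x by the chain rule. *)
Let g (x y : R) : R := expR (- (v ((y - x) / a x) + ln (a x)) / 2).

Let gE x y : g x y = Num.sqrt (noisy_density x y).
Proof.
have e : g x y ^+ 2 = noisy_density x y.
  rewrite /g expr2 -expRD -mulrDl -mulr2n -[X in expR (X / 2)]mulr_natr mulfK//.
  by rewrite opprD expRD (expRN (ln _)) lnK ?posrE.
by rewrite -e sqrtr_sqr ger0_norm ?expR_ge0.
Qed.

Let g1 (y x : R) : R := g x y *
  ((v1 ((y - x) / a x) * (1 + (y - x) / a x * a1 x) / a x - a1 x / a x) / 2).

Let dg (y x : R) : is_derive x 1 (fun x => g x y) (g1 y x).
Proof.
have hinv : is_derive x 1 (fun x => (a x)^-1) (- (a x) ^- 2 * a1 x).
  have := is_deriveV (an0 x) (da x).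
  by [].
have hlin : is_derive x 1 (fun x : R => y - x) (-1 : R).
  by apply: is_derive_eq; rewrite add0r mul1r.
have hres : is_derive x 1 (fun x => (y - x) / a x)
    ((y - x) * (- (a x) ^- 2 * a1 x) + (a x)^-1 * -1).
  exact: (is_deriveM hlin hinv).
have hv := @is_derive1_comp _ v (fun x => (y - x) / a x) x _ _ (dv _) hres.
have hl := @is_derive1_comp _ (@ln R) a x _ _ (is_derive1_ln (a0 x)) (da x).
have hs := is_deriveD hv hl.
have hz := is_deriveZ (- 2^-1) hs.
have eN (A B : R) : - 2^-1 *: (A + B) = - (A + B) / 2 by rewrite /GRing.scale/= mulrC mulrN mulNr.
have hw : is_derive x 1 (fun t => - (v ((y - t) / a t) + ln (a t)) / 2)
    (- 2^-1 *: (((y - x) * (- (a x) ^- 2 * a1 x) + (a x)^-1 * -1) * v1 ((y - x) / a x)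
       + a1 x * (a x)^-1)).
  rewrite (_ : (fun t => _) = - 2^-1 \*: ((v \o (fun t => (y - t) / a t)) + (@ln R \o a))); last first.
    by apply/funext => t; rewrite -eN.
  by apply: (is_derive_eq hz); congr (_ *: (_ + _)); rewrite mulrC.
have he := @is_derive1_comp _ (@expR R) _ x _ _ (is_derive_expR _) hw.
apply: (is_derive_eq he); rewrite /g1; congr (_ * _).
by rewrite eN; field.
Qed.

Let res_cont (y : R) : continuous (fun x : R => (y - x) / a x).
Proof.
move=> x; apply: cvgM; first by apply: cvgB; [exact: cvg_cst|exact: cvg_id].
by apply: cvgV => //; exact: conta.
Qed.

Let g1_cont (y : R) : continuous (g1 y).
Proof.
have ai : continuous (fun x : R => (a x)^-1) by move=> x; apply: cvgV => //; exact: conta.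
move=> x; apply: cvgM.
  have [d _] := dg y x.
  exact: (differentiable_continuous (proj1 (derivable1_diffP _ _) d)).
apply: cvgM; last exact: cvg_cst.
apply: cvgB; last by apply: cvgM; [exact: ca1|exact: ai].
apply: cvgM; last exact: ai.
apply: cvgM; first by apply: (continuous_comp (@res_cont y x)); exact: cv1.
apply: cvgD; first exact: cvg_cst.
by apply: cvgM; [exact: res_cont|exact: ca1].
Qed.

Definition noise_const : R := (1 + L ^+ 2) / am ^+ 2.

(** Cauchy-Schwarz: (1 + u a')^2 <= (1 + u^2) (1 + a'^2). The weight 1 + u^2 in the score moment
    answers to the dependence of the noise scale on x. *)
Let g1_sqr y x : g1 y x ^+ 2 <= noise_const * (noisy_density x y *
   (v1 ((y - x) / a x) ^+ 2 * (1 + ((y - x) / a x) ^+ 2) + 1)).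
Proof.
rewrite /g1 exprMn gE sqr_sqrtr ?noisy_density_ge0// [leRHS]mulrCA.
rewrite ler_wpM2l ?noisy_density_ge0//.
set u := (y - x) / a x; set w := v1 u.
have L1 : a1 x ^+ 2 <= L ^+ 2.
  by rewrite -[leLHS]real_normK ?num_real// lerXn2r ?nnegrE// (le_trans _ (a1L x)).
have A1 : (a x) ^- 2 <= (am ^+ 2)^-1.
  by rewrite lef_pV2 ?posrE ?exprn_gt0// lerXn2r ?nnegrE ?(ltW am0) ?(ltW (a0 x)).
have c1 : (1 + u * a1 x) ^+ 2 <= (1 + u ^+ 2) * (1 + L ^+ 2).
  have : (1 + u * a1 x) ^+ 2 <= (1 + u ^+ 2) * (1 + a1 x ^+ 2).
    by have := sqr_ge0 (u - a1 x); lra.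
  move=> /le_trans; apply; rewrite ler_wpM2l ?lerD2l// addr_ge0 ?sqr_ge0//.
have -> : (w * (1 + u * a1 x) / a x - a1 x / a x) / 2 =
   (w * (1 + u * a1 x) - a1 x) / 2 * (a x)^-1 by field.
rewrite exprMn exprVn /noise_const.
have q1 : ((w * (1 + u * a1 x) - a1 x) / 2) ^+ 2 <=
    (1 + L ^+ 2) * (w ^+ 2 * (1 + u ^+ 2) + 1).
  have h1 : w ^+ 2 * (1 + u * a1 x) ^+ 2 <= w ^+ 2 * ((1 + u ^+ 2) * (1 + L ^+ 2)).
    by rewrite ler_wpM2l ?sqr_ge0.
  have h2 : ((w * (1 + u * a1 x) - a1 x) / 2) ^+ 2 <= w ^+ 2 * (1 + u * a1 x) ^+ 2 + a1 x ^+ 2.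
    set k := 1 + u * a1 x.
    have := sqr_ge0 (w * k + a1 x); have := sqr_ge0 (w * k); have := sqr_ge0 (a1 x).
    by rewrite -[w ^+ 2 * k ^+ 2]exprMn; set t := w * k; lra.
  lra.
rewrite [leRHS]mulrAC; apply: ler_pM; [exact: sqr_ge0| |exact: q1|exact: A1].
by rewrite invr_ge0; exact: sqr_ge0.
Qed.

Let mg1 : measurable_fun setT (fun z : RR * RR => g1 z.2 z.1).
Proof.
have mres2 : measurable_fun setT (fun z : RR * RR => (z.2 - z.1) / a z.1).
  apply: measurable_funM; first by apply: measurable_funB.
  apply: (measurableT_comp (f := fun x : RR => (a x)^-1)) => //.
  by apply: continuous_measurable_fun => x; apply: cvgV => //; exact: conta.
have mai : measurable_fun setT (fun z : RR * RR => (a z.1)^-1).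
  apply: (measurableT_comp (f := fun x : RR => (a x)^-1)) => //.
  by apply: continuous_measurable_fun => x; apply: cvgV => //; exact: conta.
have ma1 : measurable_fun setT (fun z : RR * RR => a1 z.1).
  by apply: (measurableT_comp (continuous_measurable_fun ca1)).
apply: measurable_funM.
  apply: (measurableT_comp (continuous_measurable_fun (@continuous_expR R))).
  apply: measurable_funM => //; apply: measurableT_comp => //.
  apply: measurable_funD.
    by apply: (measurableT_comp (continuous_measurable_fun contv)).
  apply: (measurableT_comp (f := fun x : RR => ln (a x))) => //.
  apply: continuous_measurable_fun => x; apply: (continuous_comp (@conta x)).
  exact: continuous_ln.
apply: measurable_funM => //; apply: measurable_funB; last exact: measurable_funM.
apply: measurable_funM => //; apply: measurable_funM.
  exact: (measurableT_comp mv1).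
by apply: measurable_funD => //; exact: measurable_funM.
Qed.

(** Fisher information in the location x: the substitution y = x + a(x) u turns the bound of
    [g1_sqr] into the score moment plus the total mass 1, uniformly in x. *)
Let energy x : (\int[mu]_y (g1 y x ^+ 2)%:E <= (noise_const * (M + 1))%:E)%E.
Proof.
have K0 : 0 <= noise_const by rewrite divr_ge0 ?sqr_ge0// addr_ge0 ?sqr_ge0.
have ms : measurable_fun setT (fun u : R => v1 u ^+ 2 * (1 + u ^+ 2) * expR (- v u)).
  apply: measurable_funM => //; apply: measurable_funM; first exact: measurable_funX.
  by apply: measurable_funD => //; exact: measurable_funX.
have ms1 : measurable_fun setT (fun u : R => (v1 u ^+ 2 * (1 + u ^+ 2) + 1) * expR (- v u)).
  apply: measurable_funM => //; apply: measurable_funD => //; apply: measurable_funM; first exact: measurable_funX.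
  by apply: measurable_funD => //; exact: measurable_funX.
have p1 (u : R) : 0 <= v1 u ^+ 2 * (1 + u ^+ 2) by rewrite mulr_ge0 ?sqr_ge0// addr_ge0 ?sqr_ge0.
have E : (\int[mu]_y (noisy_density x y * (v1 ((y - x) / a x) ^+ 2 * (1 + ((y - x) / a x) ^+ 2) + 1))%:E
   <= (M + 1)%:E)%E.
  rewrite (integral_affine x (a0 x)); first last.
  - by move=> y; rewrite lee_fin mulr_ge0 ?noisy_density_ge0// addr_ge0.
  - apply/measurable_EFinP; apply: measurable_funM; first exact: measurable_noisy_density.
    apply: measurable_funD => //; apply: measurable_funM.
      by apply: measurable_funX; exact: (measurableT_comp mv1 (mres x)).
    by apply: measurable_funD => //; apply: measurable_funX; exact: mres.
  rewrite -ge0_integralZl//; last 3 first.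
  - apply/measurable_EFinP; apply: measurable_funM.
      exact: (measurableT_comp (measurable_noisy_density x) (measurable_shiftscale x (a x))).
    apply: measurable_funD => //; apply: measurable_funM.
      apply: measurable_funX; apply: (measurableT_comp mv1).
      exact: (measurableT_comp (mres x) (measurable_shiftscale x (a x))).
    apply: measurable_funD => //; apply: measurable_funX.
    exact: (measurableT_comp (mres x) (measurable_shiftscale x (a x))).
  - by move=> y _; rewrite lee_fin mulr_ge0 ?noisy_density_ge0// addr_ge0.
  - by rewrite lee_fin ltW.
  apply: (@le_trans _ _ (\int[mu]_u ((v1 u ^+ 2 * (1 + u ^+ 2) * expR (- v u))%:E + (expR (- v u))%:E))%E).
    rewrite le_eqVlt; apply/orP; left; apply/eqP; apply: eq_integral => u _.
    rewrite -EFinM -EFinD /noisy_density; congr EFin.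
    have -> : (x + a x * u - x) / a x = u by field.
    by field.
  rewrite ge0_integralD//; first last.
  - exact/measurable_EFinP.
  - exact/measurable_EFinP.
  - by move=> u _; rewrite lee_fin mulr_ge0 ?expR_ge0.
  rewrite EFinD; apply: leeD => //.
  by rewrite -(nuE measurableT) probability_setT.
apply: (@le_trans _ _ (noise_const%:E * (M + 1)%:E)%E); last by rewrite -EFinM.
apply: le_trans (lee_wpmul2l _ E); last by rewrite lee_fin.
rewrite -ge0_integralZl//; last 2 first.
- apply/measurable_EFinP; apply: measurable_funM; first exact: measurable_noisy_density.
  apply: measurable_funD => //; apply: measurable_funM.
    by apply: measurable_funX; exact: (measurableT_comp mv1 (mres x)).
  by apply: measurable_funD => //; apply: measurable_funX; exact: mres.
- by move=> y _; rewrite lee_fin mulr_ge0 ?noisy_density_ge0// addr_ge0.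
apply: ge0_le_integral => //.
- by move=> y _; rewrite lee_fin sqr_ge0.
- apply/measurable_EFinP; apply: measurable_funX.
  exact: (measurableT_comp mg1 (measurable_pair1 x)).
- apply/measurable_EFinP; apply: measurable_funM => //; apply: measurable_funM; first exact: measurable_noisy_density.
  apply: measurable_funD => //; apply: measurable_funM.
    by apply: measurable_funX; exact: (measurableT_comp mv1 (mres x)).
  by apply: measurable_funD => //; apply: measurable_funX; exact: mres.
- by move=> y _; rewrite -EFinM lee_fin g1_sqr.
Qed.

(** Cauchy-Schwarz along the segment, from g1^2 >= 2 m g1 - m^2 with m the mean slope: the right
    side has an explicit primitive. *)
Let increment y x x' : x < x' ->
  (((g x' y - g x y) ^+ 2)%:E <= (x' - x)%:E * \int[mu]_(t in `[x, x']) (g1 y t ^+ 2)%:E)%E.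
Proof.
move=> xx'; have d0 : 0 < x' - x by rewrite subr_gt0.
set m := (g x' y - g x y) / (x' - x).
have G1 : mu.-integrable `[x, x'] (EFin \o (fun t => g1 y t ^+ 2)).
  apply: continuous_compact_integrable; first exact: segment_compact.
  apply: continuous_subspaceT => t; exact: (@continuous_comp _ _ _ (g1 y) (fun u => u ^+ 2) t (@g1_cont y t) (@exprn_continuous _ 2 _)).
have cl : continuous (fun t => 2 * m * g1 y t - m ^+ 2).
  by move=> t; apply: cvgB; [apply: cvgMr; exact: g1_cont|exact: cvg_cst].
have G2 : mu.-integrable `[x, x'] (EFin \o (fun t => 2 * m * g1 y t - m ^+ 2)).
  apply: continuous_compact_integrable; first exact: segment_compact.
  exact: continuous_subspaceT.
pose Fm t := 2 * m * g t y - m ^+ 2 * t.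
have dF (t : R) : is_derive t 1 Fm (2 * m * g1 y t - m ^+ 2).
  have h := is_deriveB (is_deriveZ (2 * m) (dg y t)) (is_deriveZ (m ^+ 2) (is_derive_id t 1)).
  by apply: (is_derive_eq h); rewrite /GRing.scale/= mulr1.
have cF : continuous Fm.
  by move=> t; have [d _] := dF t; apply: differentiable_continuous; exact/derivable1_diffP.
have FTC : (\int[mu]_(t in `[x, x']) (2 * m * g1 y t - m ^+ 2)%:E = (Fm x')%:E - (Fm x)%:E)%E.
  apply: continuous_FTC2 => //.
  - exact: continuous_subspaceT.
  - split; first by move=> t _; have [] := dF t.
    + exact/cvg_at_right_filter/cF.
    + exact/cvg_at_left_filter/cF.
  - by move=> t _; rewrite derive1E; have [_ ->] := dF t.
have le : ((Fm x')%:E - (Fm x)%:E <= \int[mu]_(t in `[x, x']) (g1 y t ^+ 2)%:E)%E.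
  rewrite -FTC; apply: le_integral => // t _; rewrite /= lee_fin.
  by have := sqr_ge0 (g1 y t - m); lra.
have -> : (((g x' y - g x y) ^+ 2)%:E = (x' - x)%:E * ((Fm x')%:E - (Fm x)%:E))%E.
  rewrite -EFinB -EFinM; congr EFin; rewrite /Fm.
  have -> : g x' y = g x y + m * (x' - x) by rewrite /m; field; rewrite gt_eqF.
  by ring.
by apply: lee_wpmul2l => //; rewrite lee_fin ltW.
Qed.

Let noise_const_ge0 : 0 <= noise_const.
Proof. by rewrite divr_ge0 ?sqr_ge0// addr_ge0 ?sqr_ge0. Qed.

Let mg x : measurable_fun setT (g x).
Proof.
rewrite (_ : g x = fun y => Num.sqrt (noisy_density x y)); last by apply/funext => y; rewrite gE.
by apply: measurable_sqrt; exact: measurable_noisy_density.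
Qed.

(** The increment bound is integrated in y and the order exchanged by Tonelli; the energy is bounded
    at each t in [x, x'], which supplies the second factor x' - x. *)
Let hellinger x x' : x <= x' ->
  (\int[mu]_y ((g x' y - g x y) ^+ 2)%:E <= (noise_const * (M + 1) * (x' - x) ^+ 2)%:E)%E.
Proof.
rewrite le_eqVlt => /predU1P[<-|xx'].
  rewrite (eq_integral (cst 0%E)); last by move=> y _; rewrite subrr expr0n.
  by rewrite integral0 lee_fin mulr_ge0 ?sqr_ge0// mulr_ge0// addr_ge0.
have d0 : 0 <= x' - x by rewrite subr_ge0 ltW.
pose f (z : RR * RR) := ((g1 z.2 z.1 ^+ 2)%:E * (\1_(`[x, x'] : set RR) z.1)%:E)%E.
have mf : measurable_fun setT f.
  apply: emeasurable_funM; apply/measurable_EFinP; first exact: measurable_funX.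
  have mi : measurable_fun setT (\1_(`[x, x'] : set RR) : RR -> R) by [].
  exact: (measurableT_comp mi measurable_fst).
have f0 z : (0 <= f z)%E by rewrite mule_ge0// lee_fin sqr_ge0.
have fE y : (\int[mu]_(t in `[x, x']) (g1 y t ^+ 2)%:E = \int[mu]_t f (t, y))%E.
  by rewrite integral_mkcond epatch_indic.
apply: (@le_trans _ _ (\int[mu]_y ((x' - x)%:E * \int[mu]_t f (t, y)))%E).
  apply: ge0_le_integral => //.
  - by move=> y _; rewrite lee_fin sqr_ge0.
  - by apply/measurable_EFinP; apply: measurable_funX; exact: (measurable_funB (mg x') (mg x)).
  - apply: emeasurable_funM => //.
    exact: (measurable_fun_fubini_tonelli_G (m1 := mu) f mf f0).
  - by move=> y _; rewrite -fE; exact: increment.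
rewrite ge0_integralZl//; first last.
- by move=> y _; exact: integral_ge0.
- exact: (measurable_fun_fubini_tonelli_G (m1 := mu) f mf f0).
rewrite -(fubini_tonelli (m1 := mu) (m2 := mu) f mf f0).
have le : (\int[mu]_t \int[mu]_y f (t, y) <=
   \int[mu]_t ((noise_const * (M + 1))%:E * (\1_(`[x, x'] : set RR) t)%:E))%E.
  apply: ge0_le_integral => //.
  - by move=> t _; exact: integral_ge0.
  - exact: (measurable_fun_fubini_tonelli_F (m2 := mu) f mf f0).
  - by apply: emeasurable_funM => //; apply/measurable_EFinP.
  move=> t _; rewrite /f/= ge0_integralZr//; last 2 first.
  - by apply/measurable_EFinP; apply: measurable_funX; exact: (measurableT_comp mg1 (measurable_pair1 t)).
  - by move=> y _; rewrite lee_fin; exact: sqr_ge0.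
  by apply: lee_wpmul2r => //; exact: energy.
apply: (le_trans (lee_wpmul2l _ le)); first by rewrite lee_fin.
rewrite ge0_integralZl//; last 2 first.
- exact/measurable_EFinP.
- by rewrite lee_fin mulr_ge0// addr_ge0.
have -> : (\int[mu]_t (\1_(`[x, x'] : set RR) t)%:E = (x' - x)%:E)%E.
  rewrite integral_indic// setIT; apply: (eq_trans (lebesgue_measure_itv _)).
  by rewrite /= lte_fin xx' EFinB.
by rewrite -!EFinM lee_fin mulrCA -expr2.
Qed.

Definition noise_rate : R := noise_const * (M + 1).

Lemma noise_rate_ge0 : 0 <= noise_rate.
Proof. by rewrite mulr_ge0// addr_ge0. Qed.

(** The squared Hellinger distance is 2 minus twice the integral of the geometric mean. The maximum
    with 0 keeps the factors nonnegative, hence multipliable, when x and x' are far apart. *)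
Lemma noisy_aff_bound x x' :
  aff_bound (noisy x) (noisy x') (Num.max 0 (1 - noise_rate * (x - x') ^+ 2)).
Proof.
have aux (K I : R) : 2 - 2 * I <= K -> 0 <= K -> 1 - K <= I by lra.
have mq z : @measurable_fun _ _ RR R setT (noisy_density z) := @measurable_noisy_density z.
have q0 := noisy_density_ge0; have qE z := @noisy_densityE z.
apply: (@aff_bound_density _ RR R mu (noisy x) (noisy x') _ _ (mq x) (mq x') (q0 x) (q0 x') (@qE x) (@qE x')).
have iq z : mu.-integrable setT (EFin \o noisy_density z).
  exact: (density_integrable (P := noisy z) (mq z) (q0 z) (@qE z)).
have q1 z : \int[mu]_y noisy_density z y = 1.
  by rewrite /Rintegral -(qE z _ measurableT) probability_setT.
have isq := integrable_geometric (mq x) (mq x') (q0 x) (q0 x') (@qE x) (@qE x').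
have sq0 : 0 <= \int[mu]_y Num.sqrt (noisy_density x y * noisy_density x' y).
  by apply: Rintegral_ge0 => y _; exact: sqrtr_ge0.
rewrite ge_max sq0/=.
have hd : \int[mu]_y ((g x' y - g x y) ^+ 2) <= noise_rate * (x - x') ^+ 2.
  wlog xx' : x x' {sq0 isq} / x <= x'.
    move=> W; have [/W //|/ltW/W] := leP x x'.
    rewrite -(opprB x x') sqrrN; apply: le_trans; rewrite le_eqVlt; apply/orP; left; apply/eqP.
    by apply: eq_Rintegral => y _; rewrite -sqrrN opprB.
  rewrite -(opprB x' x) sqrrN; have h := hellinger xx'.
  have hf : (\int[mu]_y ((g x' y - g x y) ^+ 2)%:E)%E \is a fin_num.
    rewrite ge0_fin_numE; first exact: le_lt_trans h (ltry _).
    by apply: integral_ge0 => y _; rewrite lee_fin sqr_ge0.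
  by rewrite /Rintegral -lee_fin fineK.
have e : \int[mu]_y ((g x' y - g x y) ^+ 2) =
    2 - 2 * \int[mu]_y Num.sqrt (noisy_density x y * noisy_density x' y).
  transitivity (\int[mu]_y ((noisy_density x y + noisy_density x' y) -
      2 * Num.sqrt (noisy_density x y * noisy_density x' y))).
    apply: eq_Rintegral => y _; rewrite !gE (sqrtrM (noisy_density x' y) (q0 x y)) sqrrB !sqr_sqrtr//.
    by ring.
  have iD : mu.-integrable setT (EFin \o (fun y => noisy_density x y + noisy_density x' y)).
    exact: (integrableD measurableT (iq x) (iq x')).
  have iZ : mu.-integrable setT
      (EFin \o (fun y => 2 * Num.sqrt (noisy_density x y * noisy_density x' y))).
    exact: (integrableZl measurableT 2 isq).
  by rewrite (RintegralB measurableT iD iZ) (RintegralD measurableT (iq x) (iq x'))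
     (RintegralZl 2 measurableT isq) !q1.
have K0 : 0 <= noise_rate * (x - x') ^+ 2 by rewrite mulr_ge0 ?noise_rate_ge0 ?sqr_ge0.
by apply: aux K0; rewrite -e.
Qed.

End NoiseHellinger.

(** * The law of the observations as a mixture over the signal *)

Section ObservationLaw.
Context d (T : measurableType d) (R : realType).
Local Notation RR := (measurableTypeR R).
Variables (P : probability T R) (N : nat) (Z eps : 'I_N -> {mfun T >-> R}).
Variables (nu : nat -> probability RR R) (a : R -> R).
Hypothesis ma : @measurable_fun _ _ RR RR setT a.
Hypothesis joint : forall (A : set (N.-tuple RR)) (b : 'I_N -> R), measurable A ->
  P (random_tuple Z @^-1` A `&` random_tuple eps @^-1` hbox b) =
  (P (random_tuple Z @^-1` A) * tprod N nu (hbox b))%E.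

Definition perturb (x e : N.-tuple RR) : N.-tuple RR :=
  [tuple tnth x i + a (tnth x i) * tnth e i | i < N].

Lemma measurable_perturb : measurable_fun setT (fun z : N.-tuple RR * N.-tuple RR => perturb z.1 z.2).
Proof.
apply/measurable_fun_tnthP => i.
rewrite (_ : _ \o _ = fun z => (tnth z.1 i + a (tnth z.1 i) * tnth z.2 i : RR)); last first.
  by apply/funext => z; rewrite /= tnth_mktuple.
have m1 : measurable_fun setT (fun z : N.-tuple RR * N.-tuple RR => tnth z.1 i).
  exact: (measurableT_comp (@measurable_tnth _ RR N i) measurable_fst).
have m2 : measurable_fun setT (fun z : N.-tuple RR * N.-tuple RR => tnth z.2 i).
  exact: (measurableT_comp (@measurable_tnth _ RR N i) measurable_snd).
apply: measurable_funD => //; apply: measurable_funM => //.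
exact: (measurableT_comp ma m1).
Qed.

Definition signal_noise (w : T) : N.-tuple RR * N.-tuple RR := (random_tuple Z w, random_tuple eps w).

Lemma measurable_signal_noise : measurable_fun setT signal_noise.
Proof. by apply/measurable_fun_pairP; split; exact: measurable_random_tuple. Qed.

HB.instance Definition _ := isMeasurableFun.Build _ _ _ _ signal_noise measurable_signal_noise.

(** For fixed A both sides are finite measures in B that agree on orthants. *)
Lemma joint_box (A B : set (N.-tuple RR)) : measurable A -> measurable B ->
  P (random_tuple Z @^-1` A `&` random_tuple eps @^-1` B) =
  (P (random_tuple Z @^-1` A) * tprod N nu B)%E.
Proof.
move=> mA; set C := random_tuple Z @^-1` A.
have mC : measurable C.
  by rewrite /C -[X in measurable X]setTI; exact: (measurable_random_tuple Z measurableT mA).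
have PC : P C = (fine (P C))%:E by rewrite fineK ?fin_num_measure.
have PC0 : 0 <= fine (P C) by rewrite fine_ge0.
have mT : measurable_fun setT (random_tuple eps) by exact: measurable_random_tuple.
pose m1 : {measure set (N.-tuple RR) -> \bar R} := pushforward (mrestr P mC) (random_tuple eps).
pose m2 : {measure set (N.-tuple RR) -> \bar R} := mscale (NngNum PC0) (tprod N nu).
have H : (m1 mT setT < +oo)%E.
  rewrite /m1 /= /pushforward /= /mrestr preimage_setT setTI.
  by apply: le_lt_trans (probability_le1 P mC) _; rewrite ltry.
have := tuple_measure_unique (m1 := m1 mT) (m2 := m2) H.
rewrite /m1 /m2 /= /pushforward /mrestr /mscale /= => U mB.
rewrite PC setIC; apply: U => //.
by move=> b; rewrite setIC -PC; exact: joint.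
Qed.

Lemma joint_law C : measurable C ->
  (distribution P (random_tuple Z) \x tprod N nu)%E C = distribution P signal_noise C.
Proof.
move=> mC; apply: product_measure_unique => // A B mA mB.
exact: joint_box.
Qed.

Lemma noisy_tuple (x : N.-tuple RR) B : measurable B ->
  tprod N nu (perturb x @^-1` B) = tprod N (fun i => noisy a (nu i) (nth 0 x i)) B.
Proof.
have mm : measurable_fun setT (perturb x).
  exact: (measurableT_comp measurable_perturb (measurable_pair1 x)).
pose px : {mfun (N.-tuple RR) >-> (N.-tuple RR)} := @mfun_Sub _ _ (N.-tuple RR) (N.-tuple RR) _ (mem_set mm).
have U := tuple_measure_unique (m1 := distribution (tprod N nu) px)
  (m2 := tprod N (fun i => noisy a (nu i) (nth 0 x i))).
apply: U; first by apply: le_lt_trans (probability_le1 _ _) _; rewrite ?ltry.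
move=> b; rewrite /hbox /distribution /pushforward.
pose b' (k : nat) := if insub k is Some i then b i else 0 : R.
have bE (i : 'I_N) : b' i = b i by rewrite /b' valK.
pose B' (k : nat) : set RR := `]b' k, +oo[%classic.
have -> : box (fun i : 'I_N => `]b i, +oo[%classic) = box (fun i : 'I_N => B' i).
  by congr box; apply/funext => i; rewrite /B' bE.
have mB' k : measurable (B' k) by exact: measurable_itv.
pose C (k : nat) : set RR := shiftscale (nth 0 x k) (a (nth 0 x k)) @^-1` B' k.
have mC k : measurable (C k).
  by rewrite /C -[X in measurable X]setTI; exact: measurable_shiftscale.
have E : px @^-1` box (fun i : 'I_N => B' i) = box (fun i : 'I_N => C i).
  apply/seteqP; split=> t /= h i; have := h i.
    by rewrite tnth_mktuple /C /= /shiftscale -tnth_nth.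
  by rewrite tnth_mktuple /C /= /shiftscale -tnth_nth.
apply: (etrans (congr1 (tprod N nu) E)).
exact: (etrans (tprod_box N nu mC) (esym (tprod_box N (fun i => noisy a (nu i) (nth 0 x i)) mB'))).
Qed.

(** The conditional expectation of h(Y) when the signal on the grid is x. *)
Definition noisy_mean (h : N.-tuple RR -> R) (x : N.-tuple RR) : R :=
  \int[tprod N (fun i => noisy a (nu i) (nth 0 x i))]_y h y.

Lemma noisy_meanE h x : test h -> noisy_mean h x = \int[tprod N nu]_e h (perturb x e).
Proof.
move=> th; have mm : measurable_fun setT (perturb x).
  exact: (measurableT_comp measurable_perturb (measurable_pair1 x)).
pose px : {mfun (N.-tuple RR) >-> (N.-tuple RR)} := @mfun_Sub _ _ (N.-tuple RR) (N.-tuple RR) _ (mem_set mm).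
rewrite -(Rint_distribution (tprod N nu) px (test_bmeas th)).
by rewrite /noisy_mean /Rintegral; congr fine; apply: eq_measure_integral => A mA _; exact: (esym (noisy_tuple x mA)).
Qed.

Lemma test_noisy_mean h : test h -> test (noisy_mean h).
Proof.
move=> th; rewrite (_ : noisy_mean h = fun x => \int[tprod N nu]_e h (perturb x e)); last first.
  by apply/funext => x; exact: noisy_meanE.
exact: (test_inner (tprod N nu) (tprod N nu) (test_comp measurable_perturb th)).
Qed.

Lemma observation_mean h : test h ->
  \int[P]_w h (perturb (random_tuple Z w) (random_tuple eps w)) =
  \int[distribution P (random_tuple Z)]_x noisy_mean h x.
Proof.
move=> th; have tm := test_comp measurable_perturb th.
rewrite -(Rint_distribution P signal_noise (test_bmeas tm)).
transitivity (\int[(distribution P (random_tuple Z) \x tprod N nu)%E]_z h (perturb z.1 z.2)).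
  by rewrite /Rintegral; congr fine; apply: eq_measure_integral => A mA _; exact: (esym (joint_law mA)).
rewrite (Rint_prod _ _ (test_bmeas tm)).
by apply: eq_Rintegral => x _; rewrite noisy_meanE.
Qed.

End ObservationLaw.

(** * Gaussian affinity and the two-point bound *)

Section Bernoulli.
Variable R : realType.

Lemma prod_ge_1sub (I : Type) (s : seq I) (y rho : I -> R) :
  (forall i, 0 <= y i) -> (forall i, 0 <= rho i <= 1) -> (forall i, 1 - y i <= rho i) ->
  1 - \sum_(i <- s) y i <= \prod_(i <- s) rho i.
Proof.
move=> y0 r01 h; elim: s => [|i s IH]; first by rewrite !big_nil subr0.
rewrite !big_cons.
have s0 : 0 <= \sum_(j <- s) y j by exact: sumr_ge0.
have p0 : 0 <= \prod_(j <- s) rho j by apply: prodr_ge0 => j _; case/andP: (r01 j).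
have p1 : \prod_(j <- s) rho j <= 1.
  by apply: prodr_ile1 => j _; exact: r01.
have /andP[ri0 ri1] := r01 i; have hi := h i.
have : 0 <= (1 - rho i) * (1 - \prod_(j <- s) rho j) by rewrite mulr_ge0// subr_ge0.
by rewrite mulrBl mul1r mulrBr mulr1; lra.
Qed.

End Bernoulli.

Section NormalAffinity.
Variable R : realType.
Local Notation RR := (measurableTypeR R).
Notation mu := (@lebesgue_measure R).
Variable r : R.
Hypothesis r0 : 0 < r.

(** The geometric mean of the densities of N(0, 1) and N(0, r^2) is [normal_affinity] times the
    normal density whose variance is the harmonic mean of 1 and r^2. *)
Definition mean_scale : R := Num.sqrt (2 * r ^+ 2 / (1 + r ^+ 2)).
Definition normal_affinity : R := Num.sqrt (2 * r / (1 + r ^+ 2)).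

Let q0 : 0 < 1 + r ^+ 2. Proof. by have := sqr_ge0 r; lra. Qed.

Lemma mean_scale_sqr : mean_scale ^+ 2 = 2 * r ^+ 2 / (1 + r ^+ 2).
Proof. by rewrite sqr_sqrtr// divr_ge0 ?(ltW q0)// mulr_ge0// sqr_ge0. Qed.

Lemma mean_scale_gt0 : 0 < mean_scale.
Proof. by rewrite sqrtr_gt0 divr_gt0// mulr_gt0// exprn_gt0. Qed.

(** A bound free of r, used to average the squared distance of the signals under the intermediate
    law. *)
Lemma mean_scale_sqr_le2 : mean_scale ^+ 2 <= 2.
Proof. by rewrite mean_scale_sqr ler_pdivrMr//; lra. Qed.

Lemma normal_affinity_sqr : normal_affinity ^+ 2 = 2 * r / (1 + r ^+ 2).
Proof. by rewrite sqr_sqrtr// divr_ge0 ?(ltW q0)// mulr_ge0// ltW. Qed.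

Lemma normal_affinity01 : 0 <= normal_affinity <= 1.
Proof.
rewrite sqrtr_ge0/= -[leRHS]sqrtr1 ler_wsqrtr// ler_pdivrMr//.
by have := sqr_ge0 (1 - r); rewrite sqrrB -mulr_natr; lra.
Qed.

Lemma normal_affinity_ge : 1 - (1 - r) ^+ 2 <= normal_affinity.
Proof.
have /andP[h0 h1] := normal_affinity01.
apply: (@le_trans _ _ (normal_affinity ^+ 2)); last by rewrite expr2 ler_piMl.
rewrite normal_affinity_sqr ler_pdivlMr//.
have := sqr_ge0 (r * (1 - r)).
have -> : (1 - (1 - r) ^+ 2) * (1 + r ^+ 2) = 2 * r - (r * (1 - r)) ^+ 2 by ring.
lra.
Qed.

Lemma normal_peakE (s : R) : 0 < s -> normal_peak s = (s * Num.sqrt (2 * pi))^-1.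
Proof.
move=> s0; rewrite /normal_peak -mulr_natl mulrCA sqrtrM ?sqr_ge0//.
by rewrite sqrtr_sqr gtr0_norm.
Qed.

Lemma normal_geometric (x : R) :
  Num.sqrt (normal_pdf 0 1 x * normal_pdf 0 r x) =
  normal_affinity * normal_pdf 0 mean_scale x.
Proof.
have t0 := mean_scale_gt0.
have a0 : 0 <= normal_affinity by case/andP: normal_affinity01.
have f0 (s : R) : 0 <= normal_pdf 0 s x by exact: normal_pdf_ge0.
suff E : normal_pdf 0 1 x * normal_pdf 0 r x = (normal_affinity * normal_pdf 0 mean_scale x) ^+ 2.
  by rewrite E sqrtr_sqr ger0_norm// mulr_ge0.
rewrite exprMn normal_affinity_sqr !normal_pdf_expR ?oner_neq0 ?gt_eqF//.
rewrite exprMn -expRM_natl mulrACA -expRD [RHS]mulrA !subr0 !normal_peakE//.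
have s0 : 0 < Num.sqrt (2 * pi) :> R by rewrite sqrtr_gt0 mulr_gt0// pi_gt0.
congr (_ * expR _).
  rewrite exprVn exprMn mean_scale_sqr.
  by field; rewrite !gt_eqF.
rewrite mean_scale_sqr expr1n.
by field; rewrite !gt_eqF.
Qed.

Lemma sub_affine_normal :
  sub_affine (normal_prob 0 1 : probability RR R) (normal_prob 0 r) (normal_prob 0 mean_scale)
    normal_affinity.
Proof.
have mq s : @measurable_fun _ _ RR R setT (normal_pdf 0 s) := measurable_normal_pdf 0 s.
have q_ge0 s x : 0 <= normal_pdf 0 s x :> R := normal_pdf_ge0 0 s x.
have qE s A : measurable A ->
    (normal_prob 0 s : probability RR R) A = (\int[mu]_(x in A) (normal_pdf 0 s x)%:E)%E.
  by move=> _; exact: normal_probE.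
exact: (@sub_affine_density _ RR R mu _ _ _ _ (mq 1) (mq r) (q_ge0 1) (q_ge0 r) (qE 1) (qE r)
  _ _ _ (mq mean_scale) (q_ge0 mean_scale) (qE mean_scale) normal_geometric).
Qed.

End NormalAffinity.

Section TwoPoint.
Context d (T : measurableType d) (R : realType).
Local Notation RR := (measurableTypeR R).
Variables (P0 P1 : probability T R) (N : nat) (Z eps : 'I_N -> {mfun T >-> R}).
Variables (nu : nat -> probability RR R) (a : R -> R) (C : R).
Variables (K : nat) (A0 A1 : nat -> nat -> R) (r : nat -> R).
Hypothesis ma : @measurable_fun _ _ RR RR setT a.
Hypothesis joint0 : forall (A : set (N.-tuple RR)) (b : 'I_N -> R), measurable A ->
  P0 (random_tuple Z @^-1` A `&` random_tuple eps @^-1` hbox b) =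
  (P0 (random_tuple Z @^-1` A) * tprod N nu (hbox b))%E.
Hypothesis joint1 : forall (A : set (N.-tuple RR)) (b : 'I_N -> R), measurable A ->
  P1 (random_tuple Z @^-1` A `&` random_tuple eps @^-1` hbox b) =
  (P1 (random_tuple Z @^-1` A) * tprod N nu (hbox b))%E.
Hypothesis law0 : forall B, measurable B ->
  distribution P0 (random_tuple Z) B = distribution (tprod K (normals (fun=> 1))) (@linmap R K N A0) B.
Hypothesis law1 : forall B, measurable B ->
  distribution P1 (random_tuple Z) B = distribution (tprod K (normals r)) (@linmap R K N A1) B.
Hypothesis r0 : forall q, 0 < r q.
Hypothesis C0 : 0 <= C.
Hypothesis noise : forall i x x', (i < N)%N ->
  aff_bound (noisy a (nu i) x) (noisy a (nu i) x') (Num.max 0 (1 - C * (x - x') ^+ 2)).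

Let S1 := \sum_(q < K) (1 - r q) ^+ 2.
Let S2 := \sum_(q < K) \sum_(i < N) (A0 q i - A1 q i) ^+ 2.

Let dist2 (z : K.-tuple RR) (i : nat) : R := (\sum_(q < K) (A0 q i - A1 q i) * tnth z q + 0) ^+ 2.

(** Given the Gaussian coefficients z, both laws are products over the grid, so the losses add up;
    the same test on both sides starts with affinity 1. *)
Lemma noisy_mean_aff (h : N.-tuple RR -> R) (z : K.-tuple RR) : test h ->
  1 - C * \sum_(i < N) dist2 z i <=
  aff (noisy_mean nu a h (linmap N A0 z)) (noisy_mean nu a h (linmap N A1 z)).
Proof.
move=> th.
pose rho (i : nat) := Num.max 0 (1 - C * dist2 z i).
have rho01 i : 0 <= rho i <= 1.
  rewrite /rho le_max lexx/= ge_max ler01/= gerBl mulr_ge0// sqr_ge0//.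
have hh x : aff (h x) (h x) = 1.
  have /andP[h0 h1] := th.2 x; rewrite /aff -!expr2 !sqrtr_sqr !ger0_norm ?subr_ge0//.
  by rewrite addrC subrK.
apply: (@le_trans _ _ (\prod_(i < N) rho i * 1)).
  rewrite mulr1 mulr_sumr; apply: prod_ge_1sub => i.
  - by rewrite mulr_ge0// sqr_ge0.
  - exact: rho01.
  - by rewrite /rho le_max lexx orbT.
apply: (aff_bound_tprod (rho := rho)) => //.
- by move=> i; case/andP: (rho01 i).
- move=> i iN; rewrite /rho.
  have -> : dist2 z i = ((linmap N A0 z)`_i - (linmap N A1 z)`_i) ^+ 2.
    rewrite /dist2 addr0 -!(tnth_nth 0 _ (Ordinal iN)) !tnth_mktuple -sumrB/=.
    by congr (_ ^+ 2); apply: eq_bigr => q _; rewrite mulrBl.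
  exact: noise.
- by move=> x; rewrite hh.
Qed.

Lemma two_point_aff (h : N.-tuple RR -> R) : test h -> S1 <= 1 -> 2 * C * S2 <= 1 ->
  (1 - S1) * (1 - 2 * C * S2) <=
  aff (\int[P0]_w h (perturb a (random_tuple Z w) (random_tuple eps w)))
      (\int[P1]_w h (perturb a (random_tuple Z w) (random_tuple eps w))).
Proof.
move=> th hS1 hS2.
rewrite (observation_mean ma joint0 th) (observation_mean ma joint1 th).
have tk := test_noisy_mean nu ma th; set k := noisy_mean nu a h in tk *.
have -> : \int[distribution P0 (random_tuple Z)]_x k x =
    \int[distribution (tprod K (normals (fun=> 1))) (@linmap R K N A0)]_x k x.
  by rewrite /Rintegral; congr fine; apply: eq_measure_integral => A mA _; exact: law0.
have -> : \int[distribution P1 (random_tuple Z)]_x k x =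
    \int[distribution (tprod K (normals r)) (@linmap R K N A1)]_x k x.
  by rewrite /Rintegral; congr fine; apply: eq_measure_integral => A mA _; exact: law1.
rewrite (Rint_distribution _ _ (test_bmeas tk)) (Rint_distribution _ _ (test_bmeas tk)).
pose t q := mean_scale (r q); pose rho q := normal_affinity (r q).
have rho01 q : 0 <= rho q <= 1 by exact: normal_affinity01.
have sub := sub_affine_tprod (n := K) (P0 := normals (fun=> 1)) (P1 := normals r) (M := normals t)
  (rho := rho) (fun q => proj1 (andP (rho01 q))) (fun q _ => sub_affine_normal (r0 q)).
have t0 := test_comp (@measurable_linmap R K N A0) tk.
have t1 := test_comp (@measurable_linmap R K N A1) tk.
apply: le_trans (sub _ _ t0 t1).
have ta := test_aff t0 t1; set g := (fun x => aff _ _) in ta *.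
apply: ler_pM; rewrite ?subr_ge0//.
  apply: prod_ge_1sub => q; rewrite ?sqr_ge0//.
  exact: normal_affinity_ge.
have bg := test_bmeas ta.
(* Under the intermediate law the coefficients are independent and centred with variance at most 2,
   so the mean squared distance is at most 2 * S2. *)
suff : (1 - \int[tprod K (normals t)]_z g z <= 2 * C * S2) by lra.
rewrite -(Rint_C _ ta) -lee_fin -(RintEFin _ (test_bmeas (testC ta))).
have md i : measurable_fun setT (fun z => dist2 z i).
  exact: (measurable_funX 2 (measurable_lin (n := K) (fun q => A0 q i - A1 q i) 0)).
have mde i : measurable_fun setT (fun z => (dist2 z i)%:E) by apply/measurable_EFinP; exact: md.
have mS : measurable_fun setT (fun z => \sum_(i < N) dist2 z i) by apply: measurable_sum => i; exact: md.
have m1g : measurable_fun setT (fun z => (1 - g z)%:E).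
  by apply/measurable_EFinP; exact: (testC ta).1.
apply: (@le_trans _ _ (\int[tprod K (normals t)]_z (C * \sum_(i < N) dist2 z i)%:E)%E).
  apply: ge0_le_integral => //.
  - by move=> z _; rewrite lee_fin; case/andP: ((testC ta).2 z).
  - by apply/measurable_EFinP; apply: measurable_funM.
  - move=> z _; rewrite lee_fin lerBlDl addrC -lerBlDl.
    by have := noisy_mean_aff z th; rewrite -/k /g /=; lra.
under eq_integral do rewrite EFinM.
rewrite ge0_integralZl_EFin//; first last.
- by apply/measurable_EFinP.
- by move=> z _; rewrite lee_fin; apply: sumr_ge0 => i _; exact: sqr_ge0.
under eq_integral do rewrite -sumEFin.
rewrite ge0_integral_sum//; last by move=> i z _; rewrite lee_fin sqr_ge0.
rewrite (eq_bigr (fun i : 'I_N => (\sum_(q < K) (A0 q i - A1 q i) ^+ 2 * t q ^+ 2)%:E)); last first.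
  move=> i _; rewrite /dist2 (normals_quadratic K (fun q => A0 q i - A1 q i) 0).
    by rewrite expr0n/= addr0.
  by move=> q; rewrite gt_eqF// mean_scale_gt0.
rewrite sumEFin -EFinM lee_fin [2 * C]mulrC -mulrA ler_wpM2l//.
rewrite /S2 mulr_sumr exchange_big/=; apply: ler_sum => q _; rewrite mulr_sumr; apply: ler_sum => i _.
by rewrite mulrC ler_wpM2r ?sqr_ge0// mean_scale_sqr_le2.
Qed.

End TwoPoint.

(** * Independence of signal and noise from the conditional hypotheses *)

Section ConditionalNoise.
Context d (T : measurableType d) (R : realType).
Local Notation RR := (measurableTypeR R).
Local Notation mu := (@lebesgue_measure R).
Variables (P : probability T R) (X : R -> {mfun T >-> R}).
Local Notation G := (sigma_generated `[0, +oo[ X).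

Lemma cond_density_law (Z : T -> R) (p : R -> R) : has_cond_density P G Z p ->
  forall B, measurable B -> P (Z @^-1` B) = (\int[mu]_(x in B) (p x)%:E)%E.
Proof.
move=> [p0 mp H].
have GT : G setT.
  have [G0 GC _] : sigma_algebra setT G by exact: smallest_sigma_algebra.
  by have := GC _ G0; rewrite setD0.
have E (B : set R) : measurable B -> measurable (Z @^-1` B) ->
   P (Z @^-1` B) = (\int[mu]_(x in B) p x)%:E.
  move=> mB mZB; have [_ _ _ /(_ _ GT)] := H B mB.
  move=> e; have := integral_cst P measurableT (\int[mu]_(x in B) p x)%:E.
  rewrite [X in (_ * X)%E](probability_setT P) mule1 => <-.
  transitivity (\int[P]_w (\1_(Z @^-1` B) w)%:E)%E; last exact: esym e.
  by rewrite integral_indic// setIT.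
(* [Z] is a bare function here; the measurability of the preimage is read off the integrability of
   its indicator. *)
have mZ (B : set R) : measurable B -> measurable (Z @^-1` B).
  move=> mB; have [/integrableP[m1 _] _ _ _] := H B mB.
  have -> : Z @^-1` B = (\1_(Z @^-1` B) : T -> R) @^-1` [set 1].
    apply/seteqP; split=> w /= => [h|]; first by rewrite indicE mem_set.
    rewrite indicE; case: (boolP (w \in Z @^-1` B)) => [/set_mem//|_ /eqP].
    by rewrite eq_sym oner_eq0.
  move/measurable_EFinP : m1 => m1.
  rewrite -[X in measurable X]setTI; apply: m1 => //.
(* The total mass is known to be 1 through [fine], which sends infinite values to 0; as 1 is not 0,
   the integral is finite. *)
have i1 : (\int[mu]_x (p x)%:E)%E = 1%E.
  have := E _ measurableT (mZ _ measurableT); rewrite preimage_setT probability_setT /Rintegral.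
  case: (\int[mu]_x (p x)%:E)%E => [r [<-]//| |] /= [] /eqP; by rewrite oner_eq0.
move=> B mB; rewrite (E B mB (mZ B mB)) /Rintegral fineK// ge0_fin_numE; last first.
  by apply: integral_ge0 => x _; rewrite lee_fin.
apply: (@le_lt_trans _ _ (\int[mu]_x (p x)%:E)%E); last by rewrite i1 ltry.
by apply: ge0_subset_integral => //; [exact/measurable_EFinP|move=> x _; rewrite lee_fin].
Qed.

Variables (N : nat) (t : 'I_N -> R) (eps : 'I_N -> {mfun T >-> R}) (p : 'I_N -> R -> R).
Variable nu : nat -> probability RR R.
Hypothesis t0 : forall i, 0 <= t i.
Hypothesis hind : cond_independent P G (fun i => eps i : T -> R).
Hypothesis hden : forall i, has_cond_density P G (eps i) (p i).
Hypothesis hnu : forall (i : 'I_N) A, measurable A -> nu i A = (\int[mu]_(x in A) (p i x)%:E)%E.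

Lemma generated_signal (A : set (N.-tuple RR)) : measurable A ->
  G (random_tuple (fun i => X (t i)) @^-1` A).
Proof.
pose T' := g_sigma_algebraType (\bigcup_(i in `[0%R, +oo[) preimage_set_system setT (X i) measurable).
suff H : @measurable_fun _ _ T' (N.-tuple RR) setT (random_tuple (fun i => X (t i))).
  by move=> mA; have := H measurableT A mA; rewrite setTI.
apply/measurable_fun_tnthP => i.
rewrite (_ : _ \o _ = X (t i)); last by apply/funext => w; rewrite /= tnth_mktuple.
move=> _ B mB; apply: sub_sigma_algebra; exists (t i); first by rewrite /= in_itv/= t0.
by exists B.
Qed.

(** The event on X lies in the conditioning sigma-field and the conditional probabilities of the
    rays are constants, so the integral of their product over the event factorises. *)
Lemma cond_noise_joint (A : set (N.-tuple RR)) (b : 'I_N -> R) : measurable A ->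
  P (random_tuple (fun i => X (t i)) @^-1` A `&` random_tuple eps @^-1` hbox b) =
  (P (random_tuple (fun i => X (t i)) @^-1` A) * tprod N nu (hbox b))%E.
Proof.
move=> mA; set C := random_tuple _ @^-1` A.
have GC : G C by exact: generated_signal.
have mC : measurable C.
  by rewrite /C -[X in measurable X]setTI; exact: (measurable_random_tuple _ measurableT mA).
pose B (i : 'I_N) : set R := `]b i, +oo[%classic.
have mB i : measurable (B i) by exact: measurable_itv.
pose c i := \int[mu]_(x in B i) p i x.
have cE i : (c i)%:E = nu i (B i).
  have h := hnu i (mB i).
  have f : (\int[mu]_(x in B i) (p i x)%:E)%E \is a fin_num by rewrite -h; exact: (fin_num_measure (nu i) _ (mB i)).
  exact: (etrans (fineK f) (esym h)).
have mI : measurable (\bigcap_i (eps i @^-1` B i)).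
  apply: fin_bigcap_measurable; first exact: finite_finset.
  by move=> i _; rewrite -[X in measurable X]setTI; exact: (measurable_funPT (eps i)).
have hc i : is_cond_prob P G (eps i @^-1` B i) (cst (c i)).
  by have [_ _ h] := hden i; exact: h.
have [_ _ _ /(_ C GC)] := hind mB hc.
rewrite integral_indic// => e0.
have e := etrans (esym (integral_cst P mC (\prod_i c i)%:E)) e0.
have E : random_tuple eps @^-1` hbox b = \bigcap_i (eps i @^-1` B i).
  apply/seteqP; split=> w /= h i; have := h i; rewrite tnth_mktuple//.
  by apply.
rewrite E setIC -e muleC; congr (_ * _)%E.
pose b' (k : nat) := if insub k is Some i then b i else 0 : R.
have bE (i : 'I_N) : b' i = b i by rewrite /b' valK.
pose B' (k : nat) : set RR := `]b' k, +oo[%classic.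
have mB' k : measurable (B' k) by exact: measurable_itv.
have -> : hbox b = box (fun i : 'I_N => B' i).
  by rewrite /hbox; congr box; apply/funext => i; rewrite /B' bE.
rewrite (tprod_box N nu mB') -prodEFin; apply: eq_bigr => i _.
by rewrite cE /B' bE.
Qed.

End ConditionalNoise.

(** * Continuity and positivity of Gamma and kappa *)

Section GammaFunction.
Variable R : realType.
Local Notation RR := (measurableTypeR R).
Notation mu := (@lebesgue_measure R).
Local Notation I := (`]0%R, +oo[%classic : set R).

Definition gamma_integrand (x t : R) : R := t `^ (x - 1) * expR (- t).

Lemma gamma_integrand_ge0 x t : 0 <= gamma_integrand x t.
Proof. by rewrite mulr_ge0 ?powR_ge0 ?expR_ge0. Qed.

Lemma measurable_gamma_integrand x : measurable_fun setT (gamma_integrand x).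
Proof.
apply: measurable_funM; first exact: measurable_powR.
by apply: measurableT_comp => //; exact: measurable_funN.
Qed.

(** On 1 < x < 2, the range of 2H, a single integrable function dominates: t^(x - 1) <= 1 + t, and
    half of the exponential absorbs 1 + t up to the factor 2. *)
Lemma gamma_integrand_le x t : 1 < x < 2 -> 0 < t ->
  gamma_integrand x t <= 2 * expR (- (t / 2)).
Proof.
move=> /andP[x1 x2] t0; rewrite /gamma_integrand.
have h : t `^ (x - 1) <= 1 + t.
  have [t1|t1] := leP t 1.
    have : t `^ (x - 1) <= 1 `^ (x - 1) by rewrite ge0_ler_powR ?nnegrE//; lra.
    by rewrite powR1; lra.
  have : t `^ (x - 1) <= t `^ 1 by rewrite ler_powR//; lra.
  by rewrite powRr1; lra.
have e : expR (- t) = expR (- (t / 2)) * expR (- (t / 2)).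
  by rewrite -expRD; congr expR; field.
have h2 : (1 + t / 2) * expR (- (t / 2)) <= 1.
  rewrite expRN ler_pdivrMr ?expR_gt0// mul1r; apply: expR_ge1Dx.
have p := expR_gt0 (- (t / 2)).
apply: (@le_trans _ _ ((1 + t) * expR (- t))); first by rewrite ler_wpM2r ?expR_ge0.
by rewrite e mulrA ler_pM2r//; nra.
Qed.

Lemma integrable_exp_half : mu.-integrable I (EFin \o (fun t => 2 * expR (- (t / 2)))).
Proof.
have h : 0 < 2^-1 :> R by lra.
have mI : measurable (I : set RR) by exact: measurable_itv.
have i1 := integrableS measurableT mI (@subsetT _ _) (integrable_exponential_pdf h).
have i2 := integrableZl mI 4 i1.
apply: (eq_integrable mI _ _ _ i2) => t; rewrite inE/= in_itv/= andbT => t0.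
rewrite exponential_pdfE ?(ltW t0)// -EFinM; congr EFin.
have -> : - 2^-1 * t = - (t / 2) by field.
by field.
Qed.

Lemma gamma_integrable x : 1 < x < 2 -> mu.-integrable I (EFin \o gamma_integrand x).
Proof.
have mI : measurable (I : set RR) by exact: measurable_itv.
move=> hx; apply: (le_integrable mI _ _ integrable_exp_half).
  by apply/measurable_EFinP; apply: measurable_funTS; exact: measurable_gamma_integrand.
move=> t; rewrite /= in_itv/= andbT => t0; rewrite lee_fin !ger0_norm ?gamma_integrand_ge0//.
  exact: gamma_integrand_le.
Qed.

Lemma Gamma_continuous x : 1 < x < 2 -> {for x, continuous (@Gamma R)}.
Proof.
move=> hx.
apply: (@continuity_under_integral R _ _ mu gamma_integrand I (measurable_itv _) 1 2 _ _
  (fun t => 2 * expR (- (t / 2)))).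
- by move=> y; rewrite /= in_itv/=; exact: gamma_integrable.
- apply: aeW => t; rewrite /= in_itv/= andbT => t0 y _.
  have c : {for y, continuous (fun z : R => t `^ (z - 1))}.
    rewrite (_ : (fun z : R => _) = fun z => expR ((z - 1) * ln t)); last first.
      by apply/funext => z; rewrite /powR gt_eqF.
    apply: (@continuous_comp _ _ _ (fun z : R => (z - 1) * ln t) (@expR R) y).
      by apply: cvgM; [apply: cvgB; [exact: cvg_id|exact: cvg_cst]|exact: cvg_cst].
    exact: continuous_expR.
  by rewrite /gamma_integrand; apply: cvgM; [exact: c|exact: cvg_cst].
- exact: integrable_exp_half.
- move=> y; rewrite /= in_itv/= => hy; apply: aeW => t; rewrite /= in_itv/= andbT => t0.
  by rewrite ger0_norm ?gamma_integrand_ge0//; exact: gamma_integrand_le.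
- by rewrite inE/= in_itv/=.
Qed.

Lemma Gamma_gt0 (x : R) : 1 < x < 2 -> 0 < Gamma x.
Proof.
move=> hx; have /andP[x1 x2] := hx.
have J : `[1%R, 2%R]%classic `<=` I.
  by move=> t; rewrite /= !in_itv/= andbT => /andP[]; lra.
have mI : measurable (I : set RR) by exact: measurable_itv.
have mJ : measurable (`[1%R, 2%R]%classic : set RR) by exact: measurable_itv.
have iJ := integrableS mI mJ J (gamma_integrable hx).
have lb t : `[1%R, 2%R]%classic t -> expR (- 2) <= gamma_integrand x t.
  rewrite /= in_itv/= => /andP[t1 t2]; rewrite /gamma_integrand.
  have p1 : 1 `^ (x - 1) <= t `^ (x - 1) by rewrite ge0_ler_powR ?nnegrE//; lra.
  rewrite powR1 in p1.
  have p2 : expR (- 2) <= expR (- t) by rewrite ler_expR; lra.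
  by apply: le_trans p2 _; rewrite ler_peMl ?expR_ge0.
apply: (@lt_le_trans _ _ (\int[mu]_(t in `[1, 2]) (fun=> expR (- 2)) t)).
  rewrite /Rintegral integral_cst//= lebesgue_measure_itv/= lte_fin.
  have -> : (1 < 2 :> R) = true by lra.
  rewrite -EFinB -EFinM /= mulr_gt0 ?expR_gt0//; lra.
apply: (@le_trans _ _ (\int[mu]_(t in `[1, 2]) gamma_integrand x t)).
  apply: le_Rintegral => //.
  apply: (le_integrable mJ _ _ iJ); first by apply/measurable_EFinP; exact: measurable_cst.
  move=> t ht; rewrite lee_fin /= !ger0_norm ?expR_ge0 ?gamma_integrand_ge0//; exact: lb.
apply: (fine_le (integrable_fin_num mJ iJ) (integrable_fin_num mI (gamma_integrable hx))).
apply: ge0_subset_integral => //.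
  by apply/measurable_EFinP; apply: measurable_funTS; exact: measurable_gamma_integrand.
by move=> t _; rewrite lee_fin gamma_integrand_ge0.
Qed.

End GammaFunction.

Section Kappa.
Variable R : realType.

Lemma kappa_denominator_gt0 (H : R) : 1 / 2 < H < 1 -> 0 < H * Gamma (2 * H) * sin (pi * H).
Proof.
move=> /andP[h1 h2]; have p := @pi_gt0 R.
have G : 0 < Gamma (2 * H) by apply: Gamma_gt0; apply/andP; split; lra.
have S : 0 < sin (pi * H) by apply: sin_gt0_pi; apply/andP; split; nra.
by rewrite !mulr_gt0//; lra.
Qed.

Lemma kappa_gt0 (H : R) : 1 / 2 < H < 1 -> 0 < kappa H.
Proof. by move=> h; rewrite /kappa divr_gt0 ?pi_gt0// kappa_denominator_gt0. Qed.

(** The scale of the alternative compensates the change of kappa; continuity keeps that scale near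
    s0. *)
Lemma kappa_continuous (H : R) : 1 / 2 < H < 1 -> {for H, continuous (@kappa R)}.
Proof.
move=> h; have /andP[h1 h2] := h; rewrite /kappa.
apply: cvgM; first exact: cvg_cst.
apply: cvgV; first by rewrite gt_eqF// kappa_denominator_gt0.
apply: cvgM; first apply: cvgM; first exact: cvg_id.
  apply: (@continuous_comp _ _ _ (fun y : R => 2 * y) (@Gamma R) H).
    by apply: cvgM; [exact: cvg_cst|exact: cvg_id].
  by apply: Gamma_continuous; apply/andP; split; lra.
apply: (@continuous_comp _ _ _ (fun y : R => pi * y) (@sin R) H); last exact: continuous_sin.
by apply: cvgM; [exact: cvg_cst|exact: cvg_id].
Qed.

End Kappa.

(** * Regularity of the log-density and the score moment *)

Section LogDensity.
Variable R : realType.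
Local Notation RR := (measurableTypeR R).
Notation mu := (@lebesgue_measure R).
Variable v : R -> R.
Hypothesis dens : twice_continuously_differentiable (fun x => expR (- v x)).

Let g (x : R) : R := expR (- v x).

(** Regularity is assumed of exp(-v) only; it passes to v as minus the logarithm of a positive
    function. *)
Lemma log_density_derive (u : R) : is_derive u 1 v (- (g^`()%classic u / g u)).
Proof.
have dg : derivable g u 1 by exact: dens.1.
have gp : 0 < g u by exact: expR_gt0.
have dlg : is_derive u 1 (fun x => ln (g x)) (g^`()%classic u / g u).
  have d1 : is_derive u 1 g (g^`()%classic u) by rewrite derive1E; exact: derivableP.
  have := @is_derive1_comp _ (@ln R) g u _ _ (is_derive1_ln gp) d1.
  by rewrite mulrC.
rewrite (_ : v = fun x => - ln (g x)); last by apply/funext => x; rewrite /g expRK opprK.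
exact: is_deriveN.
Qed.

Lemma log_density_is_derive (u : R) : is_derive u 1 v (v^`()%classic u).
Proof.
by rewrite derive1E; apply: derivableP; exact: (@ex_derive _ _ _ _ _ _ _ (log_density_derive u)).
Qed.

Lemma log_density_continuous_derive : continuous v^`()%classic.
Proof.
have cg' : continuous g^`()%classic.
  move=> x; apply: differentiable_continuous; apply/derivable1_diffP.
  by have [_ [h _]] := dens; exact: h.
have cg : continuous g.
  move=> x; apply: differentiable_continuous; apply/derivable1_diffP.
  exact: dens.1.
rewrite (_ : v^`()%classic = fun x => - (g^`()%classic x / g x)).
  move=> x; apply: cvgN; apply: cvgM; first exact: cg'.
  by apply: cvgV; [rewrite gt_eqF// expR_gt0|exact: cg].
apply/funext => x; rewrite derive1E; exact: (@derive_val _ _ _ _ _ _ _ (log_density_derive x)).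
Qed.

Section Score.
Context d (T : measurableType d) (P : probability T R) (Z : {mfun T >-> RR}) (M : R).
Hypothesis law : forall B, measurable B -> P (Z @^-1` B) = (\int[mu]_(x in B) (expR (- v x))%:E)%E.
Hypothesis moment :
  ('E_P[fun w => (v^`()%classic (Z w) ^+ 2 * (1 + `|Z w| ^+ 2))%R] <= M%:E)%E.

Lemma score_integral :
  (\int[mu]_u (v^`()%classic u ^+ 2 * (1 + u ^+ 2) * expR (- v u))%:E <= M%:E)%E.
Proof.
have mv1 : @measurable_fun _ _ RR R setT v^`()%classic.
  by apply: continuous_measurable_fun; exact: log_density_continuous_derive.
have mf : measurable_fun setT (fun u : RR => (v^`()%classic u ^+ 2 * (1 + u ^+ 2))%:E).
  apply/measurable_EFinP; apply: measurable_funM; first exact: measurable_funX.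
  by apply: measurable_funD => //; exact: measurable_funX.
have f0 (u : RR) : (0 <= (v^`()%classic u ^+ 2 * (1 + u ^+ 2))%:E)%E.
  by rewrite lee_fin mulr_ge0 ?addr_ge0 ?sqr_ge0.
have mp : @measurable_fun _ _ RR R setT g.
  apply: continuous_measurable_fun => x; apply: differentiable_continuous; apply/derivable1_diffP.
  exact: dens.1.
have lawE A : measurable A -> distribution P Z A = (\int[mu]_(x in A) (g x)%:E)%E.
  exact: law.
have := @ge0_integral_density _ RR R mu (distribution P Z) g mp lawE _ mf f0.
rewrite (@ge0_integral_distribution _ _ _ _ _ P Z _ mf f0) => e.
apply: le_trans moment; rewrite unlock.
have -> : (\int[P]_w (v^`()%classic (Z w) ^+ 2 * (1 + `|Z w| ^+ 2))%:E)%E =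
  (\int[P]_w ((fun u : RR => (v^`()%classic u ^+ 2 * (1 + u ^+ 2))%:E) \o Z) w)%E.
  by apply: eq_integral => w _ /=; rewrite real_normK ?num_real.
by rewrite e le_eqVlt; apply/orP; left; apply/eqP; apply: eq_integral => u _; rewrite EFinM.
Qed.

End Score.
End LogDensity.

(** * Events of the observations and the law of the signal on the grid *)

Section GeneratedEvents.
Context d (T : measurableType d) (R : realType).
Local Notation RR := (measurableTypeR R).

(** Doob-Dynkin factorisation for events: the preimages under the tuple of observations form a
    sigma-field that contains the generators. *)
Lemma generated_event N (Y : 'I_N -> T -> R) (est : T -> R) (B : set R) :
  measurable_wrt (sigma_generated [set: 'I_N] Y) est -> measurable B ->
  exists2 B' : set (N.-tuple RR), measurable B' &
    est @^-1` B = (fun w => [tuple (Y i w : RR) | i < N]) @^-1` B'.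
Proof.
move=> mest mB; set Yt := fun w : T => _ : N.-tuple RR.
have : sigma_generated [set: 'I_N] Y (est @^-1` B) by apply: mest; exists B => //; rewrite setTI.
move: (est @^-1` B).
suff : sigma_generated [set: 'I_N] Y `<=`
    [set S | exists2 B' : set (N.-tuple RR), measurable B' & S = Yt @^-1` B'] by [].
apply: smallest_sub.
  split=> [|S [S' mS ->]|F HF].
  - by exists set0 => //; rewrite preimage_set0.
  - by exists (~` S'); [exact: measurableC|rewrite setTD preimage_setC].
  - have /choice[G HG] : forall k, exists B' : set (N.-tuple RR), measurable B' /\ F k = Yt @^-1` B'.
      by move=> k; have [B' mB' e] := HF k; exists B'.
    exists (\bigcup_k G k); first by apply: bigcup_measurable => k _; case: (HG k).
    by rewrite preimage_bigcup; apply: eq_bigcup => // k _; case: (HG k).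
move=> S [i _ [A mA <-]]; exists ((fun t => tnth t i) @^-1` A).
  by rewrite -[X in measurable X]setTI; exact: measurable_tnth.
by rewrite setTI; apply/seteqP; split => w /=; rewrite tnth_mktuple.
Qed.

End GeneratedEvents.

Section FbmLaw.
Context d (T : measurableType d) (R : realType).
Local Notation RR := (measurableTypeR R).
Variables (P : probability T R) (H : R) (W : R -> {mfun T >-> R}).
Hypothesis hW : fbm P H W.

Lemma fbm_sqr_integrable t : 0 <= t -> P.-integrable setT (fun w => (W t w ^+ 2)%:E).
Proof.
move=> t0; have [g _ _ _] := hW.
have mW : @measurable_fun _ _ T RR setT (W t) by exact: (measurable_funPT (W t)).
pose Wt : {mfun T >-> RR} := @mfun_Sub _ _ T RR _ (mem_set mW).
have gW : gaussian P Wt.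
  have := g 1%N (fun=> t) (fun=> 1) (fun=> t0); congr (gaussian P _).
  by apply/funext => w; rewrite big_ord1 mul1r.
by have [] := gaussian_facts gW.
Qed.

Lemma fbm_integrable t : 0 <= t -> P.-integrable setT (EFin \o W t).
Proof.
move=> t0.
have := integrableD measurableT (bmeas_integrable P (bmeas_cst _ 1)) (fbm_sqr_integrable t0).
apply: le_integrable => //; first exact/measurable_EFinP.
move=> w _; rewrite /= lee_fin [leRHS]ger0_norm ?addr_ge0 ?sqr_ge0//.
exact: norm_le_1sqr.
Qed.

Lemma fbm_mean t : 0 <= t -> \int[P]_w W t w = 0.
Proof.
move=> t0; have [_ m _ _] := hW; have := m t t0; rewrite unlock /Rintegral => e.
by rewrite e.
Qed.

Lemma fbm_prod s t : 0 <= s -> 0 <= t -> \int[P]_w (W s w * W t w) = fbm_cov H s t.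
Proof.
move=> s0 t0; have [_ m c _] := hW; have := c s t s0 t0.
rewrite covariance.unlock (m s s0) (m t t0) unlock => e.
rewrite /Rintegral (_ : (\int[P]_w _)%E = (fbm_cov H s t)%:E)// -e.
apply: eq_integral => w _ /=; congr EFin.
transitivity ((W s w - 0) * (W t w - 0)) => //; by rewrite !subr0.
Qed.

End FbmLaw.

Section ScaledFbmLaw.
Context d (T : measurableType d) (R : realType).
Local Notation RR := (measurableTypeR R).
Variables (P : probability T R) (H s : R) (X : R -> {mfun T >-> R}).
Hypothesis hX : scaled_fbm P H s X.

(** Self-similarity: the step 1 / n factors out as n^(-2H). *)
Lemma grid_cov n i i' : (0 < n)%N ->
  fbm_cov H (i%:R / n%:R) (i'%:R / n%:R) =
  kappa H / 2 * n%:R `^ (- (2 * H)) *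
    (pw (2 * H) i + pw (2 * H) i' - pw (2 * H) (distn i i')).
Proof.
move=> n0; have n0R : 0 < n%:R :> R by rewrite ltr0n.
have E (k : nat) : (k%:R / n%:R) `^ (2 * H) = n%:R `^ (- (2 * H)) * pw (2 * H) k :> R.
  rewrite /pw mulrC powRM ?invr_ge0//; congr (_ * _).
  by rewrite -(powR_inv1 (ltW n0R)) -powRrM mulN1r.
have D : `|i%:R / n%:R - i'%:R / n%:R| = (distn i i')%:R / n%:R :> R.
  rewrite -mulrBl normrM (gtr0_norm (_ : 0 < n%:R^-1)) ?invr_gt0//; congr (_ / _).
  rewrite /distn; have [h|h] := leqP i i'.
    rewrite (eqP (h : (i - i')%N == 0%N)) add0n natrB// distrC ger0_norm// subr_ge0 ler_nat//.
  have /eqP -> : (i' - i)%N == 0%N by rewrite subn_eq0 ltnW.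
  by rewrite addn0 natrB ?(ltnW h)// ger0_norm// subr_ge0 ler_nat ltnW.
rewrite /fbm_cov (distrC (i'%:R / _)) D !ger0_norm ?divr_ge0// !E; ring.
Qed.

Lemma scaled_fbm_grid_law n K (A : nat -> nat -> R) (r : nat -> R) : (0 < n)%N ->
  (forall i i', (i <= n)%N -> (i' <= n)%N ->
    s ^+ 2 * kappa H / 2 * n%:R `^ (- (2 * H)) *
      (pw (2 * H) i + pw (2 * H) i' - pw (2 * H) (distn i i')) =
    \sum_(q < K) r q ^+ 2 * (A q i * A q i')) ->
  (forall q, r q != 0) ->
  forall B, measurable B ->
  distribution P (random_tuple (fun i : 'I_n.+1 => X (i%:R / n%:R))) B =
  distribution (tprod K (normals r)) (@linmap R K n.+1 A) B.
Proof.
move=> n0 HA r0.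
have [W hW XE] := hX.
have t0 (i : 'I_n.+1) : 0 <= i%:R / n%:R :> R by rewrite divr_ge0.
apply: gaussian_vector_law => //.
- move=> c; have [g _ _ _] := hW.
  have := g _ (fun i : 'I_n.+1 => i%:R / n%:R) (fun i => c i * s) t0.
  congr (gaussian P _); apply/funext => w; apply: eq_bigr => i _.
  by rewrite XE ?divr_ge0// mulrA.
- move=> i; under eq_Rintegral do rewrite XE//.
  by rewrite RintegralZl// ?(fbm_mean hW)// ?mulr0//; exact: (fbm_integrable hW).
- move=> i j; under eq_Rintegral do rewrite !XE// mulrACA -expr2.
  rewrite RintegralZl//; last by apply: integrable_prod_sqr; exact: (fbm_sqr_integrable hW).
  rewrite (fbm_prod hW)// grid_cov// -HA; try by rewrite -ltnS.
  by ring.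
Qed.

End ScaledFbmLaw.

Section Transport.
Variable R : realType.

(** Carries families indexed by a frequency and a boolean to the [nat] indices of [tprod]. The value
    [x0] fills the indices beyond the cardinal; it is 1 for the scales, which thus stay positive
    everywhere. *)
Definition transport (I : finType) (S : Type) (x0 : S) (f : I -> S) (q : nat) : S :=
  if insub q is Some j then f (enum_val (j : 'I_#|I|)) else x0.

Lemma transportP (I : finType) (S : Type) (x0 : S) (f : I -> S) (Q : S -> Prop) :
  Q x0 -> (forall i, Q (f i)) -> forall q, Q (transport x0 f q).
Proof. by move=> h0 h q; rewrite /transport; case: insubP => //. Qed.

Lemma sum_transport (I : finType) (S S' : Type) (x0 : S) (x0' : S') f f' (F : S -> S' -> R) :
  \sum_(q < #|I|) F (transport x0 f q) (transport x0' f' q) = \sum_(i : I) F (f i) (f' i).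
Proof.
rewrite [RHS](reindex (@enum_val I xpredT))/=; last first.
  by apply: onW_bij; exact: enum_val_bij.
by apply: eq_bigr => q _; rewrite /transport valK.
Qed.

End Transport.

(** * Choice of the alternative parameter *)

Section ParameterPath.
Variable R : realType.

Lemma near_ln_ge (A : R) : \forall n \near \oo, A <= ln (n%:R : R).
Proof.
near=> n; have h : expR A <= n%:R by near: n; exact: nbhs_infty_ger.
by rewrite -(expRK A) ler_ln// posrE ?expR_gt0// (lt_le_trans (expR_gt0 A)).
Unshelve. all: by end_near. Qed.

Lemma expR_ge_sqr (y : R) : 0 <= y -> y ^+ 2 / 4 <= expR y.
Proof.
move=> y0; have h := expR_ge1Dx (y / 2).
have -> : expR y = expR (y / 2) ^+ 2 by rewrite -expRM_natl; congr expR; field.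
have p := expR_gt0 (y / 2).
apply: (@le_trans _ _ ((1 + y / 2) ^+ 2)); first by nra.
by rewrite lerXn2r ?nnegrE//; lra.
Qed.

Variable b : R.
Hypothesis b0 : 0 < b.

Let y (n : nat) : R := ln n%:R / b.

Lemma cvg_inv_power : expR (- y n) @[n --> \oo] --> (0 : R).
Proof.
apply/cvgr0Pnorm_le => e e0; near=> n.
have h : b * e^-1 <= ln (n%:R : R) by near: n; exact: near_ln_ge.
have hy : e^-1 <= y n by rewrite /y ler_pdivlMr// mulrC.
have ei : 0 < e^-1 by rewrite invr_gt0.
rewrite ger0_norm ?expR_ge0// expRN.
have := expR_ge1Dx (y n) => h2.
rewrite -(invrK e) lef_pV2 ?posrE ?expR_gt0//; lra.
Unshelve. all: by end_near. Qed.

(** The product eps log n tends to 0, which is why a power of N with exponent of order eps tends to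
    1 although N grows. *)
Lemma cvg_log_inv_power : expR (- y n) * y n @[n --> \oo] --> (0 : R).
Proof.
apply/cvgr0Pnorm_le => e e0; near=> n.
have h : b * (4 * e^-1) <= ln (n%:R : R) by near: n; exact: near_ln_ge.
have hy : 4 * e^-1 <= y n by rewrite /y ler_pdivlMr// mulrC.
have ei : 0 < e^-1 by rewrite invr_gt0.
have y0 : 0 < y n by lra.
have nn : 0 <= expR (- y n) * y n by rewrite mulr_ge0 ?expR_ge0 ?(ltW y0).
rewrite (ger0_norm nn) expRN mulrC ler_pdivrMr ?expR_gt0//.
have := expR_ge_sqr (ltW y0) => h2.
apply: (@le_trans _ _ (e * (y n ^+ 2 / 4))); last by rewrite ler_wpM2l// ltW.
have -> : e * (y n ^+ 2 / 4) = y n * (e * y n / 4) by field.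
rewrite ler_peMr ?(ltW y0)// ler_pdivlMr// mul1r.
by rewrite -ler_pdivrMl// mulrC.
Unshelve. all: by end_near. Qed.

End ParameterPath.

(** The last equation dictates s1. With x = exp(-y) and y = ln n / (4 H0 + 2), N is exp(2 y) and 2
    H1 - 2 H0 is - 4 c x, so the power of N equals exp(- 8 c x y). *)
Lemma alternative_parameter (R : realType) (H0 s0 delta d0 c : R) :
  1 / 2 < H0 < 1 -> 0 < s0 -> 0 < delta -> 0 < d0 -> 0 < c ->
  \forall n \near \oo,
    let x := n%:R `^ (- (1 / (4 * H0 + 2))) in
    let H1 := H0 - 2 * c * x in
    exists s1, [/\ `|H1 - H0| < delta, `|s1 - s0| < delta, `|2 * H1 - 2 * H0| <= d0 &
      s1 ^+ 2 * kappa H1 = s0 ^+ 2 * kappa H0 * (n%:R `^ (1 / (2 * H0 + 1))) `^ (2 * H1 - 2 * H0)].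
Proof.
move=> hH s00 de0 d00 c0; have /andP[h1 h2] := hH.
pose b := 4 * H0 + 2; have b0 : 0 < b by rewrite /b; lra.
pose y (n : nat) : R := ln n%:R / b.
pose x n := expR (- y n).
have cx : x n @[n --> \oo] --> (0 : R) := cvg_inv_power b0.
have cxy : x n * y n @[n --> \oo] --> (0 : R) := cvg_log_inv_power b0.
have cH : H0 - 2 * c * x n @[n --> \oo] --> H0.
  rewrite -[X in _ --> X]subr0 -[X in _ --> _ - X](mulr0 (2 * c)).
  apply: cvgB; first exact: cvg_cst.
  by apply: cvgM; [exact: cvg_cst|exact: cx].
pose q n := kappa H0 / kappa (H0 - 2 * c * x n) * expR (- (8 * c * (x n * y n))).
have ck : kappa (H0 - 2 * c * x n) @[n --> \oo] --> kappa H0.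
  by apply: (@continuous_cvg _ _ _ _ _ _ (@kappa R)) => //; exact: kappa_continuous.
have k0 := kappa_gt0 hH.
have cq : q n @[n --> \oo] --> (1 : R).
  have -> : 1 = kappa H0 / kappa H0 * expR (- (8 * c * 0)) by rewrite mulr0 oppr0 expR0 mulr1 divff// gt_eqF.
  apply: cvgM.
    by apply: cvgM; [exact: cvg_cst|apply: cvgV => //; rewrite gt_eqF].
  apply: (@continuous_cvg _ _ _ _ _ _ (@expR R)); first exact: continuous_expR.
  by apply: cvgN; apply: cvgM; [exact: cvg_cst|exact: cxy].
have cs : s0 * Num.sqrt (q n) @[n --> \oo] --> s0.
  have e : s0 = s0 * Num.sqrt 1 by rewrite sqrtr1 mulr1.
  rewrite [X in _ --> X]e.
  apply: cvgM; first exact: cvg_cst.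
  apply: (@continuous_cvg _ _ _ _ _ _ (@Num.sqrt R)) => //; exact: sqrt_continuous.
have half_gt : 0 < H0 - 1 / 2 by lra.
near=> n.
have n0 : (0 < n)%N by near: n; exact: nbhs_infty_gt.
have n0R : 0 < n%:R :> R by rewrite ltr0n.
have xE : n%:R `^ (- (1 / (4 * H0 + 2))) = x n.
  by rewrite powR_eq_expR// /x /y /b; congr expR; field; rewrite gt_eqF.
rewrite xE; set H1 := H0 - _.
have NE : (n%:R `^ (1 / (2 * H0 + 1))) `^ (2 * H1 - 2 * H0) = expR (- (8 * c * (x n * y n))).
  rewrite -powRrM powR_eq_expR//; congr expR; rewrite /H1 /y /b; field.
  by apply/andP; split; rewrite gt_eqF//; lra.
exists (s0 * Num.sqrt (q n)).
have hd : `|H0 - (H0 - 2 * c * x n)| < Num.min delta (Num.min (d0 / 2) (H0 - 1 / 2)).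
  near: n; move/cvgrPdist_lt : cH; apply.
  by rewrite !lt_min de0 half_gt divr_gt0.
move: hd; rewrite !lt_min distrC => /and3P[hd1 hd2 hd3].
have x0 : 0 < x n by exact: expR_gt0.
have cx0 : 0 < 2 * c * x n by rewrite !mulr_gt0.
have hH1 : 1 / 2 < H1 < 1.
  by move: hd3; rewrite -/H1 ltr_norml /H1 => /andP[]; lra.
have k1 := kappa_gt0 hH1.
split=> //.
- by rewrite distrC; near: n; move/cvgrPdist_lt : cs; apply.
- by rewrite -mulrBr normrM ger0_norm//; move: hd2; rewrite -/H1; lra.
- rewrite exprMn sqr_sqrtr; last by rewrite /q mulr_ge0 ?expR_ge0// divr_ge0// ltW.
  rewrite NE /q -/H1; field; by rewrite gt_eqF.
Unshelve. all: by end_near. Qed.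

(** * The statistical experiment and the lower bound *)

Section Experiment.
Context (R : realType) (disp : measure_display) (T : measurableType disp).
Local Notation RR := (measurableTypeR R).
Notation mu := (@lebesgue_measure R).
Variables (D : set (R * R)) (P : nat -> R * R -> probability T R).
Variables (X : R -> {mfun T >-> R}) (xi : forall n : nat, 'I_n.+1 -> {mfun T >-> R}).
Variables (a : R -> R) (v : forall n : nat, 'I_n.+1 -> R -> R).
Hypothesis hX : forall n : nat, (0 < n)%N -> forall H sigma : R, D (H, sigma) ->
     scaled_fbm (P n (H, sigma)) H sigma X.
Hypothesis aC1 : continuously_differentiable a.
Hypothesis hB : assumption_B D P X (@xi) a (@v).
Variables (am L M : R).
Hypotheses (am0 : 0 < am) (aam : forall x, am <= a x) (a1L : forall x, `|a^`()%classic x| <= L).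
Hypotheses (M0 : 0 <= M) (hM : forall n, (0 < n)%N -> forall (i : 'I_n.+1) theta, D theta ->
      ('E_(P n theta)[fun w =>
         ((@v n i)^`()%classic (@xi n i w) ^+ 2 * (1 + `|@xi n i w| ^+ 2))%R] <= M%:E)%E).

Let da (x : R) : is_derive x 1 a (a^`()%classic x).
Proof. by rewrite derive1E; apply: derivableP; exact: aC1.1. Qed.

Let conta : continuous a.
Proof. by move=> x; apply: differentiable_continuous; apply/derivable1_diffP; exact: aC1.1. Qed.

Let ma : @measurable_fun _ _ RR RR setT a.
Proof. exact: continuous_measurable_fun. Qed.

Variable n : nat.
Hypothesis n0 : (0 < n)%N.

Let Z (i : 'I_n.+1) : {mfun T >-> R} := X (i%:R / n%:R).
Let eps (i : 'I_n.+1) : {mfun T >-> R} := @xi n i.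

Lemma observation_perturb (w : T) :
  [tuple (observation X (@xi) a (n := n) i w : RR) | i < n.+1] =
  perturb a (random_tuple Z w) (random_tuple eps w).
Proof. by apply: eq_from_tnth => i; rewrite !tnth_mktuple. Qed.

Lemma measurable_observation_perturb :
  measurable_fun setT (fun w => perturb a (random_tuple Z w) (random_tuple eps w)).
Proof. exact: (measurableT_comp (measurable_perturb ma) (measurable_signal_noise Z eps)). Qed.

Lemma estimator_event est (B : set R) : estimator X (@xi) a n est -> measurable B ->
  exists2 B' : set (n.+1.-tuple RR), measurable B' &
    est @^-1` B = (fun w => perturb a (random_tuple Z w) (random_tuple eps w)) @^-1` B'.
Proof.
move=> hest mB; have [B' mB' e] := generated_event hest mB.
by exists B' => //; rewrite e; apply/seteqP; split => w /=; rewrite observation_perturb.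
Qed.

Lemma measurable_estimator_event est (B : set R) : estimator X (@xi) a n est -> measurable B ->
  measurable (est @^-1` B).
Proof.
move=> hest mB; have [B' mB' ->] := estimator_event hest mB.
by rewrite -[X in measurable X]setTI; exact: measurable_observation_perturb.
Qed.

Let RRfun (Y : {mfun T >-> R}) : {mfun T >-> RR} :=
  @mfun_Sub _ _ T RR _ (mem_set (measurable_funPT Y : @measurable_fun _ _ T RR setT Y)).

(** The density hypothesis makes this law the same for all parameters in D; indices beyond n receive
    a point mass. *)
Definition noise_law (theta : R * R) (k : nat) : probability RR R :=
  if insub k is Some i then distribution (P n theta) (RRfun (eps i)) else \d_(0 : RR).

Lemma noise_law_density theta (i : 'I_n.+1) A : D theta -> measurable A ->
  noise_law theta i A = (\int[mu]_(x in A) (expR (- @v n i x))%:E)%E.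
Proof.
move=> Dt mA; rewrite /noise_law valK.
exact: (cond_density_law (B_density hB n0 i Dt) mA).
Qed.

Lemma noise_aff theta i x x' : D theta -> (i < n.+1)%N ->
  aff_bound (noisy a (noise_law theta i) x) (noisy a (noise_law theta i) x')
    (Num.max 0 (1 - noise_rate am L M * (x - x') ^+ 2)).
Proof.
move=> Dt hi; pose j := Ordinal hi.
have dens := B_C2 hB n0 j.
have sc : (\int[mu]_u ((@v n j)^`()%classic u ^+ 2 * (1 + u ^+ 2) * expR (- @v n j u))%:E <= M%:E)%E.
  apply: (score_integral dens (P := P n theta) (Z := RRfun (eps j))); last exact: hM.
  move=> B mB; exact: (cond_density_law (B_density hB n0 j Dt) mB).
have nuE A : measurable A -> noise_law theta i A = (\int[mu]_(x in A) (expR (- @v n j x))%:E)%E.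
  by move=> mA; exact: (noise_law_density j Dt mA).
exact: (noisy_aff_bound (log_density_is_derive dens) (log_density_continuous_derive dens)
  da aC1.2 am0 aam a1L nuE M0 sc).
Qed.

Lemma experiment_aff H0 s0 H1 s1 K (A0 A1 : nat -> nat -> R) (r : nat -> R) est (B : set R) :
  D (H0, s0) -> D (H1, s1) ->
  (forall q, 0 < r q) ->
  (forall i i', (i <= n)%N -> (i' <= n)%N ->
    s0 ^+ 2 * kappa H0 / 2 * n%:R `^ (- (2 * H0)) *
      (pw (2 * H0) i + pw (2 * H0) i' - pw (2 * H0) (distn i i')) =
    \sum_(q < K) A0 q i * A0 q i') ->
  (forall i i', (i <= n)%N -> (i' <= n)%N ->
    s1 ^+ 2 * kappa H1 / 2 * n%:R `^ (- (2 * H1)) *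
      (pw (2 * H1) i + pw (2 * H1) i' - pw (2 * H1) (distn i i')) =
    \sum_(q < K) r q ^+ 2 * (A1 q i * A1 q i')) ->
  \sum_(q < K) (1 - r q) ^+ 2 <= 1 ->
  2 * noise_rate am L M * \sum_(q < K) \sum_(i < n.+1) (A0 q i - A1 q i) ^+ 2 <= 1 ->
  estimator X (@xi) a n est -> measurable B ->
  (1 - \sum_(q < K) (1 - r q) ^+ 2) *
  (1 - 2 * noise_rate am L M * \sum_(q < K) \sum_(i < n.+1) (A0 q i - A1 q i) ^+ 2) <=
  aff (fine (P n (H0, s0) (est @^-1` B))) (fine (P n (H1, s1) (est @^-1` B))).
Proof.
move=> D0 D1 r0 cov0 cov1 hS1 hS2 hest mB.
have [B' mB' ->] := estimator_event hest mB.
have tB := @test_indic _ _ R B' mB'.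
have t0 (i : 'I_n.+1) : 0 <= i%:R / n%:R :> R by rewrite divr_ge0.
(* The noise law at (H0, s0) is used for both parameters, as the conditional densities do not depend
   on them. *)
have joint H s : D (H, s) -> forall (A : set (n.+1.-tuple RR)) (b : 'I_n.+1 -> R), measurable A ->
    P n (H, s) (random_tuple Z @^-1` A `&` random_tuple eps @^-1` hbox b) =
    (P n (H, s) (random_tuple Z @^-1` A) * tprod n.+1 (noise_law (H0, s0)) (hbox b))%E.
  move=> Ds; apply: (cond_noise_joint t0 (B_independent hB n0 Ds) (fun i => B_density hB n0 i Ds)).
  by move=> i A mA; exact: noise_law_density.
have law0 := scaled_fbm_grid_law (hX n0 D0) (A := A0) (r := fun=> 1) (K := K) n0.
have law1 := scaled_fbm_grid_law (hX n0 D1) (A := A1) (r := r) (K := K) n0 cov1.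
have E H s : \int[P n (H, s)]_w \1_B' (perturb a (random_tuple Z w) (random_tuple eps w)) =
    fine (P n (H, s) ((fun w => perturb a (random_tuple Z w) (random_tuple eps w)) @^-1` B')).
  rewrite (Rint_indic (P n (H, s))); last first.
    by rewrite -[X in measurable X]setTI; exact: measurable_observation_perturb.
  by [].
rewrite -!E.
apply: (two_point_aff ma (joint _ _ D0) (joint _ _ D1) _ _ r0 _ _ tB hS1 hS2).
- apply: law0 => [i i' hi hi'|q]; last exact: oner_neq0.
  by rewrite cov0//; apply: eq_bigr => q _; rewrite expr1n mul1r.
- by apply: law1 => q; rewrite gt_eqF.
- by apply: (noise_rate_ge0 _ _ M0).
- by move=> i x x' hi; exact: noise_aff.
Qed.

End Experiment.

Lemma limn_einf_ge (R : realType) (u : (\bar R)^nat) (l : \bar R) :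
  (\forall n \near \oo, (l <= u n)%E) -> (l <= limn_einf u)%E.
Proof.
move=> [n0 _ H]; rewrite limn_einf_lim; apply: lime_ge.
  exact: is_cvg_einfs.
near=> n; rewrite /einfs; apply: le_ereal_inf_tmp => _ [k /= nk <-].
apply: H => /=; apply: leq_trans nk; near: n; exact: nbhs_infty_ge.
Unshelve. all: by end_near. Qed.

Lemma interior_square (R : realType) (D : set (R * R)) : interior D !=set0 ->
  exists H0 s0 delta : R, 0 < delta /\
    forall H s, `|H - H0| < delta -> `|s - s0| < delta -> D (H, s).
Proof.
move=> [[H0 s0]] [[A B] /= [/nbhs_ballP[e1 e10 hA] /nbhs_ballP[e2 e20 hB]] sub].
exists H0, s0, (Num.min e1 e2); split; first by rewrite lt_min e10 e20.
move=> H s; rewrite !lt_min => /andP[h1 _] /andP[_ h2]; apply: sub; split => /=.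
- by apply: hA; rewrite /ball /= distrC.
- by apply: hB; rewrite /ball /= distrC.
Qed.

Lemma far_set (R : realType) (c u h : R) : 0 < u ->
  [set z : R | c <= u * `|z - h|] = ~` `]h - c / u, h + c / u[%classic.
Proof.
move=> u0; apply/seteqP; split => z /=; rewrite in_itv/= -ltr_distl.
  by move=> h1; apply/negP; rewrite -leNgt ler_pdivrMr// mulrC.
by move/negP; rewrite -leNgt ler_pdivrMr// mulrC.
Qed.

(** The extreme case is (1 - 1/4) (1 - 1/3) = 1/2, the affinity required by [aff_half]. *)
Lemma half_le_mul_1sub (R : realFieldType) (s t : R) :
  s <= 4^-1 -> t <= 3^-1 -> 2^-1 <= (1 - s) * (1 - t).
Proof. by move=> hs ht; nra. Qed.

Theorem theorem2 (R : realType) (Hm Hp sm sp : R) (D : set (R * R))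
  (hD : D = `[Hm, Hp] `*` `[sm, sp])
  (hDsub : D `<=` `]2^-1, 1[ `*` `]0, +oo[)
  (hDint : interior D !=set0)
  (disp : measure_display) (T : measurableType disp)
  (P : nat -> R * R -> probability T R)
  (X : R -> {mfun T >-> R})
  (xi : forall n : nat, 'I_n.+1 -> {mfun T >-> R})
  (a : R -> R)
  (F : nat -> R -> set_system T)
  (v : forall n : nat, 'I_n.+1 -> R -> R)
  (hX : forall n : nat, (0 < n)%N -> forall H sigma : R, D (H, sigma) ->
     scaled_fbm (P n (H, sigma)) H sigma X)
  (hA : assumption_A D P X xi a F)
  (hB : assumption_B D P X xi a v) :
  exists c : R, 0 < c /\
    (0 < limn_einf (fun n : nat =>
       ereal_inf [set
         ereal_sup [set
           P n theta [set w | (c <= n%:R `^ (1 / (4 * theta.1 + 2))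
                                    * `|est w - theta.1|)%R]
           | theta in D]
         | est in estimator X xi a n]))%E.
Proof.
have [H0 [s0 [delta [delta0 hD0]]]] := interior_square hDint.
have D0 : D (H0, s0) by apply: hD0; rewrite subrr normr0.
have D_range H s : D (H, s) -> 1 / 2 < H < 1 /\ 0 < s.
  move=> /hDsub [] /=; rewrite !in_itv/= andbT => /andP[h1 h2] h3.
  by split=> //; apply/andP; split; lra.
have [hH0 s00] := D_range _ _ D0; have /andP[hHl hHr] := hH0.
have [[am am0 aam] [L aL] [M M0 hM]] :
  [/\ exists2 am : R, 0 < am & forall x, am <= a x,
      exists L : R, forall x, `|a^`()%classic x| <= L &
      exists2 M : R, 0 <= M & forall n, (0 < n)%N -> forall (i : 'I_n.+1) theta, D theta ->
      ('E_(P n theta)[fun w =>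
         ((v n i)^`()%classic (xi n i w) ^+ 2 * (1 + `|xi n i w| ^+ 2))%R] <= M%:E)%E].
  split.
  - exists (inf (range a)); first exact: B_inf hB.
    move=> x; apply: ge_inf; last by exists x.
    have [K [_ hK]] := A_bounded hA.
    (* Boundedness speaks of the bounds strictly above K, hence K + 1; a lower bound of the range is
       what makes its infimum a true lower bound. *)
    exists (- (K + 1)) => _ [z _ <-].
    have := hK (K + 1) _ z I; rewrite ltrDl ltr01 => /(_ isT).
    by rewrite /= ler_norml => /andP[].
  - have [K [_ hK]] := A_bounded_derivative hA.
    by exists (K + 1) => x; apply: hK => //; rewrite ltrDl.
  - have [M hM] := B_score_moment hB.
    exists (Num.max M 0); first by rewrite le_max lexx orbT.
    move=> n n0 i theta Dt; apply: le_trans (hM n n0 i theta Dt) _.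
    by rewrite lee_fin le_max lexx.
pose Cn := noise_rate am L M.
have Cn0 : 0 <= Cn by exact: (noise_rate_ge0 _ _ M0).
have k0 := kappa_gt0 hH0.
pose V := s0 ^+ 2 * kappa H0.
have V0 : 0 < V by rewrite mulr_gt0// exprn_gt0.
have p0r : 1 < 2 * H0 < 2 by apply/andP; split; lra.
have [C [d0 [C0 d00 pair]]] := gaussian_pair p0r V0.
(* 96 = 3 * 32 makes the noise cost 2 Cn * 16 C c^2 at most 1/3 and the variance cost 16 C c^2 at
   most 1/6; the minimum with 1 gives c^2 <= c. *)
pose c := Num.min 1 (96 * C * (1 + Cn))^-1.
have cc0 : 0 < 96 * C * (1 + Cn) by rewrite !mulr_gt0//; lra.
have c0 : 0 < c by rewrite lt_min ltr01 invr_gt0.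
have c1 : c ^+ 2 * (96 * C * (1 + Cn)) <= 1.
  have h1 : c <= 1 by rewrite ge_min lexx.
  have h2 : c * (96 * C * (1 + Cn)) <= 1.
    by rewrite -ler_pdivlMr// mul1r ge_min lexx orbT.
  apply: le_trans h2; rewrite ler_wpM2r ?(ltW cc0)//.
  by rewrite expr2 ler_piMl// ltW.
exists c; split=> //.
apply: (@lt_le_trans _ _ (16^-1)%:E); first by rewrite lte_fin invr_gt0.
apply: limn_einf_ge.
have := alternative_parameter hH0 s00 delta0 d00 c0.
apply: filterS2 (nbhs_infty_ge 3) => n /= n3.
set x := n%:R `^ _; set H1 := H0 - _ => -[s1 [h1 hs1 hd e1]].
have n0 : (0 < n)%N by exact: leq_trans n3.
have n0R : 0 < n%:R :> R by rewrite ltr0n.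
have n1R : 1 <= n%:R :> R by rewrite ler1n.
have D1 : D (H1, s1) by exact: hD0.
have [hH1 s10] := D_range _ _ D1; have /andP[hH1l hH1r] := hH1.
pose N : R := n%:R `^ (1 / (2 * H0 + 1)).
have N1 : 1 <= N.
  rewrite /N -[leLHS](powRr0 (n%:R : R)); apply: powR_gt0_le => //.
  by rewrite divr_ge0//; clear - hHl; lra.
have NE : N `^ (2 * H0 + 1) = n%:R.
  rewrite /N -powRrM (_ : _ * _ = 1); first by rewrite powRr1// ltW.
  by field; rewrite gt_eqF//; clear - hHl; lra.
have p1r : 0 < 2 * H1 <= 2 by clear - hH1l hH1r; apply/andP; split; lra.
have [A0 [A1 [r [r0 cov0 cov1 S1 S2]]]] := pair n N (2 * H1) n3 N1 NE p1r hd.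
have x0 : 0 < x by exact: powR_gt0.
(* The balance that fixes the rate: the number N of informative frequencies times the square of the
   separation does not depend on n. *)
have xN : x ^+ 2 * N = 1.
  rewrite -powR_mulrn ?(ltW x0)// /x /N -powRrM -powR_addr// (_ : _ + _ = 0) ?powRr0//.
  by field; clear - hHl; apply/andP; split; rewrite gt_eqF//; lra.
have bd : C * (2 * H1 - 2 * H0) ^+ 2 * N = 16 * C * c ^+ 2.
  transitivity (16 * C * c ^+ 2 * (x ^+ 2 * N)); last by rewrite xN mulr1.
  by rewrite /H1; ring.
rewrite bd in S1 S2.
pose A0' q (i : nat) : R := transport (fun=> 0) A0 q i.
pose A1' q (i : nat) : R := transport (fun=> 0) A1 q i.
pose r' : nat -> R := transport 1 r.
pose K := #|{: 'I_(2 * n) * bool}|.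
have r0' q : 0 < r' q by exact: (transportP (Q := fun t => 0 < t)).
have S1E : \sum_(q < K) (1 - r' q) ^+ 2 = \sum_q (1 - r q) ^+ 2.
  exact: (sum_transport 1 tt r (fun=> tt) (fun t _ => (1 - t) ^+ 2)).
have S2E : \sum_(q < K) \sum_(i < n.+1) (A0' q i - A1' q i) ^+ 2 =
    \sum_q \sum_(i < n.+1) (A0 q i - A1 q i) ^+ 2.
  exact: (sum_transport (fun=> 0) (fun=> 0) A0 A1
    (fun f f' => \sum_(i < n.+1) (f i - f' i) ^+ 2)).
have CnC : 0 <= C * Cn * c ^+ 2 by rewrite mulr_ge0 ?sqr_ge0// mulr_ge0// ltW.
have Cc : 0 <= C * c ^+ 2 by rewrite mulr_ge0 ?sqr_ge0// ltW.
have S1' : \sum_(q < K) (1 - r' q) ^+ 2 <= 4^-1.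
  by rewrite S1E; apply: le_trans S1 _; clear - c1 Cc CnC; lra.
have S2' : 2 * Cn * \sum_(q < K) \sum_(i < n.+1) (A0' q i - A1' q i) ^+ 2 <= 3^-1.
  rewrite S2E; apply: (@le_trans _ _ (2 * Cn * (16 * C * c ^+ 2))).
    by rewrite ler_wpM2l// mulr_ge0.
  by clear - c1 Cc CnC; lra.
apply: le_ereal_inf_tmp => _ [est hest <-].
have K1 : \sum_(q < K) (1 - r' q) ^+ 2 <= 1 by apply: le_trans S1' _; clear - R; lra.
have K2 : 2 * Cn * \sum_(q < K) \sum_(i < n.+1) (A0' q i - A1' q i) ^+ 2 <= 1.
  by apply: le_trans S2' _; clear - R; lra.
have cov0' i i' : (i <= n)%N -> (i' <= n)%N ->
    s0 ^+ 2 * kappa H0 / 2 * n%:R `^ (- (2 * H0)) *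
      (pw (2 * H0) i + pw (2 * H0) i' - pw (2 * H0) (distn i i')) =
    \sum_(q < K) A0' q i * A0' q i'.
  move=> hi hi'; rewrite (cov0 _ _ hi hi').
  exact: (esym (sum_transport (fun=> 0) tt A0 (fun=> tt) (fun f _ => f i * f i'))).
have cov1' i i' : (i <= n)%N -> (i' <= n)%N ->
    s1 ^+ 2 * kappa H1 / 2 * n%:R `^ (- (2 * H1)) *
      (pw (2 * H1) i + pw (2 * H1) i' - pw (2 * H1) (distn i i')) =
    \sum_(q < K) r' q ^+ 2 * (A1' q i * A1' q i').
  move=> hi hi'; rewrite e1 (cov1 _ _ hi hi').
  exact: (esym (sum_transport 1 (fun=> 0) r A1 (fun t f => t ^+ 2 * (f i * f i')))).
pose u H : R := n%:R `^ (1 / (4 * H + 2)).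
have u0 H : 0 < u H by exact: powR_gt0.
(* The values that are accurate for H0. By the affinity bound, either missing B is likely under (H0,
   s0) or hitting B is likely under (H1, s1). *)
pose B : set R := `]H0 - c / u H0, H0 + c / u H0[%classic.
have mB : measurable B by exact: measurable_itv.
have mest S : measurable S -> measurable (est @^-1` S) := measurable_estimator_event (A_C1 hA) hest.
have := experiment_aff hX (A_C1 hA) hB am0 aam aL M0 hM n0 D0 D1 r0' cov0' cov1' K1 K2 hest mB.
set pr0 := fine _; set pr1 := fine _ => ineq.
have prob01 theta : 0 <= fine (P n theta (est @^-1` B)) <= 1.
  have f := fin_num_measure (P n theta) _ (mest _ mB).
  by rewrite fine_ge0//= -lee_fin (fineK f) (probability_le1 _ (mest _ mB)).
have half : 2^-1 <= aff pr0 pr1.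
  by apply: le_trans ineq; exact: half_le_mul_1sub S1' S2'.
have xu : x * u H0 = 1.
  by rewrite /x /u -powR_addr// addNr powRr0.
have sup_ge theta : D theta -> (16^-1%:E <= P n theta [set w | (c <= u theta.1 * `|est w - theta.1|)%R])%E ->
    (16^-1%:E <= ereal_sup [set P n theta [set w | (c <= n%:R `^ (1 / (4 * theta.1 + 2)) *
       `|est w - theta.1|)%R] | theta in D])%E.
  by move=> Dt h; apply: le_trans h _; apply: ereal_sup_ubound; exists theta.
have far H : [set w | c <= u H * `|est w - H|] =
    est @^-1` (~` `]H - c / u H, H + c / u H[%classic).
  by rewrite -(far_set c H (u0 H)).
have := aff_half (prob01 (H0, s0)) (prob01 (H1, s1)) half.
rewrite le_max => /orP[] hp.
  apply: (sup_ge (H0, s0) D0) => /=; rewrite far preimage_setC.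
  rewrite probability_setC; last exact: (mest _ mB).
  rewrite -/B -(fineK (fin_num_measure (P n (H0, s0)) _ (mest _ mB))) -EFinB lee_fin.
  exact: hp.
apply: (sup_ge (H1, s1) D1) => /=; rewrite far.
apply: (@le_trans _ _ (P n (H1, s1) (est @^-1` B))).
  by rewrite -(fineK (fin_num_measure (P n (H1, s1)) _ (mest _ mB))) lee_fin.
apply: le_measure; rewrite ?inE; [exact: (mest _ mB)|exact: (mest _ (measurableC (measurable_itv _)))|].
rewrite -far => w; rewrite /B /= in_itv/= -ltr_distl => hw.
have cx : c / u H0 = c * x.
  apply: (mulIf (lt0r_neq0 (u0 H0))).
  by rewrite divfK ?(lt0r_neq0 (u0 H0))// -mulrA xu mulr1.
rewrite cx in hw.
(* The parameters are 2 c x apart and B has radius c x, so an estimate in B is at least c x away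
   from H1. *)
have d1 : c * x <= `|est w - H1|.
  move: hw; rewrite ltr_norml => /andP[hw _].
  by apply: le_trans (ler_norm _); rewrite /H1; lra.
have H10 : H1 <= H0 by rewrite /H1 gerBl mulr_ge0 ?(ltW x0)// mulr_ge0// ltW.
(* This is why H1 lies below H0: its rate is the larger one, so a distance of c x is enough there
   too. *)
have uu : u H0 <= u H1.
  apply: powR_gt0_le => //; rewrite !div1r lef_pV2 ?posrE ?lerD2r ?ler_pM2l//.
  - by rewrite addr_gt0// mulr_gt0//; clear - hHl hH1l; lra.
  - by rewrite addr_gt0// mulr_gt0//; clear - hHl hH1l; lra.
apply: (@le_trans _ _ (u H0 * (c * x))); last by rewrite ler_pM// ?ltW// mulr_gt0.
by rewrite mulrCA [u H0 * x]mulrC xu mulr1.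
Qed.
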